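(* Let $p\ge 2$. The triangulated category $\underline{\tilde{\mathcal{S}}}(p)$ is Calabi-Yau of fractional Calabi-Yau dimension $d_p$ given as follows: $$d_2=\frac{1}{3}\quad(=1-2\chi_{\mathbb{X}}),\qquad d_p=\frac{\mathrm{lcm}(3,p)\cdot(1-2\chi_{\mathbb{X}})}{\mathrm{lcm}(3,p)}\quad\text{for } p\geq 3.$$ Here $\chi_{\mathbb{X}}=\frac1p-\frac16=\frac{6-p}{6p}$ is the Euler characteristic of $\mathbb{X}=\mathbb{X}(2,3,p)$, and $1-2\chi_{\mathbb{X}}=\frac{4p-6}{3p}$.
   Context: Let $k$ be a field. $\tilde{\mathcal{S}}(p)$ is the category of monomorphisms $U\hookrightarrow M$ of finite dimensional $\mathbb{Z}$-graded $k[x]/(x^p)$-modules ($\deg x=1$), viewed as full extension-closed subcategory of the abelian category of all morphisms $U\to M$ of such modules; with the inherited exact structure it is a Frobenius category, its projective-injectives being the projectives of that abelian category, and $\underline{\tilde{\mathcal{S}}}(p)$ is its triangulated stable category; it has Serre duality. For a triangulated category $\mathcal{T}$ with Serre duality and Serre functor $\mathbb{S}$, assume there exists a smallest integer $n\ge1$ such that there is an isomorphism of functors $\mathbb{S}^n\cong[m]$ for some integer $m$, where $[m]$ is the $m$-fold suspension. Then $\mathcal{T}$ is called Calabi-Yau of fractional CY-dimension $\frac{m}{n}$. The ''fraction'' $\frac mn$ is kept in uncancelled format, i.e. it records the pair $(m,n)$. *)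

(* Defs.v *)
From HB Require Import structures.
From mathcomp Require Import all_boot all_order all_algebra.
From mathcomp Require Import boolp.
Set Implicit Arguments.
Unset Strict Implicit.
Unset Printing Implicit Defensive.
Import GRing.Theory.
Local Open Scope ring_scope.
#[local] Obligation Tactic := idtac.

Record lincat (k : fieldType) := Lincat {
  ob :> Type;
  hom : ob -> ob -> lmodType k;
  idm : forall X, hom X X;
  comp : forall X Y Z, hom Y Z -> hom X Y -> hom X Z;
  compA : forall W X Y Z (h : hom Y Z) (g : hom X Y) (f : hom W X),
    comp h (comp g f) = comp (comp h g) f;
  comp1f : forall X Y (f : hom X Y), comp (idm Y) f = f;
  compf1 : forall X Y (f : hom X Y), comp f (idm X) = f;
  comp_linl : forall X Y Z (f : hom X Y), linear (fun g : hom Y Z => comp g f);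
  comp_linr : forall X Y Z (g : hom Y Z), linear (fun f : hom X Y => comp g f)
}.
Arguments idm {k} {_} X.

Section LincatTheory.
Variables (k : fieldType) (C : lincat k).

Lemma compDl (X Y Z : C) (g g' : hom Y Z) (f : hom X Y) :
  comp (g + g') f = comp g f + comp g' f.
Proof. by have := comp_linl f 1 g g'; rewrite !scale1r. Qed.

Lemma compDr (X Y Z : C) (g : hom Y Z) (f f' : hom X Y) :
  comp g (f + f') = comp g f + comp g f'.
Proof. by have := comp_linr g 1 f f'; rewrite !scale1r. Qed.

Lemma comp0l (X Y Z : C) (f : hom X Y) : comp (0 : hom Y Z) f = 0.
Proof. by apply: (addIr (comp 0 f)); rewrite -compDl !add0r. Qed.

Lemma comp0r (X Y Z : C) (g : hom Y Z) : comp g (0 : hom X Y) = 0.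
Proof. by apply: (addIr (comp g 0)); rewrite -compDr !add0r. Qed.

Lemma compZl (X Y Z : C) a (g : hom Y Z) (f : hom X Y) :
  comp (a *: g) f = a *: comp g f.
Proof. by have := comp_linl f a g 0; rewrite comp0l !addr0. Qed.

Lemma compZr (X Y Z : C) a (g : hom Y Z) (f : hom X Y) :
  comp g (a *: f) = a *: comp g f.
Proof. by have := comp_linr g a f 0; rewrite comp0r !addr0. Qed.

Lemma compBl (X Y Z : C) (g g' : hom Y Z) (f : hom X Y) :
  comp (g - g') f = comp g f - comp g' f.
Proof. by rewrite -scaleN1r compDl compZl scaleN1r. Qed.

Lemma compBr (X Y Z : C) (g : hom Y Z) (f f' : hom X Y) :
  comp g (f - f') = comp g f - comp g f'.
Proof. by rewrite -scaleN1r compDr compZr scaleN1r. Qed.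

Definition is_iso (X Y : C) (f : hom X Y) : Prop :=
  exists g : hom Y X, comp g f = idm X /\ comp f g = idm Y.

End LincatTheory.

Record functor (k : fieldType) (C D : lincat k) := Functor {
  fob :> C -> D;
  fmap : forall X Y : C, hom X Y -> hom (fob X) (fob Y);
  fmap_lin : forall X Y, linear (@fmap X Y);
  fmap_id : forall X, fmap (idm X) = idm (fob X);
  fmap_comp : forall X Y Z (g : hom Y Z) (f : hom X Y),
    fmap (comp g f) = comp (fmap g) (fmap f)
}.

Section Functors.
Variables (k : fieldType) (C : lincat k).

Program Definition idF : functor C C :=
  @Functor k C C (fun X => X) (fun X Y f => f) _ _ _.
Next Obligation. by []. Qed.
Next Obligation. by []. Qed.
Next Obligation. by []. Qed.

Program Definition compF (G F : functor C C) : functor C C :=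
  @Functor k C C (fun X => G (F X)) (fun X Y f => fmap G (fmap F f)) _ _ _.
Next Obligation. by move=> G F X Y a f g; rewrite !fmap_lin. Qed.
Next Obligation. by move=> G F X /=; rewrite !fmap_id. Qed.
Next Obligation. by move=> G F X Y Z g f /=; rewrite !fmap_comp. Qed.

Definition nat_iso (F G : functor C C) : Prop :=
  exists t : forall X : C, hom (F X) (G X),
    (forall X, is_iso (t X)) /\
    (forall (X Y : C) (f : hom X Y),
        comp (fmap G f) (t X) = comp (t Y) (fmap F f)).

Record autoequiv := Autoequiv {
  aeF :> functor C C;
  aeG : functor C C;
  aeFG : nat_iso (compF aeF aeG) idF;
  aeGF : nat_iso (compF aeG aeF) idF
}.

Definition fpow (F : functor C C) (n : nat) : functor C C :=
  iter n (compF F) idF.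

Definition aepow (E : autoequiv) (m : int) : functor C C :=
  match m with
  | Posz n => fpow E n
  | Negz n => fpow (aeG E) n.+1
  end.

(** [eta X Y] is an isomorphism from [Hom(X, Y)] onto the dual of
    [Hom(Y, S X)], natural in both variables. *)
Definition is_serre (S : autoequiv) : Prop :=
  exists eta : forall X Y : C, hom X Y -> {scalar (hom Y (S X))},
    [/\ forall X Y a (f f' : hom X Y) g,
          eta X Y (a *: f + f') g = a * eta X Y f g + eta X Y f' g,
        forall X Y (phi : {scalar (hom Y (S X))}),
          exists! f : hom X Y, eta X Y f =1 phi,
        forall X Y Y' (h : hom Y Y') (f : hom X Y) (g : hom Y' (S X)),
          eta X Y' (comp h f) g = eta X Y f (comp g h)
      & forall X X' Y (e : hom X' X) (f : hom X Y) (g : hom Y (S X')),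
          eta X' Y (comp f e) g = eta X Y f (comp (fmap S e) g)].

(** Fractional Calabi-Yau dimension [m / n], the fraction being kept
    uncancelled; [Sg] is the suspension. *)
Definition fractional_CY (Sg : autoequiv) (m : int) (n : nat) : Prop :=
  exists S : autoequiv,
    [/\ is_serre S, (1 <= n)%N, nat_iso (fpow S n) (aepow Sg m)
      & forall (n' : nat) (m' : int), (1 <= n')%N ->
          nat_iso (fpow S n') (aepow Sg m') -> (n <= n')%N].

End Functors.

Record ideal (k : fieldType) (C : lincat k) := Ideal {
  inI : forall X Y : C, hom X Y -> Prop;
  inI0 : forall X Y, inI (0 : hom X Y);
  inID : forall X Y (f g : hom X Y), inI f -> inI g -> inI (f + g);
  inIZ : forall X Y a (f : hom X Y), inI f -> inI (a *: f);
  inIl : forall X Y Z (g : hom Y Z) (f : hom X Y), inI f -> inI (comp g f);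
  inIr : forall X Y Z (g : hom Y Z) (f : hom X Y), inI g -> inI (comp g f)
}.

Section Quotient.
Variables (k : fieldType) (C : lincat k) (I : ideal C).
Local Open Scope quotient_scope.

Section Hom.
Variables (X Y : C).

Definition ipred : {pred hom X Y} := fun f => `[< inI I f >].

Lemma ipredP f : (f \in ipred) <-> inI I f.
Proof. by split => [/asboolP|/asboolP]. Qed.

Lemma ipred_zmod : zmod_closed ipred.
Proof.
split=> [|f g /ipredP If /ipredP Ig]; apply/ipredP; first exact: inI0.
by apply: inID => //; rewrite -scaleN1r; apply: inIZ.
Qed.

HB.instance Definition _ := GRing.isZmodClosed.Build _ ipred ipred_zmod.

Definition qhom : Type := Quotient.quot ipred.
HB.instance Definition _ := GRing.Zmodule.on qhom.

Definition qcl (f : hom X Y) : qhom := \pi_(Quotient.quot ipred) f.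
Definition qrepr (f : qhom) : hom X Y := repr (f : Quotient.quot ipred).

Lemma qreprK f : qcl (qrepr f) = f. Proof. exact: reprK. Qed.

Lemma qclE f g : qcl f = qcl g <-> inI I (f - g).
Proof.
split=> [/eqP|/ipredP]; last by rewrite Quotient.idealrBE => /eqP.
by rewrite /qcl -Quotient.idealrBE => /ipredP.
Qed.

Lemma qclD f g : qcl (f + g) = qcl f + qcl g.
Proof. exact: Quotient.pi_add. Qed.

Definition qscale (a : k) (f : qhom) : qhom := qcl (a *: qrepr f).

Lemma qclZ a f : qcl (a *: f) = qscale a (qcl f).
Proof.
by apply/qclE; rewrite -scalerBr; apply/inIZ/qclE; rewrite qreprK.
Qed.

Fact qscaleA a b f : qscale a (qscale b f) = qscale (a * b) f.
Proof. by rewrite -(qreprK f) -!qclZ scalerA. Qed.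
Fact qscale1 : left_id 1 qscale.
Proof. by move=> f; rewrite -(qreprK f) -qclZ scale1r. Qed.
Fact qscaleDr : right_distributive qscale +%R.
Proof.
by move=> a f g; rewrite -(qreprK f) -(qreprK g) -qclD -!qclZ scalerDr qclD.
Qed.
Fact qscaleDl f : {morph qscale^~ f : a b / a + b}.
Proof. by move=> a b; rewrite -(qreprK f) -!qclZ scalerDl qclD. Qed.

HB.instance Definition _ :=
  GRing.Zmodule_isLmodule.Build k qhom qscaleA qscale1 qscaleDr qscaleDl.

Lemma qcl_linear : linear qcl.
Proof. by move=> a f g; rewrite qclD qclZ. Qed.

End Hom.

Definition qcomp (X Y Z : C) (g : qhom Y Z) (f : qhom X Y) : qhom X Z :=
  qcl (comp (qrepr g) (qrepr f)).

Lemma qcl_comp (X Y Z : C) (g : hom Y Z) (f : hom X Y) :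
  qcl (comp g f) = qcomp (qcl g) (qcl f).
Proof.
apply/qclE; rewrite -(subrKA (comp (qrepr (qcl g)) f)) -compBl -compBr.
by apply: inID; [apply: inIr | apply: inIl]; apply/qclE; rewrite qreprK.
Qed.

Fact qcompA (W X Y Z : C) (h : qhom Y Z) (g : qhom X Y) (f : qhom W X) :
  qcomp h (qcomp g f) = qcomp (qcomp h g) f.
Proof.
by rewrite -(qreprK h) -(qreprK g) -(qreprK f) -!qcl_comp compA.
Qed.

Fact qcomp1f (X Y : C) (f : qhom X Y) : qcomp (qcl (idm Y)) f = f.
Proof. by rewrite -(qreprK f) -qcl_comp comp1f. Qed.

Fact qcompf1 (X Y : C) (f : qhom X Y) : qcomp f (qcl (idm X)) = f.
Proof. by rewrite -(qreprK f) -qcl_comp compf1. Qed.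

Fact qcomp_linl (X Y Z : C) (f : qhom X Y) :
  linear (fun g : qhom Y Z => qcomp g f).
Proof.
move=> a g h; rewrite -(qreprK f) -(qreprK g) -(qreprK h).
by rewrite -qcl_linear -!qcl_comp comp_linl qcl_linear.
Qed.

Fact qcomp_linr (X Y Z : C) (g : qhom Y Z) :
  linear (fun f : qhom X Y => qcomp g f).
Proof.
move=> a f h; rewrite -(qreprK f) -(qreprK g) -(qreprK h).
by rewrite -qcl_linear -!qcl_comp comp_linr qcl_linear.
Qed.

Definition quotcat : lincat k := @Lincat k C (fun X Y => qhom X Y)
  (fun X => qcl (idm X)) qcomp qcompA qcomp1f qcompf1 qcomp_linl qcomp_linr.

End Quotient.

(** An additive category with a class of conflations (the short exact
    sequences of an exact structure).  The axioms of exact and Frobenius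
    categories are not part of the record: they enter neither the definition
    of the stable category nor that of its suspension. *)
Record conflcat (k : fieldType) := Conflcat {
  ccat :> lincat k;
  confl : forall X Y Z : ccat, hom X Y -> hom Y Z -> Prop;
  cc_zero : exists Z : ccat, idm Z = 0;
  cc_biprod : forall X1 X2 : ccat, exists (Z : ccat)
      (i1 : hom X1 Z) (i2 : hom X2 Z) (p1 : hom Z X1) (p2 : hom Z X2),
    [/\ comp p1 i1 = idm X1, comp p2 i2 = idm X2, comp p1 i2 = 0,
        comp p2 i1 = 0 & comp i1 p1 + comp i2 p2 = idm Z]
}.

Section Stable.
Variables (k : fieldType) (E : conflcat k).

Definition projective (P : E) : Prop :=
  forall (X Y Z : E) (i : hom X Y) (q : hom Y Z), confl i q ->
  forall f : hom P Z, exists g : hom P Y, comp q g = f.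

Definition injective_obj (J : E) : Prop :=
  forall (X Y Z : E) (i : hom X Y) (q : hom Y Z), confl i q ->
  forall f : hom X J, exists g : hom Y J, comp g i = f.

Definition projinj (P : E) : Prop := projective P /\ injective_obj P.

Definition stably_zero (X Y : E) (f : hom X Y) : Prop :=
  exists (P : E) (h : hom P Y) (g : hom X P), projinj P /\ f = comp h g.

Fact stably_zero0 (X Y : E) : stably_zero (0 : hom X Y).
Proof.
have [Z Z0] := cc_zero E; exists Z, 0, 0; split; last by rewrite comp0l.
have homZ0 A (f : hom A Z) : f = 0 by rewrite -(comp1f f) Z0 comp0l.
have hom0Z A (f : hom Z A) : f = 0 by rewrite -(compf1 f) Z0 comp0r.
by split=> A B D i q _ f; exists 0; rewrite ?comp0l ?comp0r // (homZ0, hom0Z).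
Qed.

Fact stably_zeroD (X Y : E) (f g : hom X Y) :
  stably_zero f -> stably_zero g -> stably_zero (f + g).
Proof.
move=> [P1 [h1 [g1 [[pP1 iP1] ->]]]] [P2 [h2 [g2 [[pP2 iP2] ->]]]].
have [P [i1 [i2 [p1 [p2 [p1i1 p2i2 p1i2 p2i1 sum1]]]]]] := cc_biprod P1 P2.
exists P, (comp h1 p1 + comp h2 p2), (comp i1 g1 + comp i2 g2); split.
  split=> A B D i q iq u.
    have [v1 qv1] := pP1 _ _ _ _ _ iq (comp u i1).
    have [v2 qv2] := pP2 _ _ _ _ _ iq (comp u i2).
    exists (comp v1 p1 + comp v2 p2).
    by rewrite compDr !compA qv1 qv2 -!compA -compDr sum1 compf1.
  have [v1 v1i] := iP1 _ _ _ _ _ iq (comp p1 u).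
  have [v2 v2i] := iP2 _ _ _ _ _ iq (comp p2 u).
  exists (comp i1 v1 + comp i2 v2).
  by rewrite compDl -!compA v1i v2i !compA -compDl sum1 comp1f.
rewrite compDl !compDr -!compA !(compA p1) !(compA p2).
by rewrite p1i1 p2i2 p1i2 p2i1 !comp0l !comp0r !comp1f addr0 add0r.
Qed.

Fact stably_zeroZ (X Y : E) a (f : hom X Y) :
  stably_zero f -> stably_zero (a *: f).
Proof.
by move=> [P [h [g [PP ->]]]]; exists P, (a *: h), g; rewrite compZl.
Qed.

Fact stably_zerol (X Y Z : E) (g : hom Y Z) (f : hom X Y) :
  stably_zero f -> stably_zero (comp g f).
Proof.
by move=> [P [h [u [PP ->]]]]; exists P, (comp g h), u; rewrite compA.
Qed.

Fact stably_zeror (X Y Z : E) (g : hom Y Z) (f : hom X Y) :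
  stably_zero g -> stably_zero (comp g f).
Proof.
by move=> [P [h [u [PP ->]]]]; exists P, h, (comp u f); rewrite compA.
Qed.

Definition stable_ideal : ideal E :=
  Ideal stably_zero0 stably_zeroD stably_zeroZ stably_zerol stably_zeror.

Definition stable : lincat k := quotcat stable_ideal.

Definition scl (X Y : E) (f : hom X Y) : hom (X : stable) (Y : stable) :=
  qcl stable_ideal f.

(** [Sg] sends [X] to the third term of a chosen conflation
    [X -> J X -> Sg X] with [J X] projective-injective, and the class of
    [f : X -> Y] to the class of any [b] completing [f] to a morphism
    [(f, a, b)] of the chosen conflations. *)
Definition is_suspension (Sg : autoequiv stable) : Prop :=
  exists (J : E -> E) (i : forall X : E, hom X (J X))
         (q : forall X : E, hom (J X) (Sg X : E)),
    (forall X : E, projinj (J X) /\ confl (i X) (q X)) /\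
    (forall (X Y : E) (f : hom X Y) (a : hom (J X) (J Y))
            (b : hom (Sg X : E) (Sg Y : E)),
        comp a (i X) = comp (i Y) f -> comp b (q X) = comp (q Y) a ->
        fmap Sg (scl f) = scl b).

End Stable.

Section Smono.
Variables (k : fieldType) (p : nat).

(** A finite dimensional [int]-graded [k[x]/(x^p)]-module, [deg x = 1]: [gr d]
    is the component of degree [d] and [grx] the action of [x]. *)
Record grmod := Grmod {
  gsp :> vectType k;
  gr : int -> {vspace gsp};
  grx : 'End(gsp);
  gr_direct : exists r : seq int,
    [/\ uniq r, forall d, d \notin r -> gr d = 0%VS,
        (\sum_(d <- r) gr d)%VS = fullv & directv (\sum_(d <- r) gr d)];
  grx_deg : forall d, (grx @: gr d <= gr (d + 1))%VS;
  grx_nil : forall v, iter p grx v = 0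
}.

Definition is_grhom (V W : grmod) (f : 'Hom(V, W)) : Prop :=
  (forall d, (f @: gr V d <= gr W d)%VS) /\ (f \o grx V = grx W \o f)%VF.

Record smono := Smono {
  sU : grmod;
  sM : grmod;
  sf : 'Hom(sU, sM);
  sf_hom : is_grhom sf;
  sf_mono : lker sf = 0%VS
}.

Section Hom.
Variables X Y : smono.

Definition is_smor (f : 'Hom(sU X, sU Y) * 'Hom(sM X, sM Y)) : Prop :=
  [/\ is_grhom f.1, is_grhom f.2 & (f.2 \o sf X = sf Y \o f.1)%VF].

Definition smor_pred : {pred 'Hom(sU X, sU Y) * 'Hom(sM X, sM Y)} :=
  fun f => `[< is_smor f >].

Fact is_grhom_lin (V W : grmod) a (f g : 'Hom(V, W)) :
  is_grhom f -> is_grhom g -> is_grhom (a *: f + g).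
Proof.
move=> [fd fx] [gd gx]; split=> [d|].
  apply/subvP=> _ /memv_imgP[v Vv ->]; rewrite lfunE /= lfunE /=.
  by apply/rpredD; [apply/rpredZ/(subvP (fd d)) | apply/(subvP (gd d))];
    apply: memv_img.
by rewrite comp_lfunDl comp_lfunDr -comp_lfunZl -comp_lfunZr fx gx.
Qed.

Fact is_grhom0 (V W : grmod) : is_grhom (0 : 'Hom(V, W)).
Proof.
by split=> [d|]; rewrite ?lim0g ?sub0v // comp_lfun0l comp_lfun0r.
Qed.

Fact smor_submod : submod_closed smor_pred.
Proof.
split; first by apply/asboolP; split; rewrite ?comp_lfun0l ?comp_lfun0r //;
  apply: is_grhom0.
move=> a f g /asboolP[f1 f2 ff] /asboolP[g1 g2 gg]; apply/asboolP.
split=> /=; try exact: is_grhom_lin.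
by rewrite comp_lfunDl comp_lfunDr -comp_lfunZl -comp_lfunZr ff gg.
Qed.

Record smor := Smor { smorval :> 'Hom(sU X, sU Y) * 'Hom(sM X, sM Y);
                      smorP : smorval \in smor_pred }.

HB.instance Definition _ := [isSub for smorval].
HB.instance Definition _ := [Choice of smor by <:].
HB.instance Definition _ :=
  GRing.SubChoice_isSubLmodule.Build k _ smor_pred smor smor_submod.

End Hom.

Lemma smorE (X Y : smono) (f : smor X Y) : is_smor f.
Proof. exact/asboolP/smorP. Qed.

Definition mk_smor (X Y : smono) (f : 'Hom(sU X, sU Y) * 'Hom(sM X, sM Y))
  (fP : is_smor f) : smor X Y := Smor (introT (asboolP _) fP).

Fact is_grhom1 (V : grmod) : is_grhom (\1%VF : 'End(V)).
Proof. by split=> [d|]; rewrite ?lim1g // comp_lfun1l comp_lfun1r. Qed.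

Fact is_grhom_comp (U V W : grmod) (g : 'Hom(V, W)) (f : 'Hom(U, V)) :
  is_grhom g -> is_grhom f -> is_grhom (g \o f)%VF.
Proof.
move=> [gd gx] [fd fx]; split=> [d|].
  by rewrite limg_comp (subv_trans (limgS _ (fd d))).
by rewrite -comp_lfunA fx comp_lfunA gx comp_lfunA.
Qed.

Fact smor_id_proof (X : smono) : is_smor (\1%VF : 'End(sU X), \1%VF : 'End(sM X)).
Proof.
by split; rewrite /= ?comp_lfun1l ?comp_lfun1r //; apply: is_grhom1.
Qed.

Definition smor_id (X : smono) : smor X X := mk_smor (smor_id_proof X).

Fact smor_comp_proof (X Y Z : smono) (g : smor Y Z) (f : smor X Y) :
  is_smor ((g.1 \o f.1)%VF, (g.2 \o f.2)%VF).
Proof.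
have [g1 g2 gg] := smorE g; have [f1 f2 ff] := smorE f.
split=> /=; try exact: is_grhom_comp.
by rewrite -comp_lfunA ff comp_lfunA gg comp_lfunA.
Qed.

Definition smor_comp (X Y Z : smono) (g : smor Y Z) (f : smor X Y) : smor X Z :=
  mk_smor (smor_comp_proof g f).

Lemma smor_eq (X Y : smono) (f g : smor X Y) :
  f.1 = g.1 -> f.2 = g.2 -> f = g.
Proof.
by case: f g => [[f1 f2] fP] [[g1 g2] gP] /= e1 e2; apply: val_inj => /=; congr pair.
Qed.

Program Definition smono_lincat : lincat k :=
  @Lincat k smono (fun X Y => smor X Y) smor_id smor_comp _ _ _ _ _.
Next Obligation. by move=> *; apply: smor_eq => /=; rewrite comp_lfunA. Qed.
Next Obligation. by move=> *; apply: smor_eq => /=; rewrite comp_lfun1l. Qed.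
Next Obligation. by move=> *; apply: smor_eq => /=; rewrite comp_lfun1r. Qed.
Next Obligation.
by move=> X Y Z f a g h; apply: smor_eq => /=;
  rewrite comp_lfunDl comp_lfunZl.
Qed.
Next Obligation.
by move=> X Y Z f a g h; apply: smor_eq => /=;
  rewrite comp_lfunDr comp_lfunZr.
Qed.

Definition short_exact (A B C : vectType k) (i : 'Hom(A, B)) (q : 'Hom(B, C)) :
    Prop :=
  [/\ lker i = 0%VS, limg i = lker q & limg q = fullv].

(** The exact structure inherited from the abelian category of all morphisms
    [U -> M], where exactness is componentwise. *)
Definition smono_confl (X Y Z : smono_lincat) (i : hom X Y) (q : hom Y Z) :
    Prop :=
  short_exact (smorval i).1 (smorval q).1 /\
  short_exact (smorval i).2 (smorval q).2.

Program Definition grmod0 : grmod :=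
  @Grmod ('rV[k]_0 : vectType k) (fun=> 0%VS) 0 _ _ _.
Next Obligation.
have v0 : fullv = 0%VS :> {vspace 'rV[k]_0}.
  by apply/eqP; rewrite -dimv_eq0 dimvf /dim /=.
exists [::]; split=> //; rewrite ?big_nil ?v0 //.
by rewrite directvE /= !big_nil dimv0.
Qed.
Next Obligation. by move=> d; rewrite lim0g sub0v. Qed.
Next Obligation. by move=> v; rewrite [LHS]thinmx0. Qed.

Lemma gr_widen (V : grmod) : exists r : seq int, forall r' : seq int,
  uniq r' -> {subset r <= r'} ->
  (\sum_(d <- r') gr V d)%VS = fullv /\
  (\sum_(d <- r') \dim (gr V d))%N = \dim {:V}.
Proof.
have [r [Ur r0 rs /=]] := gr_direct V; rewrite directvE /= rs => /eqP rd.
exists r => r' Ur' sub.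
have rr' : perm_eq [seq d <- r' | d \in r] r.
  apply: uniq_perm; rewrite ?filter_uniq // => d; rewrite mem_filter.
  by case: (boolP (d \in r)) => //= /sub.
split.
  rewrite (bigID (fun d => d \in r)) /= [X in (_ + X)%VS]big1 => [|d /r0 //].
  by rewrite addv0 -big_filter (perm_big _ rr').
rewrite (bigID (fun d => d \in r)) /= [X in (_ + X)%N]big1 => [|d /r0->].
  by rewrite addn0 -big_filter (perm_big _ rr') rd.
exact: dimv0.
Qed.

Section Biproduct.

Section Spaces.
Variables V W : vectType k.

Definition inl_fun (v : V) : (V * W)%type := (v, 0).
Definition inr_fun (w : W) : (V * W)%type := (0, w).
Fact inl_linear : linear inl_fun.
Proof. by move=> a u v; congr pair; rewrite /= scaler0 addr0. Qed.
Fact inr_linear : linear inr_fun.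
Proof. by move=> a u v; congr pair; rewrite /= scaler0 addr0. Qed.
HB.instance Definition _ := GRing.isLinear.Build k V (V * W)%type _ inl_fun inl_linear.
HB.instance Definition _ := GRing.isLinear.Build k W (V * W)%type _ inr_fun inr_linear.

Definition linl : 'Hom(V, (V * W)%type) := linfun inl_fun.
Definition linr : 'Hom(W, (V * W)%type) := linfun inr_fun.
Definition lfst : 'Hom((V * W)%type, V) := linfun fst.
Definition lsnd : 'Hom((V * W)%type, W) := linfun snd.

Lemma lfst_inl v : lfst (linl v) = v. Proof. by rewrite !lfunE. Qed.
Lemma lfst_inr w : lfst (linr w) = 0. Proof. by rewrite !lfunE. Qed.
Lemma lsnd_inl v : lsnd (linl v) = 0. Proof. by rewrite !lfunE. Qed.
Lemma lsnd_inr w : lsnd (linr w) = w. Proof. by rewrite !lfunE. Qed.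
Lemma linl_inr u : linl (lfst u) + linr (lsnd u) = u.
Proof.
by rewrite !lfunE; case: u => v w; congr pair; rewrite /= ?addr0 ?add0r.
Qed.
Lemma lfst_sum v w : lfst (linl v + linr w) = v.
Proof. by rewrite linearD /= lfst_inl lfst_inr addr0. Qed.
Lemma lsnd_sum v w : lsnd (linl v + linr w) = w.
Proof. by rewrite linearD /= lsnd_inl lsnd_inr add0r. Qed.
End Spaces.

Lemma dim_linlr (V W : vectType k) (A : {vspace V}) (B : {vspace W}) :
  \dim (linl V W @: A + linr V W @: B)%VS = (\dim A + \dim B)%N.
Proof.
rewrite dimv_disjoint_sum.
  rewrite !limg_dim_eq //; apply/eqP; rewrite -subv0; apply/subvP => v;
    rewrite memv_cap memv_ker memv0 => /andP[_ /eqP e].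
    by rewrite -[v](lsnd_inr V) e linear0.
  by rewrite -[v](lfst_inl W) e linear0.
apply/eqP; rewrite -subv0; apply/subvP => u; rewrite memv_cap memv0.
case/andP=> /memv_imgP[v _ ->] /memv_imgP[w _ e].
by rewrite -[v](lfst_inl W) e lfst_inr linear0.
Qed.

Definition lsum (V V' W W' : vectType k) (f : 'Hom(V, V')) (g : 'Hom(W, W')) :
    'Hom((V * W)%type, (V' * W')%type) :=
  (linl V' W' \o f \o lfst V W)%VF + (linr V' W' \o g \o lsnd V W)%VF.

Lemma lsumE (V V' W W' : vectType k) (f : 'Hom(V, V')) (g : 'Hom(W, W')) u :
  lsum f g u = linl V' W' (f (lfst V W u)) + linr V' W' (g (lsnd V W u)).
Proof. by rewrite add_lfunE !comp_lfunE. Qed.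

Variables V W : grmod.

Program Definition grsum : grmod :=
  @Grmod (V * W)%type
    (fun d => linl V W @: gr V d + linr V W @: gr W d)%VS
    (lsum (grx V) (grx W)) _ _ _.
Next Obligation.
have [r1 r1P] := gr_widen V; have [r2 r2P] := gr_widen W.
have [s1 [_ s10 _ _]] := gr_direct V; have [s2 [_ s20 _ _]] := gr_direct W.
pose r := undup (r1 ++ r2 ++ s1 ++ s2).
have Ur : uniq r by rewrite undup_uniq.
have [|S1 D1] := r1P r Ur.
  by move=> d dr; rewrite mem_undup !mem_cat dr.
have [|S2 D2] := r2P r Ur.
  by move=> d dr; rewrite mem_undup !mem_cat dr orbT.
have S : (\sum_(d <- r) (linl V W @: gr V d + linr V W @: gr W d))%VS = fullv.
  rewrite big_split /= -!limg_sum S1 S2; apply/eqP; rewrite eqEsubv subvf /=.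
  apply/subvP=> u _.
  by rewrite -[u]linl_inr memv_add // memv_img // memvf.
exists r; split=> //.
  move=> d; rewrite mem_undup !mem_cat !negb_or => /and4P[_ _ d1 d2].
  by rewrite s10 // s20 // !limg0 addv0.
rewrite directvE /= S; under eq_bigr do rewrite dim_linlr.
by rewrite big_split /= D1 D2 !dimvf.
Qed.
Next Obligation.
move=> d; apply/subvP=> _ /memv_imgP[_ /memv_addP[_ /memv_imgP[v Vv ->]
  [_ /memv_imgP[w Ww ->] ->]] ->].
rewrite lsumE lfst_sum lsnd_sum.
by apply: memv_add; apply: memv_img; [apply: (subvP (grx_deg V d)) |
  apply: (subvP (grx_deg W d))]; apply: memv_img.
Qed.
Next Obligation.
move=> u.
have -> n : iter n (lsum (grx V) (grx W)) u =
    linl V W (iter n (grx V) (lfst V W u)) +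
    linr V W (iter n (grx W) (lsnd V W u)).
  elim: n => [|n IHn] /=; first by rewrite linl_inr.
  by rewrite IHn lsumE lfst_sum lsnd_sum.
by rewrite !grx_nil !linear0 addr0.
Qed.

Lemma linl_grhom : is_grhom (linl V W : 'Hom(V, grsum)).
Proof.
split=> [d|]; first exact: addvSl.
apply/lfunP=> v; rewrite !comp_lfunE lsumE.
by rewrite lfst_inl lsnd_inl !linear0 addr0.
Qed.

Lemma linr_grhom : is_grhom (linr V W : 'Hom(W, grsum)).
Proof.
split=> [d|]; first exact: addvSr.
apply/lfunP=> v; rewrite !comp_lfunE lsumE.
by rewrite lfst_inr lsnd_inr !linear0 add0r.
Qed.

Lemma lfst_grhom : is_grhom (lfst V W : 'Hom(grsum, V)).
Proof.
split=> [d|].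
  apply/subvP=> _ /memv_imgP[_ /memv_addP[_ /memv_imgP[v Vv ->]
    [_ /memv_imgP[w Ww ->] ->]] ->].
  by rewrite lfst_sum.
by apply/lfunP=> v; rewrite !comp_lfunE lsumE lfst_sum.
Qed.

Lemma lsnd_grhom : is_grhom (lsnd V W : 'Hom(grsum, W)).
Proof.
split=> [d|].
  apply/subvP=> _ /memv_imgP[_ /memv_addP[_ /memv_imgP[v Vv ->]
    [_ /memv_imgP[w Ww ->] ->]] ->].
  by rewrite lsnd_sum.
by apply/lfunP=> v; rewrite !comp_lfunE lsumE lsnd_sum.
Qed.

End Biproduct.

Section SmonoSum.
Variables X Y : smono.

Program Definition smono_sum : smono :=
  @Smono (grsum (sU X) (sU Y)) (grsum (sM X) (sM Y)) (lsum (sf X) (sf Y)) _ _.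
Next Obligation.
have [Xd Xx] := sf_hom X; have [Yd Yx] := sf_hom Y.
split=> [d|].
  apply/subvP=> _ /memv_imgP[_ /memv_addP[_ /memv_imgP[v Vv ->]
    [_ /memv_imgP[w Ww ->] ->]] ->].
  rewrite lsumE lfst_sum lsnd_sum.
  by apply: memv_add; apply: memv_img; [apply: (subvP (Xd d)) |
    apply: (subvP (Yd d))]; apply: memv_img.
apply/lfunP=> u; rewrite !comp_lfunE !lsumE !lfst_sum !lsnd_sum.
by rewrite -!(comp_lfunE (sf _)) Xx Yx !comp_lfunE.
Qed.
Next Obligation.
apply/eqP; rewrite -subv0; apply/subvP => u; rewrite memv_ker memv0 lsumE.
move=> /eqP e; rewrite -[u]linl_inr.
have kX := sf_mono X; have kY := sf_mono Y.
have -> : lfst _ _ u = 0.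
  apply/eqP; rewrite -memv0 -kX memv_ker.
  by have /(congr1 (lfst _ _)) := e;
    rewrite lfst_sum linear0 => ->.
have -> : lsnd _ _ u = 0.
  apply/eqP; rewrite -memv0 -kY memv_ker.
  by have /(congr1 (lsnd _ _)) := e;
    rewrite lsnd_sum linear0 => ->.
by rewrite !linear0 addr0.
Qed.

Fact smono_inl_proof : @is_smor X smono_sum (linl (sU X) (sU Y), linl (sM X) (sM Y)).
Proof.
split=> /=; try exact: linl_grhom.
by apply/lfunP=> v; rewrite !comp_lfunE lsumE lfst_inl lsnd_inl !linear0 addr0.
Qed.

Fact smono_inr_proof : @is_smor Y smono_sum (linr (sU X) (sU Y), linr (sM X) (sM Y)).
Proof.
split=> /=; try exact: linr_grhom.
by apply/lfunP=> v; rewrite !comp_lfunE lsumE lfst_inr lsnd_inr !linear0 add0r.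
Qed.

Fact smono_fst_proof : @is_smor smono_sum X (lfst (sU X) (sU Y), lfst (sM X) (sM Y)).
Proof.
split=> /=; try exact: lfst_grhom.
by apply/lfunP=> v; rewrite !comp_lfunE lsumE lfst_sum.
Qed.

Fact smono_snd_proof : @is_smor smono_sum Y (lsnd (sU X) (sU Y), lsnd (sM X) (sM Y)).
Proof.
split=> /=; try exact: lsnd_grhom.
by apply/lfunP=> v; rewrite !comp_lfunE lsumE lsnd_sum.
Qed.

End SmonoSum.

Fact smono_has_biprod (X1 X2 : smono_lincat) : exists (Z : smono_lincat)
    (i1 : hom X1 Z) (i2 : hom X2 Z) (p1 : hom Z X1) (p2 : hom Z X2),
  [/\ comp p1 i1 = idm X1, comp p2 i2 = idm X2, comp p1 i2 = 0,
      comp p2 i1 = 0 & comp i1 p1 + comp i2 p2 = idm Z].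
Proof.
exists (smono_sum X1 X2), (mk_smor (smono_inl_proof X1 X2)),
  (mk_smor (smono_inr_proof X1 X2)), (mk_smor (smono_fst_proof X1 X2)),
  (mk_smor (smono_snd_proof X1 X2)).
split; apply: smor_eq; apply/lfunP=> v /=;
  rewrite ?add_lfunE !comp_lfunE ?id_lfunE ?zero_lfunE;
  by rewrite ?lfst_inl ?lfst_inr ?lsnd_inl ?lsnd_inr ?linl_inr.
Qed.

Program Definition smono0 : smono := @Smono grmod0 grmod0 0 (is_grhom0 _ _) _.
Next Obligation.
by apply/eqP; rewrite -subv0; apply/subvP=> v _; rewrite memv0 [v]thinmx0.
Qed.

Fact smono_has_zero : exists Z : smono_lincat, idm Z = 0.
Proof.
exists smono0; apply: smor_eq; apply/lfunP=> v /=;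
  by rewrite [v]thinmx0 !linear0.
Qed.

Definition smono_conflcat : conflcat k :=
  Conflcat smono_confl smono_has_zero smono_has_biprod.

End Smono.

Definition stable_smono (k : fieldType) (p : nat) : lincat k :=
  stable (smono_conflcat k p).

Definition euler_char (w : seq nat) : rat := 2 - \sum_(q <- w) (1 - q%:R^-1).

(* Main.v *)
From HB Require Import structures.
From mathcomp Require Import all_boot all_order all_algebra.
From mathcomp Require Import boolp zify ring.
Require Import Defs.
Set Implicit Arguments.
Unset Strict Implicit.
Unset Printing Implicit Defensive.
Import Order.TTheory GRing.Theory Num.Theory.
Import VectorInternalTheory.
#[local] Obligation Tactic := idtac.
Local Open Scope ring_scope.

(** Write [p = n + 1] and [A = k[x]/(x^p)], and describe a morphism of objects
    [U -> M] by its map on the [M]'s, as a linear map that is homogeneous of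
    degree [0], commutes with [x] and is filtered, that is, carries [U] into
    [U'].  Stable homomorphisms then become linear algebra: with
    [N phi = sum_i x^i phi x^(n-i)], a morphism is stably zero exactly when it
    is [N phi] for a filtered linear map [phi] of degree [-n]
    ([stably_zeroP]).

    Serre duality.  Let [pi : M (x) A -> M] be the multiplication and let [S]
    send [U -> M] to [ker pi -> pi^-1 U], with the grading shifted by [n].  A
    morphism [g : Y -> S X] is determined by its last component
    [hat g : M_Y -> M_X], which can be any linear map [z] of degree [0] such
    that [N z] maps [M_Y] into [U_X] and kills [U_Y].  These conditions say
    that [N z] is orthogonal to the filtered maps [X -> Y] for the trace form;
    as [N] is self-adjoint, [z] runs through the orthogonal of the stably zero
    maps.  Dually, the morphisms [X -> Y] form the orthogonal of the [hat g]
    with [g] stably zero ([stably_zero_hat]).  So the trace of [f \o hat g]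
    is a perfect pairing of stable homomorphisms ([pairing_nondegl],
    [pairing_nondegr], [pairing_surj]), and [S] is a Serre functor.

    Its cube.  [S^3 X] lies in [M (x) A (x) A (x) A], and
    [m (x) x^a (x) x^b (x) x^c |-> x^(a+b+c-p) m] restricts to a natural
    morphism [cube_mor] from [S^3 X] to the shift [X(2p-3)].  It has a section
    [theta], natural only up to homotopy because it depends on a retraction of
    [M] onto [U].  Since Serre duality makes [S] full, a natural split
    epimorphism out of [S^3] onto a faithful functor is invertible, whence
    [S^3 = (2p-3)] ([Ser3]).

    The suspension.  The conflation [X -> M (x) A -> ker pi]
    realises the suspension [Sig] as [ker pi] up to shift, while
    [ker pi -> M (x) A -> M] shows that the shift [(p)] suspends [Sig].  As
    suspensions are unique ([suspends_uniq]), [Sig^2 = (p)] and any other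
    suspension is isomorphic to [Sig].  For [p = 2] a third conflation gives
    [Sig = (1)].

    Conclusion.  If [lcm (3, p) = 3 a = p b], then
    [S^(3a) = ((2p-3) a) = (p (2a-b)) = Sig^(2(2a-b))], and [2(2a-b)] is
    [lcm (3, p)] times [(4p-6)/(3p)].  For minimality, the object [0 -> k]
    shows that [S] is never a shift, that distinct shifts are not isomorphic,
    and that for [p > 2] the suspension is not a shift; hence [S^n' = Sig^m']
    forces [3 | n'], and [p | n'] when [p > 2]. *)

(** * Functors between linear categories *)

Section FunctorCalculus.
Variables (k : fieldType) (C : lincat k).
Implicit Types (F G H K : functor C C).

Lemma is_iso_id (X : C) : is_iso (idm X).
Proof. by exists (idm X); rewrite comp1f. Qed.

Lemma is_iso_comp (X Y Z : C) (g : hom Y Z) (f : hom X Y) :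
  is_iso g -> is_iso f -> is_iso (comp g f).
Proof.
move=> [g' [g'g gg']] [f' [f'f ff']]; exists (comp f' g'); split.
  by rewrite -compA (compA g') g'g comp1f.
by rewrite -compA (compA f) ff' comp1f.
Qed.

Lemma is_iso_fmap F (X Y : C) (f : hom X Y) : is_iso f -> is_iso (fmap F f).
Proof.
by move=> [g [gf fg]]; exists (fmap F g); rewrite -!fmap_comp gf fg !fmap_id.
Qed.

Lemma nat_iso_refl F : nat_iso F F.
Proof.
exists (fun X => idm (F X)); split=> [X|X Y f]; first exact: is_iso_id.
by rewrite comp1f compf1.
Qed.

Lemma nat_iso_sym F G : nat_iso F G -> nat_iso G F.
Proof.
move=> [t [ti tn]].
have [u uP] := all_sig (fun X => cid (ti X)).
exists u; split=> [X|X Y f].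
  by exists (t X); have [] := uP X.
rewrite -(comp1f (comp _ (u X))) -(proj1 (uP Y)) -!compA (compA (t Y)) -tn.
by rewrite -!compA (proj2 (uP X)) compf1.
Qed.

Lemma nat_iso_trans F G H : nat_iso F G -> nat_iso G H -> nat_iso F H.
Proof.
move=> [t [ti tn]] [u [ui un]].
exists (fun X => comp (u X) (t X)); split=> [X|X Y f].
  exact: is_iso_comp.
by rewrite compA un -compA tn compA.
Qed.

Lemma nat_iso_comp F F' G G' :
  nat_iso F F' -> nat_iso G G' -> nat_iso (compF G F) (compF G' F').
Proof.
move=> [t [ti tn]] [u [ui un]].
exists (fun X => comp (u (F' X)) (fmap G (t X))); split=> [X|X Y f].
  by apply: is_iso_comp => //; apply: is_iso_fmap.
by rewrite /= compA un -compA -fmap_comp tn fmap_comp compA.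
Qed.

Lemma nat_iso_compl F G G' : nat_iso G G' -> nat_iso (compF G F) (compF G' F).
Proof. exact: nat_iso_comp (nat_iso_refl F). Qed.

Lemma nat_iso_compr G F F' : nat_iso F F' -> nat_iso (compF G F) (compF G F').
Proof. by move=> h; apply: nat_iso_comp h (nat_iso_refl G). Qed.

(** The two functors agree on the nose, but not as records: the identity
    transformation is used instead of an equality of functors. *)
Lemma compFA H G F : nat_iso (compF (compF H G) F) (compF H (compF G F)).
Proof.
by exists (fun X => idm _); split=> [X|X Y f]; [exact: is_iso_id | rewrite comp1f compf1].
Qed.

Lemma comp1F F : nat_iso (compF (idF C) F) F.
Proof.
by exists (fun X => idm _); split=> [X|X Y f]; [exact: is_iso_id | rewrite comp1f compf1].
Qed.

Lemma compF1 F : nat_iso (compF F (idF C)) F.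
Proof.
by exists (fun X => idm _); split=> [X|X Y f]; [exact: is_iso_id | rewrite comp1f compf1].
Qed.

Lemma fpow1 F : nat_iso (fpow F 1) F.
Proof. exact: compF1. Qed.

Lemma fpow_congr F G n : nat_iso F G -> nat_iso (fpow F n) (fpow G n).
Proof.
by move=> FG; elim: n => [|n IHn]; [exact: nat_iso_refl | exact: nat_iso_comp].
Qed.

Lemma fpowD F a b : nat_iso (compF (fpow F a) (fpow F b)) (fpow F (a + b)).
Proof.
elim: a => [|a IHa]; first exact: comp1F.
exact: nat_iso_trans (compFA _ _ _) (nat_iso_compr _ IHa).
Qed.

Lemma fpowM F a b : nat_iso (fpow (fpow F a) b) (fpow F (a * b)).
Proof.
elim: b => [|b IHb]; first by rewrite muln0; apply: nat_iso_refl.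
rewrite mulnS; apply: nat_iso_trans (fpowD _ _ _).
exact: nat_iso_compr.
Qed.

(** A left inverse [L] and a right inverse [R] are isomorphic, because both
    are isomorphic to [L F R]. *)
Lemma inverse_uniq F L R : nat_iso (compF L F) (idF C) ->
  nat_iso (compF F R) (idF C) -> nat_iso L R.
Proof.
move=> LF FR; apply: nat_iso_trans (nat_iso_sym (compF1 _)) _.
apply: nat_iso_trans (nat_iso_compr L (nat_iso_sym FR)) _.
apply: nat_iso_trans (nat_iso_sym (compFA _ _ _)) _.
exact: nat_iso_trans (nat_iso_compl _ LF) (comp1F _).
Qed.

Lemma autoequiv_of_inverses F L R : nat_iso (compF L F) (idF C) ->
  nat_iso (compF F R) (idF C) -> exists E : autoequiv C, aeF E = F.
Proof.
move=> LF FR; have LR := inverse_uniq LF FR.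
have RF := nat_iso_trans (nat_iso_compl F (nat_iso_sym LR)) LF.
by exists (Autoequiv FR RF).
Qed.

(** If a power of [F] is invertible, then so is [F]: lower powers of [F]
    provide a left and a right inverse, which agree by [inverse_uniq]. *)
Lemma autoequiv_of_pow F N T T' : nat_iso (fpow F N.+1) T ->
  nat_iso (compF T' T) (idF C) -> nat_iso (compF T T') (idF C) ->
  exists E : autoequiv C, aeF E = F.
Proof.
move=> FT T'T TT'; apply: (@autoequiv_of_inverses F (compF T' (fpow F N)) (compF (fpow F N) T')).
  apply: nat_iso_trans (compFA _ _ _) _; apply: nat_iso_trans T'T; apply: nat_iso_compr.
  apply: nat_iso_trans (nat_iso_compr _ (nat_iso_sym (fpow1 F))) _.
  by apply: nat_iso_trans (fpowD _ _ _) _; rewrite addn1.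
apply: nat_iso_trans (nat_iso_sym (compFA _ _ _)) _.
exact: nat_iso_trans (nat_iso_compl _ FT) TT'.
Qed.

Lemma faithful_of_linv F L (X Y : C) (f f' : hom X Y) :
  nat_iso (compF L F) (idF C) -> fmap F f = fmap F f' -> f = f'.
Proof.
move=> [t [ti tn]] ff'; have [u [_ tu]] := ti X.
rewrite -[f]compf1 -[f']compf1 -tu !compA.
by have /= -> := tn _ _ f; have /= -> := tn _ _ f'; rewrite ff'.
Qed.

(** Only [r] has to be natural.  By fullness the idempotent [s r] is [F e] for
    some [e]; naturality of [r] gives [G e = 1], so [e = 1] and [s r = 1]. *)
Lemma nat_iso_of_retraction F G (r : forall X : C, hom (F X) (G X)) :
  (forall (X Y : C) (g : hom (F X) (F Y)), exists f : hom X Y, fmap F f = g) ->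
  (forall (X Y : C) (f f' : hom X Y), fmap G f = fmap G f' -> f = f') ->
  (forall (X Y : C) (f : hom X Y), comp (fmap G f) (r X) = comp (r Y) (fmap F f)) ->
  (forall X, exists s : hom (G X) (F X), comp (r X) s = idm (G X)) ->
  nat_iso F G.
Proof.
move=> Ffull Gfaith rn rs; exists r; split=> // X; have [s rsK] := rs X.
exists s; split=> //; have [e eE] := Ffull _ _ (comp s (r X)).
rewrite -eE; have -> : e = idm X; last exact: fmap_id.
apply: Gfaith; rewrite fmap_id -[LHS]compf1 -rsK compA rn eE.
by rewrite compA rsK comp1f.
Qed.

End FunctorCalculus.

(** * Functors on stable categories and uniqueness of suspensions *)

Section StableFunctors.
Variables (k : fieldType) (E : conflcat k).

Lemma scl_surj (X Y : E) (f : hom (X : stable E) (Y : stable E)) :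
  exists g : hom X Y, f = scl g.
Proof. by exists (qrepr f); rewrite /scl qreprK. Qed.

Lemma scl_eq (X Y : E) (f g : hom X Y) : scl f = scl g <-> stably_zero (f - g).
Proof. exact: qclE. Qed.

Lemma scl_comp (X Y Z : E) (g : hom Y Z) (f : hom X Y) :
  scl (comp g f) = comp (scl g) (scl f).
Proof. exact: qcl_comp. Qed.

Lemma scl_id (X : E) : scl (idm X) = idm (X : stable E).
Proof. by []. Qed.

Lemma scl_lin (X Y : E) a (f g : hom X Y) : scl (a *: f + g) = a *: scl f + scl g.
Proof. exact: qcl_linear. Qed.

Lemma scl_zero (X Y : E) (f : hom X Y) : stably_zero f -> scl f = 0.
Proof.
have := scl_lin (-1) f f; rewrite !scaleN1r !addNr => <- f0.
by apply/scl_eq; rewrite subr0.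
Qed.

Section Induced.
Variable F : functor E E.
Hypothesis F0 : forall (X Y : E) (f : hom X Y), stably_zero f -> stably_zero (fmap F f).

Definition stab_map (X Y : stable E) (f : hom X Y) :
  hom (F (X : E) : stable E) (F (Y : E) : stable E) := scl (fmap F (qrepr f)).

Lemma stab_map_scl (X Y : E) (f : hom X Y) : stab_map (scl f) = scl (fmap F f).
Proof.
apply/scl_eq; rewrite -scaleN1r addrC -fmap_lin; apply: F0.
by rewrite scaleN1r addrC; apply/scl_eq; rewrite /scl qreprK.
Qed.

Fact stab_map_lin (X Y : stable E) : linear (@stab_map X Y).
Proof.
move=> a f g; have [f' ->] := scl_surj f; have [g' ->] := scl_surj g.
by rewrite -scl_lin !stab_map_scl fmap_lin scl_lin.
Qed.

Fact stab_map_id (X : stable E) : stab_map (idm X) = idm _.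
Proof. by rewrite -scl_id stab_map_scl fmap_id. Qed.

Fact stab_map_comp (X Y Z : stable E) (g : hom Y Z) (f : hom X Y) :
  stab_map (comp g f) = comp (stab_map g) (stab_map f).
Proof.
have [f' ->] := scl_surj f; have [g' ->] := scl_surj g.
by rewrite -scl_comp !stab_map_scl fmap_comp scl_comp.
Qed.

Definition stabF : functor (stable E) (stable E) :=
  @Functor k (stable E) (stable E) (fun X => F (X : E)) stab_map
    stab_map_lin stab_map_id stab_map_comp.

Lemma stabF_scl (X Y : E) (f : hom X Y) : fmap stabF (scl f) = scl (fmap F f).
Proof. exact: stab_map_scl. Qed.

End Induced.

(** These consequences of the axioms of exact categories are all that the
    uniqueness of suspensions needs: deflations are cokernels of their
    inflations. *)
Hypothesis confl_epi : forall (X Y Z W : E) (i : hom X Y) (q : hom Y Z) (a : hom Y W),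
  confl i q -> comp a i = 0 -> exists c : hom Z W, comp c q = a.
Hypothesis confl_cancel : forall (X Y Z W : E) (i : hom X Y) (q : hom Y Z) (a b : hom Z W),
  confl i q -> comp a q = comp b q -> a = b.
Hypothesis confl0 : forall (X Y Z : E) (i : hom X Y) (q : hom Y Z),
  confl i q -> comp q i = 0.

Lemma confl_lift (X J Z Y J' Z' : E) (i : hom X J) (q : hom J Z)
    (i' : hom Y J') (q' : hom J' Z') (f : hom X Y) :
  confl i q -> confl i' q' -> injective_obj J' ->
  exists (a : hom J J') (b : hom Z Z'), comp a i = comp i' f /\ comp b q = comp q' a.
Proof.
move=> c c' inj; have [a ai] := inj _ _ _ _ _ c (comp i' f).
have [|b bq] := confl_epi (a := comp q' a) c.
  by rewrite -compA ai compA (confl0 c') comp0l.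
by exists a, b.
Qed.

(** Suspending a map that factors through an injective [P] gives a map that
    factors through the deflation of the target: the factorisation extends to
    [J], where it can be subtracted. *)
Lemma confl_lift_zero (X J Z Y J' Z' : E) (i : hom X J) (q : hom J Z)
    (i' : hom Y J') (q' : hom J' Z') (f : hom X Y) a b :
  confl i q -> confl i' q' -> projinj J' -> stably_zero f ->
  comp a i = comp i' f -> comp b q = comp q' a -> stably_zero b.
Proof.
move=> c c' pJ' [P [h [g [[_ iP] ->]]]] ai bq.
have [g' g'i] := iP _ _ _ _ _ c g.
have [|e eq] := confl_epi (a := a - comp i' (comp h g')) c.
  by rewrite compBl ai -!compA g'i subrr.
exists J', q', e; split=> //; apply: (confl_cancel c).
rewrite bq -compA eq compBr [comp q' (comp i' _)]compA (confl0 c').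
by rewrite comp0l subr0.
Qed.

Lemma confl_lift_uniq (X J Z Y J' Z' : E) (i : hom X J) (q : hom J Z)
    (i' : hom Y J') (q' : hom J' Z') (f f' : hom X Y) a b a' b' :
  confl i q -> confl i' q' -> projinj J' -> scl f = scl f' ->
  comp a i = comp i' f -> comp b q = comp q' a ->
  comp a' i = comp i' f' -> comp b' q = comp q' a' -> scl b = scl b'.
Proof.
move=> c c' pJ' /scl_eq ff' ai bq ai' bq'; apply/scl_eq.
apply: (confl_lift_zero (a := a - a') c c' pJ' ff').
  by rewrite compBl ai ai' compBr.
by rewrite compBl bq bq' compBr.
Qed.

(** [F] is a suspension of [B]: functorially, [F X] is the third term of a
    conflation starting at [B X] with projective-injective middle term.
    Allowing a general [B] lets one recognise composites of suspensions. *)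
Definition suspends (B F : functor (stable E) (stable E)) : Prop :=
  exists (J : E -> E) (i : forall X : E, hom (B X : E) (J X))
         (q : forall X : E, hom (J X) (F X : E)),
    (forall X : E, projinj (J X) /\ confl (i X) (q X)) /\
    (forall (X Y : E) (f : hom (X : stable E) (Y : stable E))
            (g : hom (B X : E) (B Y : E)) (a : hom (J X) (J Y))
            (b : hom (F X : E) (F Y : E)),
        fmap B f = scl g ->
        comp a (i X) = comp (i Y) g -> comp b (q X) = comp (q Y) a ->
        fmap F f = scl b).

Lemma suspension_suspends (Sg : autoequiv (stable E)) :
  is_suspension Sg <-> suspends (idF _) Sg.
Proof.
split=> [] [J [i [q [c h]]]]; exists J, i, q; split=> // X Y f.
  by move=> g a b /= -> ai bq; apply: h ai bq.
by move=> a b ai bq; apply: h ai bq.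
Qed.

(** The identity of [B X] lifts to maps of conflations in both directions, and
    lifts are unique up to stably zero maps. *)
Lemma suspends_uniq B F F' : suspends B F -> suspends B F' -> nat_iso F F'.
Proof.
move=> [J [i [q [c h]]]] [J' [i' [q' [c' h']]]].
have pJ X : projinj (J X) by case: (c X).
have pJ' X : projinj (J' X) by case: (c' X).
have cc X : confl (i X) (q X) by case: (c X).
have cc' X : confl (i' X) (q' X) by case: (c' X).
have iJ X := proj2 (pJ X); have iJ' X := proj2 (pJ' X).
have /all_sig[u uP] X : {u : hom (J X) (J' X) * hom (F X : E) (F' X : E) |
    comp u.1 (i X) = comp (i' X) (idm _) /\ comp u.2 (q X) = comp (q' X) u.1}.
  by apply: cid; have [a [b ab]] := confl_lift (idm _) (cc X) (cc' X) (iJ' X); exists (a, b).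
have /all_sig[v vP] X : {u : hom (J' X) (J X) * hom (F' X : E) (F X : E) |
    comp u.1 (i' X) = comp (i X) (idm _) /\ comp u.2 (q' X) = comp (q X) u.1}.
  by apply: cid; have [a [b ab]] := confl_lift (idm _) (cc' X) (cc X) (iJ X); exists (a, b).
exists (fun X => scl (u X).2); split=> [X|X Y f].
  exists (scl (v X).2); have [u1 u2] := uP X; have [v1 v2] := vP X.
  rewrite -!scl_comp -!scl_id; split.
    apply: (confl_lift_uniq (f := idm _) (f' := idm _) (a := comp (v X).1 (u X).1)
              (a' := idm _) (cc X) (cc X) (pJ X)) => //.
    - by rewrite -compA u1 compA v1 !compf1.
    - by rewrite -compA u2 compA v2 compA.
    - by rewrite comp1f compf1.
    - by rewrite comp1f compf1.
  apply: (confl_lift_uniq (f := idm _) (f' := idm _) (a := comp (u X).1 (v X).1)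
            (a' := idm _) (cc' X) (cc' X) (pJ' X)) => //.
  - by rewrite -compA v1 compA u1 !compf1.
  - by rewrite -compA v2 compA u2 compA.
  - by rewrite comp1f compf1.
  - by rewrite comp1f compf1.
have [g gE] := scl_surj (fmap B f).
have [a [b [ai bq]]] := confl_lift g (cc X) (cc Y) (iJ Y).
have [a' [b' [ai' bq']]] := confl_lift g (cc' X) (cc' Y) (iJ' Y).
have [uX1 uX2] := uP X; have [uY1 uY2] := uP Y.
rewrite (h _ _ _ _ _ _ gE ai bq) (h' _ _ _ _ _ _ gE ai' bq') -!scl_comp.
apply: (confl_lift_uniq (f := g) (f' := g) (a := comp a' (u X).1)
          (a' := comp (u Y).1 a) (cc X) (cc' Y) (pJ' Y)) => //.
- by rewrite -compA uX1 compA ai' !compf1.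
- by rewrite -compA uX2 compA bq' compA.
- by rewrite -compA ai compA uY1 !compf1.
- by rewrite -compA bq compA uY2 compA.
Qed.

Lemma suspends_comp B F : suspends (idF _) F -> suspends B (compF F B).
Proof.
move=> [J [i [q [c h]]]].
exists (fun X => J (B X)), (fun X => i (B X)), (fun X => q (B X)).
split=> [X|X Y f g a b fg ai bq]; first exact: c.
by rewrite /= fg; apply: h ai bq => //; rewrite /= .
Qed.

(** For conflations that are functorial before passing to stable classes, the
    compatibility required by [suspends] holds for one lift of each map, hence
    for all. *)
Lemma suspends_strict (B F : functor (stable E) (stable E))
    (b : forall X Y : E, hom X Y -> hom (B X : E) (B Y : E))
    (c : forall X Y : E, hom X Y -> hom (F X : E) (F Y : E))
    (J : E -> E) (j : forall X Y : E, hom X Y -> hom (J X) (J Y))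
    (i : forall X : E, hom (B X : E) (J X)) (q : forall X : E, hom (J X) (F X : E)) :
  (forall (X Y : E) (f : hom X Y), fmap B (scl f) = scl (b X Y f)) ->
  (forall (X Y : E) (f : hom X Y), fmap F (scl f) = scl (c X Y f)) ->
  (forall X, projinj (J X) /\ confl (i X) (q X)) ->
  (forall (X Y : E) (f : hom X Y), comp (j X Y f) (i X) = comp (i Y) (b X Y f)) ->
  (forall (X Y : E) (f : hom X Y), comp (c X Y f) (q X) = comp (q Y) (j X Y f)) ->
  suspends B F.
Proof.
move=> bE cE ciq ni nq; exists J, i, q; split=> // X Y f g a h fg ai hq.
have [f' ff'] := scl_surj f; rewrite ff' cE; rewrite ff' bE in fg.
exact: (confl_lift_uniq (proj2 (ciq X)) (proj2 (ciq Y)) (proj1 (ciq Y)) fg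
  (ni _ _ f') (nq _ _ f') ai hq).
Qed.

Lemma nat_iso_strict (A B : functor (stable E) (stable E))
    (a : forall X Y : E, hom X Y -> hom (A X : E) (A Y : E))
    (b : forall X Y : E, hom X Y -> hom (B X : E) (B Y : E))
    (t : forall X : E, hom (A X : E) (B X : E)) (u : forall X : E, hom (B X : E) (A X : E)) :
  (forall (X Y : E) (f : hom X Y), fmap A (scl f) = scl (a X Y f)) ->
  (forall (X Y : E) (f : hom X Y), fmap B (scl f) = scl (b X Y f)) ->
  (forall X, comp (u X) (t X) = idm (A X : E)) ->
  (forall X, comp (t X) (u X) = idm (B X : E)) ->
  (forall (X Y : E) (f : hom X Y), comp (b X Y f) (t X) = comp (t Y) (a X Y f)) ->
  nat_iso A B.
Proof.
move=> aE bE ut tu nt; exists (fun X => scl (t X)); split=> [X|X Y f].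
  by exists (scl (u X)); rewrite -!scl_comp ut tu.
by have [g ->] := scl_surj f; rewrite aE bE -!scl_comp nt.
Qed.

End StableFunctors.

(** * Functionals and the trace form *)

Section Linear.
Variable k : fieldType.

Section Lf.
Variables (V W : vectType k) (f : V -> W) (fl : linear f).
HB.instance Definition _ := GRing.isLinear.Build k V W _ f fl.
Lemma linfunE v : linfun f v = f v. Proof. exact: lfunE. Qed.
End Lf.


Lemma sum_seq_pick (I : eqType) (V : zmodType) (r : seq I) (i : I) (F : I -> V) :
  uniq r -> (forall j, j \in r -> j != i -> F j = 0) -> (i \notin r -> F i = 0) ->
  \sum_(j <- r) F j = F i.
Proof.
move=> Ur Fj Fi; case: (boolP (i \in r)) => [ir|/[dup] /Fi -> nir].
  rewrite (bigD1_seq i) //= big_seq_cond big1 ?addr0 // => j /andP[jr ji].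
  exact: Fj.
rewrite big_seq big1 // => j jr; apply: Fj => //.
by apply: contraNneq nir => <-.
Qed.

Lemma directv_indep (V : vectType k) (I : eqType) (r : seq I) (A : I -> {vspace V})
    (w : I -> V) :
  uniq r -> directv (\sum_(d <- r) A d) -> (forall d, w d \in A d) ->
  \sum_(d <- r) w d = 0 -> forall d, d \in r -> w d = 0.
Proof.
case: r => // d0 r; set s := d0 :: r => Us dA Aw w0 d ds.
have dA' : directv (\sum_(i < size s) A (nth d0 s i)).
  by move: dA; rewrite !directvE /= !(big_nth d0) !big_mkord.
have w0' : \sum_(i < size s) w (nth d0 s i) = 0.
  by move: w0; rewrite (big_nth d0) big_mkord.
have ids : (index d s < size s)%N by rewrite index_mem.
have := directv_sum_independent dA' (fun i : 'I_(size s) => w (nth d0 s i)).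
move/(_ (fun i _ => Aw _) w0' (Ordinal ids) isT).
by rewrite /= nth_index.
Qed.

(** Gradings are built below from their projections, which prove directness
    and exhaustion at once. *)
Lemma gr_direct_of_proj (W : vectType k) (A : int -> {vspace W}) (r : seq int)
    (e : int -> W -> W) :
  uniq r -> (forall d, d \notin r -> A d = 0%VS) ->
  (forall d, linear (e d)) -> (forall d w, e d w \in A d) ->
  (forall w, \sum_(d <- r) e d w = w) ->
  (forall d w, w \in A d -> e d w = w) ->
  (forall d d' w, w \in A d' -> d != d' -> e d w = 0) ->
  exists r : seq int,
    [/\ uniq r, forall d, d \notin r -> A d = 0%VS,
        (\sum_(d <- r) A d)%VS = fullv & directv (\sum_(d <- r) A d)].
Proof.
move=> Ur r0 el eA es eid e0; exists r; split=> //.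
  apply/eqP; rewrite eqEsubv subvf; apply/subvP=> w _; rewrite -(es w).
  rewrite big_seq (big_nth 0) big_mkord (big_nth 0) big_mkord.
  apply: memv_suml => i ir; apply: subvP (eA _ _).
  exact: (sumv_sup i).
case: r Ur r0 es => [|d0 r] Ur r0 es; first by rewrite directvE /= !big_nil dimv0.
set s := d0 :: r in Ur r0 es *.
suff : directv (\sum_(i < size s) A (nth d0 s i)).
  by rewrite !directvE /= !(big_nth d0) !big_mkord.
apply/directv_sum_independent=> u Au u0 i _.
have := congr1 (linfun (e (nth d0 s i))) u0; rewrite linear0 linear_sum /=.
rewrite (bigD1 i) //= big1 => [|j ji]; rewrite (linfunE (el _)); last first.
  apply: (e0 _ (nth d0 s j)) => //; first exact: Au.
  by rewrite (nth_uniq d0) // eq_sym; apply: contra ji => /eqP/val_inj->.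
by rewrite addr0 eid //; apply: Au.
Qed.

Lemma sep_functional (V : vectType k) (A : {vspace V}) (v : V) :
  v \notin A -> exists xi : V -> k,
    [/\ scalar xi, forall a, a \in A -> xi a = 0 & xi v != 0].
Proof.
move=> vA; pose e := vbasis {:V}.
have prv : (\1 - projv A)%VF v != 0.
  by rewrite add_lfunE opp_lfunE id_lfunE subr_eq0; apply: contra vA => /eqP->;
    rewrite memv_proj.
have [i ci] : exists i, coord e i ((\1 - projv A)%VF v) != 0.
  apply/existsP; apply: contraNT prv => /existsPn c0.
  rewrite (coord_vbasis (memvf ((\1 - projv A)%VF v))) big1 // => i _.
  by have := c0 i; rewrite negbK => /eqP->; rewrite scale0r.
exists (fun w => coord e i ((\1 - projv A)%VF w)); split=> //.
  by move=> a u w; rewrite !linearP.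
by move=> a aA; rewrite add_lfunE opp_lfunE id_lfunE projv_id // subrr linear0.
Qed.

(** The trace of an endomorphism, read off the coordinates underlying every
    finite dimensional space. *)
Definition ltr (V : vectType k) (f : 'End(V)) : k := \tr (f2mx f).

Lemma f2mxE (V W : vectType k) (f : 'Hom(V, W)) v : v2r (f v) = v2r v *m f2mx f.
Proof. by rewrite unlock /= r2vK. Qed.

Lemma row_f2mx (V W : vectType k) (f : 'Hom(V, W)) i :
  row i (f2mx f) = v2r (f (r2v (delta_mx 0 i))).
Proof. by rewrite f2mxE r2vK -rowE. Qed.

Lemma f2mx_comp (U V W : vectType k) (g : 'Hom(V, W)) (f : 'Hom(U, V)) :
  f2mx (g \o f)%VF = f2mx f *m f2mx g.
Proof.
apply/row_matrixP=> i.
by rewrite row_f2mx comp_lfunE !f2mxE r2vK rowE mulmxA.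
Qed.

Lemma ltrC (V W : vectType k) (f : 'Hom(V, W)) (g : 'Hom(W, V)) :
  ltr (f \o g)%VF = ltr (g \o f)%VF.
Proof. by rewrite /ltr !f2mx_comp mxtrace_mulC. Qed.

Lemma f2mx_lin (V W : vectType k) : linear (@f2mx k V W).
Proof.
move=> a f g; apply/row_matrixP=> i.
by rewrite row_f2mx add_lfunE scale_lfunE !linearP /= !row_f2mx.
Qed.

HB.instance Definition _ (V W : vectType k) :=
  GRing.isLinear.Build k 'Hom(V, W) 'M[k]_(dim V, dim W) _ (@f2mx k V W) (@f2mx_lin V W).

Lemma hom_sum_delta (V W : vectType k) (g : 'Hom(V, W)) :
  g = \sum_i \sum_j (f2mx g i j) *: Hom (delta_mx i j).
Proof.
apply: val_inj; rewrite /= linear_sum {1}(matrix_sum_delta (f2mx g)).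
apply: eq_bigr => i _; rewrite linear_sum; apply: eq_bigr => j _.
by rewrite linearZ.
Qed.

Lemma ltr_lin (V : vectType k) : scalar (@ltr V).
Proof. by move=> a f g; rewrite /ltr !linearP. Qed.

HB.instance Definition _ (V : vectType k) :=
  GRing.isLinear.Build k 'End(V) k _ (@ltr V) (@ltr_lin V).

(** The trace form identifies [Hom(V, W)] with the dual of [Hom(W, V)]: the
    representing matrix is the transpose of the values on matrix units. *)
Lemma ltr_repr (V W : vectType k) (l : 'Hom(W, V) -> k) : scalar l ->
  exists f : 'Hom(V, W), forall g, l g = ltr (f \o g)%VF.
Proof.
move=> ll; pose L : {scalar 'Hom(W, V)} := HB.pack l (GRing.isLinear.Build k _ k _ l ll).
exists (Hom (\matrix_(i, j) L (Hom (delta_mx j i)))) => g.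
rewrite {1}(hom_sum_delta g) -[l _]/(L _) linear_sum /ltr f2mx_comp /mxtrace.
apply: eq_bigr => i _; rewrite linear_sum mxE; apply: eq_bigr => j _.
by rewrite linearZ /= !mxE.
Qed.

Definition rk1_fun (V W : vectType k) (xi : V -> k) (w : W) (v : V) : W := xi v *: w.

Lemma rk1_lin (V W : vectType k) (xi : V -> k) (w : W) :
  scalar xi -> linear (rk1_fun xi w).
Proof. by move=> xl a u v; rewrite /rk1_fun xl scalerDl scalerA. Qed.

Definition rk1 (V W : vectType k) (xi : V -> k) (w : W) :
  'Hom(V, W) := linfun (rk1_fun xi w).

Lemma rk1E (V W : vectType k) (xi : V -> k) (w : W) v :
  scalar xi -> rk1 xi w v = xi v *: w.
Proof. by move=> xl; rewrite (linfunE (rk1_lin w xl)). Qed.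

Lemma ltr_rk1 (V W : vectType k) (xi : V -> k) (xl : scalar xi) (w : W)
  (h : 'Hom(W, V)) : ltr (rk1 xi w \o h)%VF = xi (h w).
Proof.
have xl' : scalar (fun u => xi (h u)) by move=> a u v; rewrite linearP xl.
have -> : (rk1 xi w \o h)%VF = rk1 (fun u => xi (h u)) w.
  by apply/lfunP=> u; rewrite comp_lfunE !rk1E.
pose X : {scalar W} := HB.pack (fun u => xi (h u)) (GRing.isLinear.Build k _ k _ _ xl').
rewrite -[RHS]/(X w) /ltr /mxtrace.
have E i : f2mx (rk1 (fun u => xi (h u)) w) i i = v2r w 0 i * X (r2v (delta_mx 0 i)).
  have /rowP/(_ i) := row_f2mx (rk1 (fun u => xi (h u)) w) i.
  by rewrite rk1E // linearZ !mxE mulrC.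
rewrite (eq_bigr _ (fun i _ => E i)).
have Ew : w = \sum_i v2r w 0 i *: r2v (delta_mx 0 i).
  rewrite -[LHS]v2rK [v2r w in LHS]row_sum_delta linear_sum.
  by apply: eq_bigr => i _; rewrite linearZ.
by rewrite [in RHS]Ew linear_sum; apply: eq_bigr => i _; rewrite linearZ.
Qed.

End Linear.

(** * Graded modules *)

Section Graded.
Variables (k : fieldType) (p : nat).
Local Notation grmod := (grmod k p).

Definition supp (V : grmod) : seq int := sval (cid (gr_direct V)).

Fact supp_full (V : grmod) : fullv = (\sum_(d <- supp V) gr V d)%VS.
Proof. by have [_ _ h _] := svalP (cid (gr_direct V)); rewrite -h. Qed.

Lemma supp_uniq (V : grmod) : uniq (supp V).
Proof. by have [] := svalP (cid (gr_direct V)). Qed.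

Lemma gr_supp (V : grmod) d : d \notin supp V -> gr V d = 0%VS.
Proof. by have [_ h _ _] := svalP (cid (gr_direct V)); apply: h. Qed.

Definition pr (V : grmod) (d : int) : 'End(V) := sumv_pi_for (supp_full V) d.

Lemma mem_pr (V : grmod) d v : pr V d v \in gr V d.
Proof. exact: memv_sum_pi. Qed.

Lemma pr_notin (V : grmod) d v : d \notin supp V -> pr V d v = 0.
Proof. by move/gr_supp=> e; apply/eqP; rewrite -memv0 -e mem_pr. Qed.

Lemma pr_sum_supp (V : grmod) v : \sum_(d <- supp V) pr V d v = v.
Proof. by apply: sumv_pi_uniq_sum; rewrite ?memvf // filter_uniq // supp_uniq. Qed.

Lemma pr_sum (V : grmod) (r : seq int) v :
  uniq r -> {subset supp V <= r} -> \sum_(d <- r) pr V d v = v.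
Proof.
move=> Ur sub; rewrite -[RHS]pr_sum_supp (bigID (mem (supp V))) /=.
rewrite [X in _ + X]big1 ?addr0 => [|d /pr_notin //]; rewrite -big_filter.
apply: perm_big; apply: uniq_perm; rewrite ?filter_uniq ?supp_uniq // => d.
by rewrite mem_filter; case: (boolP (d \in supp V)) => //= /sub.
Qed.

Lemma pr_id (V : grmod) d v : v \in gr V d -> pr V d v = v.
Proof.
move=> vd; pose w d' := pr V d' v - (if d' == d then v else 0).
have wE : w d = pr V d v - v by rewrite /w eqxx.
apply/eqP; rewrite -subr_eq0 -wE; case: (boolP (d \in supp V)) => ds; last first.
  by rewrite wE pr_notin // sub0r oppr_eq0 -memv0 -(gr_supp ds).
have [_ _ _ dir] := svalP (cid (gr_direct V)).
rewrite (directv_indep (w := w) (supp_uniq V) dir) //.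
  move=> d'; rewrite /w; case: eqP => [->|_]; last by rewrite subr0 mem_pr.
  by rewrite memvB // mem_pr.
rewrite sumrB pr_sum_supp (sum_seq_pick (i := d)) ?eqxx ?subrr ?supp_uniq //.
  by move=> j _ /negPf->.
by rewrite ds.
Qed.

Lemma pr_neq (V : grmod) d d' v : v \in gr V d' -> d != d' -> pr V d v = 0.
Proof.
move=> vd dd'; pose w e := pr V e v - (if e == d' then v else 0).
have wE : w d = pr V d v by rewrite /w (negPf dd') subr0.
case: (boolP (d \in supp V)) => ds; last exact: pr_notin.
have [_ _ _ dir] := svalP (cid (gr_direct V)).
rewrite -wE; apply: (directv_indep (w := w) (supp_uniq V) dir) => //.
  move=> e; rewrite /w; case: eqP => [->|_]; last by rewrite subr0 mem_pr.
  by rewrite memvB // mem_pr.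
rewrite sumrB pr_sum_supp (sum_seq_pick (i := d')) ?eqxx ?subrr ?supp_uniq //.
  by move=> j _ /negPf->.
by move=> d's; apply/eqP; rewrite -memv0 -(gr_supp d's).
Qed.

Lemma gr_homogP (V : grmod) d v : (v \in gr V d) = (pr V d v == v).
Proof. by apply/idP/eqP => [/pr_id//|<-]; rewrite mem_pr. Qed.

Definition degr (V W : grmod) (j : int) (phi : 'Hom(V, W)) : Prop :=
  forall d v, v \in gr V d -> phi v \in gr W (d + j).

Lemma degr_pr (V W : grmod) j (phi : 'Hom(V, W)) d v : degr j phi ->
  phi (pr V d v) = pr W (d + j) (phi v).
Proof.
move=> dphi; rewrite -{2}(pr_sum_supp v) !linear_sum /=.
rewrite (sum_seq_pick (i := d)) ?supp_uniq //.
- by rewrite [RHS]pr_id //; apply: dphi (mem_pr _ _).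
- move=> e _ ed; apply: (@pr_neq _ _ (e + j)); first exact: dphi (mem_pr _ _).
  by rewrite (inj_eq (addIr j)) eq_sym.
- by move=> ds; rewrite [pr V d v]pr_notin // !linear0.
Qed.

Lemma degr_lin (V W : grmod) j a (f g : 'Hom(V, W)) :
  degr j f -> degr j g -> degr j (a *: f + g).
Proof.
by move=> df dg d v vd; rewrite add_lfunE scale_lfunE memvD ?memvZ ?df ?dg.
Qed.

Lemma degr_sum (V W : grmod) j (I : Type) (r : seq I) (P : pred I)
  (F : I -> 'Hom(V, W)) : (forall i, P i -> degr j (F i)) -> degr j (\sum_(i <- r | P i) F i).
Proof.
by move=> dF d v vd; rewrite sum_lfunE; apply: memv_suml => i Pi; apply: dF.
Qed.

Lemma degr_comp (U V W : grmod) i j (g : 'Hom(V, W)) (f : 'Hom(U, V)) l :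
  l = i + j -> degr j g -> degr i f -> degr l (g \o f)%VF.
Proof. by move=> -> dg df d v vd; rewrite comp_lfunE addrA dg ?df. Qed.

Lemma degr1 (V : grmod) : degr 0 (\1%VF : 'End(V)).
Proof. by move=> d v; rewrite addr0 id_lfunE. Qed.

(** The homogeneous part of degree [j] of a linear map.  Linear algebra
    provides sections, retractions and dual vectors that ignore the grading;
    taking homogeneous parts corrects this, since it commutes with composition
    with homogeneous maps and can be moved across the trace form. *)
Definition hmg (V W : grmod) (j : int) (phi : 'Hom(V, W)) : 'Hom(V, W) :=
  \sum_(d <- supp V) (pr W (d + j) \o phi \o pr V d)%VF.

Lemma hmgE (V W : grmod) j (phi : 'Hom(V, W)) d v : v \in gr V d ->
  hmg j phi v = pr W (d + j) (phi v).
Proof.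
move=> vd; rewrite sum_lfunE (sum_seq_pick (i := d)) ?supp_uniq //.
- by rewrite !comp_lfunE (pr_id vd).
- by move=> e _ ed; rewrite !comp_lfunE (pr_neq vd ed) !linear0.
- by move=> ds; rewrite !comp_lfunE (pr_notin _ ds) !linear0.
Qed.

Lemma hmg_degr (V W : grmod) j (phi : 'Hom(V, W)) : degr j (hmg j phi).
Proof. by move=> d v vd; rewrite (hmgE _ _ vd) mem_pr. Qed.

Lemma eq_homog (V W : grmod) (f g : 'Hom(V, W)) :
  (forall d v, v \in gr V d -> f v = g v) -> f = g.
Proof.
move=> fg; apply/lfunP=> v; rewrite -(pr_sum_supp v) !linear_sum.
by apply: eq_bigr => d _; apply: fg (mem_pr d v).
Qed.

Lemma hmg_id (V W : grmod) j (phi : 'Hom(V, W)) : degr j phi -> hmg j phi = phi.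
Proof.
by move=> dphi; apply: eq_homog => d v vd; rewrite (hmgE _ _ vd) pr_id // dphi.
Qed.

Lemma hmg_compl (U V W : grmod) i j l (g : 'Hom(V, W)) (f : 'Hom(U, V)) :
  l = i + j -> degr j g -> (g \o hmg i f)%VF = hmg l (g \o f).
Proof.
move=> -> dg; apply: eq_homog => d v vd; rewrite comp_lfunE !(hmgE _ _ vd).
by rewrite comp_lfunE (degr_pr _ _ dg) addrA.
Qed.

Lemma hmg_compr (U V W : grmod) i j l (g : 'Hom(V, W)) (f : 'Hom(U, V)) :
  l = i + j -> degr i f -> (hmg j g \o f)%VF = hmg l (g \o f).
Proof.
move=> -> df; apply: eq_homog => d v vd; rewrite comp_lfunE (hmgE _ _ vd).
by rewrite comp_lfunE (hmgE _ _ (df _ _ vd)) addrA.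
Qed.

Lemma ltr_hmg (V W : grmod) j (phi : 'Hom(V, W)) (f : 'Hom(W, V)) :
  degr (- j) f -> ltr (hmg j phi \o f)%VF = ltr (phi \o f)%VF.
Proof.
move=> df; have C d : (pr V d \o f)%VF = (f \o pr W (d + j))%VF.
  by apply/lfunP=> w; rewrite !comp_lfunE (degr_pr _ _ df) addrK.
have -> : (phi \o f)%VF = \sum_(d <- supp V) (phi \o pr V d \o f)%VF.
  apply/lfunP=> w; rewrite sum_lfunE; under eq_bigr do rewrite !comp_lfunE.
  by rewrite -linear_sum pr_sum_supp comp_lfunE.
have -> : (hmg j phi \o f)%VF = \sum_(d <- supp V) (pr W (d + j) \o (phi \o pr V d \o f))%VF.
  apply/lfunP=> w; rewrite comp_lfunE !sum_lfunE; apply: eq_bigr => d _.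
  by rewrite !comp_lfunE.
rewrite !linear_sum; apply: eq_bigr => d _ /=; rewrite ltrC.
rewrite -!comp_lfunA; congr (ltr (phi \o _)%VF); rewrite comp_lfunA C -comp_lfunA.
by congr (f \o _)%VF; apply/lfunP=> w; rewrite comp_lfunE pr_id ?mem_pr.
Qed.

Lemma grhomP (V W : grmod) (f : 'Hom(V, W)) :
  is_grhom f <-> degr 0 f /\ (forall v, f (grx V v) = grx W (f v)).
Proof.
split=> [[fd fx]|[fd fx]].
  split=> [d v vd|v]; last by rewrite -!comp_lfunE fx.
  by rewrite addr0; apply: subvP (fd d) _ _; apply: memv_img.
split=> [d|]; last by apply/lfunP=> v; rewrite !comp_lfunE.
by apply/subvP=> _ /memv_imgP[v vd ->]; rewrite -[d]addr0 fd.
Qed.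

Lemma grx_degr (V : grmod) : degr 1 (grx V).
Proof. by move=> d v vd; apply: subvP (grx_deg V d) _ _; apply: memv_img. Qed.

(** The powers of [x], as an iteration of composition so that the powers on a
    module and on its shifts are convertible. *)
Definition xp (V : grmod) (i : nat) : 'End(V) :=
  iter i (comp_lfun (grx V)) \1%VF.

Lemma xp0 (V : grmod) v : xp V 0 v = v. Proof. exact: id_lfunE. Qed.
Lemma xpS (V : grmod) i v : xp V i.+1 v = grx V (xp V i v).
Proof. exact: comp_lfunE. Qed.

Lemma xpD (V : grmod) i j v : xp V (i + j) v = xp V i (xp V j v).
Proof. by elim: i => [|i IHi]; rewrite ?xp0 // addSn !xpS IHi. Qed.

Lemma xpSr (V : grmod) i v : xp V i.+1 v = xp V i (grx V v).
Proof. by rewrite -addn1 xpD xpS xp0. Qed.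

Lemma xp_iter (V : grmod) i v : xp V i v = iter i (grx V) v.
Proof. by elim: i => [|i IHi]; rewrite ?xp0 // xpS IHi. Qed.

Lemma xp_nil (V : grmod) i v : (p <= i)%N -> xp V i v = 0.
Proof. by move=> pi; rewrite -(subnK pi) xpD [xp V p v]xp_iter grx_nil linear0. Qed.

Lemma xp_degr (V : grmod) (i : nat) : degr i (xp V i).
Proof.
elim: i => [|i IHi]; first exact: degr1.
by apply: degr_comp (@grx_degr V) IHi; rewrite -addn1 PoszD.
Qed.

Lemma grhom_xp (V W : grmod) (f : 'Hom(V, W)) i v : is_grhom f ->
  f (xp V i v) = xp W i (f v).
Proof. by move=> /grhomP[_ fx]; elim: i => [|i IHi]; rewrite ?xp0 // !xpS fx IHi. Qed.

Program Definition shiftg (s : int) (V : grmod) : grmod :=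
  @Grmod k p (gsp V) (fun d => gr V (d + s)) (grx V) _ _ _.
Next Obligation.
move=> s V; pose r := [seq d - s | d <- supp V].
apply: (gr_direct_of_proj (r := r) (e := fun d => pr V (d + s))).
- by rewrite map_inj_uniq ?supp_uniq //; apply: addIr.
- move=> d dr; apply: gr_supp; apply: contra dr => ds.
  by apply/mapP; exists (d + s); rewrite ?addrK.
- by move=> d; apply: linearP.
- by move=> d w; apply: mem_pr.
- by move=> w; rewrite big_map; under eq_bigr do rewrite subrK; apply: pr_sum_supp.
- by move=> d w; apply: pr_id.
- by move=> d d' w wd dd'; apply: pr_neq wd _; rewrite (inj_eq (addIr s)).
Qed.
Next Obligation.
move=> s V d; apply: subv_trans (grx_deg V _) _.
by rewrite addrAC subvv.
Qed.
Next Obligation. by move=> s V v; apply: grx_nil. Qed.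

Definition grsub (V : grmod) (A : {vspace V}) : Prop :=
  (forall d v, v \in A -> pr V d v \in A) /\ (forall v, v \in A -> grx V v \in A).

Lemma vsval_lf (V : vectType k) (A : {vspace V}) (w : subvs_of A) :
  linfun (vsval : subvs_of A -> V) w = vsval w.
Proof. exact: lfunE. Qed.

Lemma vsproj_lf (V : vectType k) (A : {vspace V}) (v : V) :
  linfun (vsproj A) v = vsproj A v.
Proof. exact: lfunE. Qed.

Section Sub.
Variables (V : grmod) (A : {vspace V}) (hA : grsub A).

Program Definition subg : grmod :=
  @Grmod k p (subvs_of A) (fun d => linfun (vsval : subvs_of A -> V) @^-1: gr V d)%VS
    (linfun (vsproj A) \o grx V \o linfun (vsval : subvs_of A -> V))%VF _ _ _.
Next Obligation.
pose e d (w : subvs_of A) := vsproj A (pr V d (vsval w)).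
have eE d w : vsval (e d w) = pr V d (vsval w).
  by rewrite vsprojK //; apply: (proj1 hA); apply: subvsP.
apply: (gr_direct_of_proj (r := supp V) (e := e)).
- exact: supp_uniq.
- move=> d ds; apply/eqP; rewrite -subv0; apply/subvP=> w.
  rewrite -memv_preim vsval_lf (gr_supp ds) !memv0 => /eqP w0.
  by apply/eqP/val_inj.
- by move=> d a u v; rewrite /e !linearP.
- by move=> d w; rewrite -memv_preim vsval_lf eE mem_pr.
- move=> w; apply: val_inj; rewrite /= linear_sum.
  by under eq_bigr do rewrite /= eE; apply: pr_sum_supp.
- by move=> d w; rewrite -memv_preim vsval_lf => wd; apply: val_inj; rewrite /= eE pr_id.
- move=> d d' w; rewrite -memv_preim vsval_lf => wd dd'.
  by apply: val_inj; rewrite /= eE (pr_neq wd).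
Qed.
Next Obligation.
move=> d; apply/subvP=> _ /memv_imgP[w wd ->]; move: wd.
rewrite -!memv_preim !comp_lfunE !vsval_lf vsproj_lf => wd.
rewrite vsprojK; first exact: grx_degr.
by apply: (proj2 hA); apply: subvsP.
Qed.
Next Obligation.
move=> w; apply: val_inj; rewrite /= -[RHS](grx_nil (vsval w)).
set X := (_ \o _)%VF; suff E i : vsval (iter i X w) = iter i (grx V) (vsval w) by [].
elim: i => [//|i IHi] /=; rewrite !comp_lfunE vsval_lf vsproj_lf vsprojK ?IHi //.
by rewrite -IHi; apply: (proj2 hA); apply: subvsP.
Qed.

Lemma subg_gr d (w : subg) : (w \in gr subg d) = (vsval w \in gr V d).
Proof. by rewrite /= -memv_preim vsval_lf. Qed.

Lemma subg_x (w : subg) : vsval (grx subg w) = grx V (vsval w).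
Proof.
by rewrite /= !comp_lfunE vsval_lf vsproj_lf vsprojK //; apply: (proj2 hA); apply: subvsP.
Qed.

Lemma subg_xp i (w : subg) : vsval (xp subg i w) = xp V i (vsval w).
Proof. by elim: i => [|i IHi]; rewrite ?xp0 // !xpS subg_x IHi. Qed.

End Sub.

Lemma grsub_ker (V W : grmod) j (f : 'Hom(V, W)) : degr j f ->
  (forall v, f v = 0 -> f (grx V v) = 0) -> grsub (lker f).
Proof.
move=> df fx; split=> [d v|v]; rewrite !memv_ker => /eqP fv.
  by rewrite (degr_pr _ _ df) fv linear0.
by rewrite fx.
Qed.

Lemma grsub_img (V W : grmod) (f : 'Hom(V, W)) : is_grhom f -> grsub (limg f).
Proof.
move=> /grhomP[fd fx]; split=> [d _ /memv_imgP[v _ ->]|_ /memv_imgP[v _ ->]].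
  by rewrite -[d]addr0 -(degr_pr _ _ fd) memv_img // memvf.
by rewrite -fx memv_img // memvf.
Qed.

Lemma grsub_cap (V : grmod) (A B : {vspace V}) : grsub A -> grsub B -> grsub (A :&: B)%VS.
Proof.
move=> [Ad Ax] [Bd Bx]; split=> [d v|v]; rewrite !memv_cap => /andP[vA vB].
  by rewrite Ad ?Bd.
by rewrite Ax ?Bx.
Qed.

End Graded.

(** * Free modules and the norm *)

Section Free.
Variables (k : fieldType) (n : nat).
Local Notation grmod := (grmod k n.+1).
Implicit Types (s t : int) (U V W : grmod).

Definition pshift (V : vectType k) (phi : {ffun 'I_n.+1 -> V}) : {ffun 'I_n.+1 -> V} :=
  [ffun i => if nat_of_ord i is j.+1 then phi (inord j) else 0].

Lemma pshift_lin (V : vectType k) : linear (@pshift V).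
Proof.
move=> a f g; apply/ffunP=> i; rewrite !ffunE.
by case: (nat_of_ord i) => [|j]; rewrite ?scaler0 ?addr0 // !ffunE.
Qed.

Definition pev (V : vectType k) (i : 'I_n.+1) (phi : {ffun 'I_n.+1 -> V}) : V := phi i.

Lemma pev_lin (V : vectType k) i : linear (@pev V i).
Proof. by move=> a f g; rewrite /pev !ffunE. Qed.

Definition pgr (s : int) (V : grmod) (d : int) : {vspace {ffun 'I_n.+1 -> V}} :=
  (\bigcap_(i < n.+1) (linfun (@pev V i) @^-1: gr V (d + s - i%:Z)))%VS.

Lemma pgrP s (V : grmod) d (phi : {ffun 'I_n.+1 -> V}) :
  reflect (forall i : 'I_n.+1, phi i \in gr V (d + s - i%:Z)) (phi \in pgr s V d).
Proof.
have E i : (phi \in (linfun (@pev V i) @^-1: gr V (d + s - i%:Z))%VS)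
    = (phi i \in gr V (d + s - i%:Z)) by rewrite -memv_preim (linfunE (pev_lin i)).
rewrite memvE; apply: (iffP subv_bigcapP) => [h i|h i _].
  by rewrite -E memvE h.
by rewrite -memvE E.
Qed.

Lemma iter_pshift (V : vectType k) m (phi : {ffun 'I_n.+1 -> V}) i :
  iter m (@pshift V) phi i = if (m <= i)%N then phi (inord (i - m)) else 0.
Proof.
elim: m i => [|m IHm] i; first by rewrite subn0 inord_val.
rewrite iterS ffunE; case E: (nat_of_ord i) => [//|j].
have jn : (j < n.+1)%N by have := ltn_ord i; lia.
by rewrite IHm inordK // ltnS subSS.
Qed.

(** [M (x) k[x]/(x^p)], as the space of sequences [(m_i)], standing for
    [sum_i m_i (x) x^i]; [m (x) x^i] has degree [deg m + i - s]. *)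
Program Definition freeg (s : int) (V : grmod) : grmod :=
  @Grmod k n.+1 {ffun 'I_n.+1 -> V} (pgr s V) (linfun (@pshift V)) _ _ _.
Next Obligation.
move=> s V.
pose r := undup [seq t - s + i%:Z | t <- supp V, i <- iota 0 n.+1].
pose e d (phi : {ffun 'I_n.+1 -> V}) := [ffun i : 'I_n.+1 => pr V (d + s - i%:Z) (phi i)].
have rP t (i : 'I_n.+1) : t \in supp V -> t - s + i%:Z \in r.
  move=> ts; rewrite mem_undup; apply/allpairsP; exists (t, nat_of_ord i).
  by rewrite mem_iota /= add0n ltn_ord.
have shI (i : 'I_n.+1) : injective (fun d : int => d + s - i%:Z).
  by move=> d d' /addIr /addIr.
apply: (gr_direct_of_proj (r := r) (e := e)).
- exact: undup_uniq.
- move=> d dr; apply/eqP; rewrite -subv0; apply/subvP=> phi /pgrP h.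
  rewrite memv0; apply/eqP/ffunP=> i; rewrite ffunE.
  have /gr_supp g0 : d + s - i%:Z \notin supp V.
    apply: contra dr => /(rP _ i).
    by have -> : d + s - i%:Z - s + i%:Z = d by lia.
  by apply/eqP; rewrite -memv0 -g0 h.
- by move=> d a f g; apply/ffunP=> i; rewrite !ffunE linearP.
- by move=> d w; apply/pgrP=> i; rewrite ffunE mem_pr.
- move=> w; apply/ffunP=> i; rewrite sum_ffunE.
  under eq_bigr do rewrite ffunE.
  rewrite -(big_map (fun d : int => d + s - i%:Z) xpredT (fun t => pr V t (w i))).
  apply: pr_sum; first by rewrite map_inj_uniq ?undup_uniq.
  move=> t ts; apply/mapP; exists (t - s + i%:Z); first exact: rP.
  lia.
- by move=> d w /pgrP h; apply/ffunP=> i; rewrite ffunE pr_id.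
- move=> d d' w /pgrP h dd'; apply/ffunP=> i; rewrite !ffunE (pr_neq (h i)) //.
  by rewrite (inj_eq (@shI i)).
Qed.
Next Obligation.
move=> s V d; apply/subvP=> _ /memv_imgP[phi /pgrP h ->].
rewrite (linfunE (@pshift_lin V)); apply/pgrP=> i; rewrite ffunE.
case E: (nat_of_ord i) => [|j]; first exact: mem0v.
have jn : (j < n.+1)%N by have := ltn_ord i; lia.
have := h (inord j); rewrite inordK //.
by congr (_ \in gr V _); lia.
Qed.
Next Obligation.
move=> s V phi; apply/ffunP=> i; rewrite ffunE.
have E : linfun (@pshift V) =1 @pshift V by exact: (linfunE (@pshift_lin V)).
by rewrite (eq_iter E) iter_pshift leqNgt ltn_ord.
Qed.

Lemma free_x s V (phi : freeg s V) : grx (freeg s V) phi = pshift phi.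
Proof. exact: (linfunE (@pshift_lin V)). Qed.

Lemma free_xp s V m (phi : freeg s V) (i : 'I_n.+1) :
  (xp (freeg s V) m phi : {ffun _ -> _}) i = if (m <= i)%N then phi (inord (i - m)) else 0.
Proof. by rewrite xp_iter (eq_iter (@free_x s V)) iter_pshift. Qed.

(** The transfer of [phi] from linear maps to maps commuting with [x]. *)
Definition Nm (V W : grmod) (phi : 'Hom(V, W)) : 'Hom(V, W) :=
  \sum_(i < n.+1) (xp W i \o phi \o xp V (n - i))%VF.

Lemma NmE V W (phi : 'Hom(V, W)) v :
  Nm phi v = \sum_(i < n.+1) xp W i (phi (xp V (n - i) v)).
Proof. by rewrite sum_lfunE; apply: eq_bigr => i _; rewrite !comp_lfunE. Qed.

Lemma Nm_lin V W : linear (@Nm V W).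
Proof.
move=> a f g; apply/lfunP=> v; rewrite add_lfunE scale_lfunE !NmE scaler_sumr.
rewrite -big_split; apply: eq_bigr => i _ /=.
by rewrite add_lfunE scale_lfunE linearP.
Qed.
HB.instance Definition _ V W := GRing.isLinear.Build k _ _ _ (@Nm V W) (@Nm_lin V W).

Lemma Nm_degr V W j l (phi : 'Hom(V, W)) : l = j + n%:Z -> degr j phi -> degr l (Nm phi).
Proof.
move=> -> dphi; apply: degr_sum => i _.
apply: (degr_comp (i := (n - i)%N%:Z) (j := i%:Z + j)); last exact: xp_degr.
  by have := ltn_ord i; lia.
by apply: (degr_comp (i := j) (j := i)) (@xp_degr _ _ W i) dphi; rewrite addrC.
Qed.

(** [N] is self-adjoint: reindex by [i |-> p - 1 - i] and rotate the trace. *)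
Lemma ltr_Nm V W (phi : 'Hom(V, W)) (g : 'Hom(W, V)) :
  ltr (Nm phi \o g)%VF = ltr (phi \o Nm g)%VF.
Proof.
have -> : (Nm phi \o g)%VF = \sum_(i < n.+1) (xp W i \o (phi \o xp V (n - i) \o g))%VF.
  apply/lfunP=> w; rewrite comp_lfunE NmE sum_lfunE.
  by apply: eq_bigr => i _; rewrite !comp_lfunE.
have -> : (phi \o Nm g)%VF = \sum_(i < n.+1) (phi \o xp V i \o g \o xp W (n - i))%VF.
  apply/lfunP=> w; rewrite comp_lfunE NmE sum_lfunE linear_sum.
  by apply: eq_bigr => i _; rewrite !comp_lfunE.
rewrite !linear_sum (reindex_inj rev_ord_inj); apply: eq_bigr => i _ /=.
have iE : (n.+1 - i.+1)%N = (n - i)%N by rewrite subSS.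
by rewrite iE subKn -1?ltnS // ltrC.
Qed.

(** Maps out of a free module correspond to linear maps on its generators
    [m (x) 1]; see [ext_uniq]. *)
Definition ext_fun s V W (g : 'Hom(V, W)) (phi : freeg s V) : W :=
  \sum_(i < n.+1) xp W i (g ((phi : {ffun _ -> _}) i)).

Lemma ext_lin s V W g : linear (@ext_fun s V W g).
Proof.
move=> a u v; rewrite /ext_fun scaler_sumr -big_split; apply: eq_bigr => i _ /=.
by rewrite !ffunE !linearP.
Qed.

Definition ext s V W (g : 'Hom(V, W)) : 'Hom(freeg s V, W) := linfun (@ext_fun s V W g).

Lemma extE s V W (g : 'Hom(V, W)) (phi : freeg s V) :
  ext s g phi = \sum_(i < n.+1) xp W i (g ((phi : {ffun _ -> _}) i)).
Proof. exact: (linfunE (@ext_lin s V W g)). Qed.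

Lemma ext_x s V W (g : 'Hom(V, W)) (phi : freeg s V) :
  ext s g (grx (freeg s V) phi) = grx W (ext s g phi).
Proof.
rewrite !extE free_x linear_sum big_ord_recl /= ffunE !linear0 add0r.
rewrite [RHS]big_ord_recr /= -xpS xp_nil // addr0; apply: eq_bigr => i _.
rewrite ffunE /= xpS; congr (grx W (xp W i (g (phi _)))).
by apply: val_inj; rewrite /= inordK //; have := ltn_ord i; lia.
Qed.

Lemma ext_degr s V W j l (g : 'Hom(V, W)) : l = s + j -> degr j g -> degr l (ext s g).
Proof.
move=> -> dg d phi /pgrP h; rewrite extE; apply: memv_suml => i _.
have := @xp_degr _ _ W i _ _ (dg _ _ (h i)).
by congr (_ \in gr W _); lia.
Qed.

Lemma ext_grhom s V W (g : 'Hom(V, W)) : degr (- s) g -> is_grhom (ext s g).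
Proof.
move=> dg; apply/grhomP; split; last exact: ext_x.
by apply: ext_degr dg; rewrite subrr.
Qed.

(** Maps into a free module correspond to linear maps to its last component,
    because [k[x]/(x^p)] is self-dual; see [coext_uniq]. *)
Definition coext_fun s V W (g : 'Hom(W, V)) (w : W) : freeg s V :=
  [ffun i : 'I_n.+1 => g (xp W (n - i) w)].

Lemma coext_lin s V W g : linear (@coext_fun s V W g).
Proof. by move=> a u v; apply/ffunP=> i; rewrite !ffunE !linearP. Qed.

Definition coext s V W (g : 'Hom(W, V)) : 'Hom(W, freeg s V) :=
  linfun (@coext_fun s V W g).

Lemma coextE s V W (g : 'Hom(W, V)) w (i : 'I_n.+1) :
  (coext s g w : {ffun _ -> _}) i = g (xp W (n - i) w).
Proof. by rewrite (linfunE (@coext_lin s V W g)) ffunE. Qed.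

Lemma coext_x s V W (g : 'Hom(W, V)) w :
  coext s g (grx W w) = grx (freeg s V) (coext s g w).
Proof.
apply/ffunP=> i; rewrite free_x coextE ffunE -xpSr.
case E: (nat_of_ord i) => [|j]; first by rewrite subn0 xp_nil ?linear0.
have jn := ltn_ord i; rewrite coextE inordK; last lia.
by congr (g (xp W _ w)); lia.
Qed.

Lemma coext_degr s V W j l (g : 'Hom(W, V)) : l = n%:Z + j - s -> degr j g ->
  degr l (coext s g).
Proof.
move=> -> dg d w wd; apply/pgrP=> i; rewrite coextE.
have := dg _ _ (@xp_degr _ _ W (n - i) _ _ wd).
by congr (_ \in gr V _); have := ltn_ord i; lia.
Qed.

Lemma coext_grhom s V W (g : 'Hom(W, V)) : degr (s - n%:Z) g -> is_grhom (coext s g).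
Proof.
move=> dg; apply/grhomP; split; last exact: coext_x.
by apply: coext_degr dg; lia.
Qed.

Lemma coext_uniq s V W (g : 'Hom(W, freeg s V)) w (i : 'I_n.+1) :
  (forall v, g (grx W v) = grx (freeg s V) (g v)) ->
  (g w : {ffun _ -> _}) i = (g (xp W (n - i) w) : {ffun _ -> _}) ord_max.
Proof.
move=> gx; have gxp m : g (xp W m w) = xp (freeg s V) m (g w).
  by elim: m => [|m IHm]; rewrite ?xp0 // !xpS gx IHm.
rewrite gxp free_xp leq_subr subKn -1?ltnS //.
by congr ((g w : {ffun _ -> _}) _); apply: val_inj; rewrite /= inordK.
Qed.

(** Norms are the maps that factor through the free module on the
    source. *)
Lemma NmK V W (phi : 'Hom(V, W)) s : (ext s phi \o coext s \1)%VF = Nm phi.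
Proof.
apply/lfunP=> v; rewrite comp_lfunE extE NmE; apply: eq_bigr => i _.
by rewrite coextE id_lfunE.
Qed.

Lemma Nm_x V W (phi : 'Hom(V, W)) v : Nm phi (grx V v) = grx W (Nm phi v).
Proof. by rewrite -(NmK phi 0) !comp_lfunE coext_x ext_x. Qed.

Lemma Nm_compl U V W (g : 'Hom(V, W)) (phi : 'Hom(U, V)) : is_grhom g ->
  (g \o Nm phi)%VF = Nm (g \o phi)%VF.
Proof.
move=> gh; apply/lfunP=> u; rewrite comp_lfunE !NmE linear_sum.
by apply: eq_bigr => i _; rewrite /= (grhom_xp _ _ gh) comp_lfunE.
Qed.

Lemma Nm_compr U V W (phi : 'Hom(V, W)) (f : 'Hom(U, V)) : is_grhom f ->
  (Nm phi \o f)%VF = Nm (phi \o f)%VF.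
Proof.
move=> fh; apply/lfunP=> u; rewrite comp_lfunE !NmE.
by apply: eq_bigr => i _; rewrite comp_lfunE (grhom_xp _ _ fh).
Qed.

Definition inc0_fun s V (v : V) : freeg s V := [ffun i : 'I_n.+1 => if i == ord0 then v else 0].
Lemma inc0_lin s V : linear (@inc0_fun s V).
Proof.
move=> a u v; apply/ffunP=> i; rewrite !ffunE; case: ifP => // _.
by rewrite scaler0 addr0.
Qed.
Definition inc0 s V : 'Hom(V, freeg s V) := linfun (@inc0_fun s V).
Lemma inc0E s V v (i : 'I_n.+1) :
  (inc0 s V v : {ffun _ -> _}) i = if i == ord0 then v else 0.
Proof. by rewrite (linfunE (@inc0_lin s V)) ffunE. Qed.

Lemma inc0_degr s V : degr (- s) (inc0 s V).
Proof.
move=> d v vd; apply/pgrP=> i; rewrite inc0E; case: eqP => [->|_]; last exact: mem0v.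
by rewrite subrK subr0.
Qed.

Lemma xp_inc0 s V m v (i : 'I_n.+1) :
  (xp (freeg s V) m (inc0 s V v) : {ffun _ -> _}) i = if m == i :> nat then v else 0.
Proof.
rewrite free_xp; case: ltngtP => // mi; last first.
  by rewrite inc0E -mi subnn; case: eqP => // -[]; apply: val_inj; rewrite /= inordK.
rewrite inc0E; case: eqP => // /(congr1 val) /=; rewrite inordK; last first.
  by have := ltn_ord i; lia.
by lia.
Qed.

Lemma free_decomp s V (phi : freeg s V) :
  phi = \sum_(i < n.+1) xp (freeg s V) i (inc0 s V ((phi : {ffun _ -> _}) i)).
Proof.
apply/ffunP=> j; rewrite sum_ffunE (bigD1 j) //= xp_inc0 eqxx big1 ?addr0 //.
by move=> i ij; rewrite xp_inc0 val_eqE (negPf ij).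
Qed.

Lemma ext_uniq s V W (g : 'Hom(freeg s V, W)) :
  (forall phi, g (grx (freeg s V) phi) = grx W (g phi)) -> g = ext s (g \o inc0 s V)%VF.
Proof.
move=> gx; have gxp m phi : g (xp (freeg s V) m phi) = xp W m (g phi).
  by elim: m => [|m IHm]; rewrite ?xp0 // !xpS gx IHm.
apply/lfunP=> phi; rewrite {1}(free_decomp phi) linear_sum extE.
by apply: eq_bigr => i _; rewrite /= gxp comp_lfunE.
Qed.

Definition freemap_fun s V W (f : 'Hom(V, W)) (phi : freeg s V) : freeg s W :=
  [ffun i : 'I_n.+1 => f ((phi : {ffun _ -> _}) i)].
Lemma freemap_lin s V W f : linear (@freemap_fun s V W f).
Proof. by move=> a u v; apply/ffunP=> i; rewrite !ffunE linearP. Qed.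
Definition freemap s V W (f : 'Hom(V, W)) : 'Hom(freeg s V, freeg s W) :=
  linfun (@freemap_fun s V W f).
Lemma freemapE s V W (f : 'Hom(V, W)) (phi : freeg s V) (i : 'I_n.+1) :
  (freemap s f phi : {ffun _ -> _}) i = f ((phi : {ffun _ -> _}) i).
Proof. by rewrite (linfunE (@freemap_lin s V W f)) ffunE. Qed.

Lemma freemap_grhom s V W (f : 'Hom(V, W)) : degr 0 f -> is_grhom (freemap s f).
Proof.
move=> df; apply/grhomP; split=> [d phi /pgrP h|phi].
  by apply/pgrP=> i; rewrite freemapE addr0 -[X in gr W X]addr0 df.
apply/ffunP=> i; rewrite freemapE !free_x !ffunE.
by case: (nat_of_ord i) => [|j]; rewrite ?linear0 ?freemapE.
Qed.

Lemma ext_freemap s V W (f : 'Hom(V, W)) (phi : freeg s V) : is_grhom f ->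
  ext s \1%VF (freemap s f phi) = f (ext s \1%VF phi).
Proof.
move=> fh; rewrite !extE linear_sum; apply: eq_bigr => i _.
by rewrite freemapE !id_lfunE /= (grhom_xp _ _ fh).
Qed.

Lemma coext_freemap s V W (f : 'Hom(V, W)) v : is_grhom f ->
  freemap s f (coext s \1%VF v) = coext s \1%VF (f v).
Proof.
move=> fh; apply/ffunP=> i; rewrite freemapE !coextE !id_lfunE.
exact: grhom_xp.
Qed.

(** The differential [m (x) x^i |-> m (x) x^(i+1) - x m (x) x^i]; its kernel
    is the image of [coext \1] and its image is the kernel of [ext \1]. *)
Definition freed_fun s t V (phi : freeg s V) : freeg t V :=
  pshift phi - [ffun i : 'I_n.+1 => grx V ((phi : {ffun _ -> _}) i)].
Lemma freed_lin s t V : linear (@freed_fun s t V).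
Proof.
move=> a u v; rewrite /freed_fun pshift_lin.
apply/ffunP=> i; rewrite !ffunE linearP scalerBr.
by rewrite opprD addrACA.
Qed.
Definition freed s t V : 'Hom(freeg s V, freeg t V) := linfun (@freed_fun s t V).
Lemma freedE s t V (phi : freeg s V) (i : 'I_n.+1) : (freed s t V phi : {ffun _ -> _}) i =
  (if nat_of_ord i is j.+1 then (phi : {ffun _ -> _}) (inord j) else 0)
  - grx V ((phi : {ffun _ -> _}) i).
Proof. by rewrite (linfunE (@freed_lin s t V)) !ffunE. Qed.

Lemma freed_grhom s t V : t = s + 1 -> is_grhom (freed s t V).
Proof.
move=> ->; apply/grhomP; split=> [d phi h|phi].
  apply/pgrP=> i; rewrite freedE memvB //.
    have /pgrP/(_ i) := @grx_degr _ _ (freeg s V) _ _ h; rewrite free_x ffunE.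
    by congr (_ \in gr V _); lia.
  move/pgrP/(_ i): h => /grx_degr.
  by congr (_ \in gr V _); lia.
apply/ffunP=> i; rewrite freedE !free_x !ffunE.
case E: (nat_of_ord i) => [|j]; first by rewrite linear0 subrr.
rewrite freedE ffunE; congr (_ - _).
Qed.

Lemma freed_freemap s t V W (f : 'Hom(V, W)) (phi : freeg s V) : is_grhom f ->
  freed s t W (freemap s f phi) = freemap t f (freed s t V phi).
Proof.
move=> /grhomP[_ fx]; apply/ffunP=> i; rewrite freemapE !freedE !freemapE linearB /= fx.
by congr (_ - _); case: (nat_of_ord i) => [|j]; rewrite ?linear0 ?freemapE.
Qed.

Lemma freed_ker s t V (phi : freeg s V) : freed s t V phi = 0 ->
  phi = coext s \1%VF ((phi : {ffun _ -> _}) ord_max).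
Proof.
move=> d0; have E (j : nat) : (j < n)%N -> phi (inord j) = grx V (phi (inord j.+1)).
  move=> jn; have /ffunP/(_ (inord j.+1)) := d0.
  by rewrite freedE inordK // ffunE => /eqP; rewrite subr_eq0 => /eqP.
have F m : (m <= n)%N -> phi (inord (n - m)) = xp V m (phi (inord n)).
  elim: m => [|m IHm] mn; first by rewrite subn0 xp0.
  rewrite xpS -IHm; last lia.
  by rewrite E; [congr (grx V (phi (inord _))); lia | lia].
apply/ffunP=> i; rewrite coextE id_lfunE.
have := F (n - i)%N (leq_subr _ _); rewrite subKn -1?ltnS // inord_val => ->.
by congr (xp V _ (phi _)); apply: val_inj; rewrite /= inordK.
Qed.

Lemma freed_coext s t V v : freed s t V (coext s \1%VF v) = 0.
Proof.
apply/ffunP=> i; rewrite freedE coextE ffunE !id_lfunE -xpS.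
case E: (nat_of_ord i) => [|j]; first by rewrite subn0 xp_nil ?subr0.
have jn := ltn_ord i; rewrite coextE id_lfunE inordK; last lia.
by apply/eqP; rewrite subr_eq0; apply/eqP; congr (xp V _ v); lia.
Qed.

Lemma ext_freed s t V (phi : freeg s V) : ext t \1%VF (freed s t V phi) = 0.
Proof.
rewrite extE; under eq_bigr do rewrite id_lfunE freedE linearB /=.
rewrite sumrB big_ord_recl /= linear0 add0r [X in _ - X]big_ord_recr /=.
rewrite -xpSr xp_nil // addr0; apply/eqP; rewrite subr_eq0; apply/eqP.
apply: eq_bigr => i _; rewrite /= xpSr; congr (xp V i (grx V (phi _))).
by apply: val_inj; rewrite /= inordK //; have := ltn_ord i; lia.
Qed.

(** The solution of [phi_(i-1) - x phi_i = psi_i] that starts from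
    [phi_(p-1) = 0]: it splits the differential over the kernel of
    [ext \1]. *)
Definition freeh_fun s t V (psi : freeg t V) : freeg s V :=
  [ffun i : 'I_n.+1 => \sum_(j < n.+1 | (i < j)%N) xp V (j - i.+1) ((psi : {ffun _ -> _}) j)].

Lemma freed_freeh s t V (psi : freeg t V) : ext t \1%VF psi = 0 ->
  freed s t V (freeh_fun s psi) = psi.
Proof.
move=> e0; apply/ffunP=> i; rewrite freedE ffunE linear_sum.
have -> : \sum_(j < n.+1 | (i < j)%N) grx V (xp V (j - i.+1) (psi j)) =
          \sum_(j < n.+1 | (i < j)%N) xp V (j - i) (psi j).
  by apply: eq_bigr => j ij; rewrite -xpS; congr (xp V _ _); lia.
case E: (nat_of_ord i) => [|m].
  apply/eqP; rewrite sub0r eqr_oppLR -subr_eq0 opprK; apply/eqP; rewrite -[RHS]e0 extE.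
  rewrite [RHS](bigD1 ord0) //= addrC; congr (_ + _).
    rewrite (eq_bigl (fun j : 'I_n.+1 => j != ord0)).
      by apply: eq_bigr => j _; rewrite subn0 id_lfunE.
    by move=> j; rewrite -val_eqE /= lt0n.
  by rewrite !id_lfunE; congr (fun_of_fin psi _); apply: val_inj.
have mn : (m < n.+1)%N by have := ltn_ord i; lia.
rewrite ffunE inordK // (bigD1 i) /=; last by rewrite E.
rewrite E subnn xp0 -addrA -[RHS]addr0; congr (_ + _).
apply/eqP; rewrite subr_eq0; apply/eqP; apply: eq_bigl => j.
by rewrite -val_eqE /= E; lia.
Qed.

End Free.

(** * Monomorphisms and their conflations *)

Section Smono.
Variables (k : fieldType) (p : nat).
Local Notation smono := (smono k p).
Local Notation grmod := (grmod k p).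
Implicit Types X Y Z : smono.

Definition usub X : {vspace sM X} := limg (sf X).

Lemma sf_inj X : injective (sf X).
Proof. by apply/lker0P; rewrite sf_mono. Qed.

Lemma sf_usub X u : sf X u \in usub X.
Proof. by rewrite memv_img // memvf. Qed.

Lemma usubP X v : reflect (exists u, v = sf X u) (v \in usub X).
Proof.
apply: (iffP idP) => [/memv_imgP[u _ ->]|[u ->]]; [by exists u | exact: sf_usub].
Qed.

Lemma usub_gr X : grsub (usub X).
Proof. exact/grsub_img/sf_hom. Qed.

Lemma grsub_xp (V : grmod) (A : {vspace V}) i v : grsub A -> v \in A -> xp V i v \in A.
Proof. by move=> [_ Ax] vA; elim: i => [|i IHi]; rewrite ?xp0 // xpS Ax. Qed.

Lemma sf_strict X d u : sf X u \in gr (sM X) d -> u \in gr (sU X) d.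
Proof.
have /grhomP[sd _] := sf_hom X.
move=> /pr_id su; rewrite gr_homogP; apply/eqP/sf_inj.
by rewrite (degr_pr _ _ sd) addr0.
Qed.

Definition filt X Y (phi : 'Hom(sM X, sM Y)) : Prop :=
  forall u, u \in usub X -> phi u \in usub Y.

Lemma filt_comp X Y Z (g : 'Hom(sM Y, sM Z)) (f : 'Hom(sM X, sM Y)) :
  filt g -> filt f -> filt (g \o f)%VF.
Proof. by move=> gF fF u uU; rewrite comp_lfunE gF // fF. Qed.

Lemma filt_lin X Y a (f g : 'Hom(sM X, sM Y)) : filt f -> filt g -> filt (a *: f + g).
Proof. by move=> fF gF u uU; rewrite add_lfunE scale_lfunE memvD ?memvZ ?fF ?gF. Qed.

Lemma filt1 X : filt (\1%VF : 'End(sM X)).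
Proof. by move=> u; rewrite id_lfunE. Qed.

Lemma filt_xp X i : filt (xp (sM X) i).
Proof. by move=> u uU; apply: grsub_xp => //; apply: usub_gr. Qed.

Lemma filt_hmg X Y j (phi : 'Hom(sM X, sM Y)) : filt phi -> filt (hmg j phi).
Proof.
move=> fF u uU; rewrite sum_lfunE; apply: memv_suml => d _; rewrite !comp_lfunE.
have [Xd _] := usub_gr X; have [Yd _] := usub_gr Y.
exact/Yd/fF/Xd.
Qed.

(** As [U' -> M'] is injective, a morphism is determined by this component;
    conversely [mk_mor] completes a filtered map of graded modules. *)
Definition topmap X Y (f : smor X Y) : 'Hom(sM X, sM Y) := (smorval f).2.

Lemma topmap_sf X Y (f : smor X Y) u : topmap f (sf X u) = sf Y ((smorval f).1 u).
Proof. by have [_ _ /lfunP/(_ u)] := smorE f; rewrite !comp_lfunE. Qed.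

Lemma topmap_grhom X Y (f : smor X Y) : is_grhom (topmap f).
Proof. by have [_ h _] := smorE f. Qed.

Lemma topmap_filt X Y (f : smor X Y) : filt (topmap f).
Proof. by move=> _ /usubP[u ->]; rewrite topmap_sf sf_usub. Qed.

Lemma topmap_inj X Y (f g : smor X Y) : topmap f = topmap g -> f = g.
Proof.
move=> fg; apply: smor_eq => //; apply/lfunP=> u; apply: sf_inj.
by rewrite -!topmap_sf fg.
Qed.

Section Make.
Variables (X Y : smono) (g : 'Hom(sM X, sM Y)) (gh : is_grhom g) (gF : filt g).

Let gU : 'Hom(sU X, sU Y) := ((sf Y)^-1 \o g \o sf X)%VF.

Fact mk_gU u : sf Y (gU u) = g (sf X u).
Proof. by rewrite !comp_lfunE limg_lfunVK //; apply: gF (sf_usub u). Qed.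

Fact mk_mor_proof : is_smor (gU, g).
Proof.
have /grhomP[gd gx] := gh.
have /grhomP[Xd Xx] := sf_hom X; have /grhomP[Yd Yx] := sf_hom Y.
split=> //=; last by apply/lfunP=> u; rewrite [RHS]comp_lfunE mk_gU comp_lfunE.
apply/grhomP; split=> [d u ud|u]; last by apply: sf_inj; rewrite Yx !mk_gU Xx gx.
by apply: sf_strict; rewrite mk_gU; have := gd _ _ (Xd _ _ ud); rewrite !addr0.
Qed.

Definition mk_mor : smor X Y := mk_smor mk_mor_proof.

Lemma topmap_mk : topmap mk_mor = g. Proof. by []. Qed.
End Make.

Section SubSmono.
Variables (V : grmod) (A B : {vspace V}).
Hypotheses (hA : grsub A) (hB : grsub B) (AB : {subset A <= B}).

Let inc : 'Hom(subg hA, subg hB) :=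
  (linfun (vsproj B) \o linfun (vsval : subvs_of A -> V))%VF.

Fact sub_incE w : vsval (inc w) = vsval w.
Proof. by rewrite comp_lfunE vsval_lf vsproj_lf vsprojK // AB // subvsP. Qed.

Fact sub_inc_grhom : is_grhom inc.
Proof.
apply/grhomP; split=> [d w|w]; first by rewrite addr0 !subg_gr sub_incE.
by apply: subvs_inj; rewrite subg_x !sub_incE subg_x.
Qed.

Fact sub_inc_mono : lker inc = 0%VS.
Proof.
by apply/eqP/lker0P => u v uv; apply: subvs_inj; rewrite -!sub_incE uv.
Qed.

Definition sub_smono : smono := Smono sub_inc_grhom sub_inc_mono.

Lemma sub_usub (w : sM sub_smono) : (w \in usub sub_smono) = (vsval w \in A).
Proof.
apply/usubP/idP => [[u ->]|wA]; first by rewrite sub_incE subvsP.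
exists (vsproj A (vsval w) : subg hA).
by apply: subvs_inj; rewrite sub_incE vsprojK.
Qed.

Lemma sub_mem (w : sM sub_smono) : vsval w \in B.
Proof. exact: subvsP. Qed.

Section Into.
Variables (Y : smono) (g : 'Hom(sM Y, V)) (gh : is_grhom g).
Hypotheses (gB : forall y, g y \in B) (gA : forall u, u \in usub Y -> g u \in A).

Let g' : 'Hom(sM Y, sM sub_smono) := (linfun (vsproj B) \o g)%VF.
Fact intoE y : vsval (g' y) = g y.
Proof. by rewrite comp_lfunE vsproj_lf vsprojK. Qed.

Fact into_grhom : is_grhom g'.
Proof.
have /grhomP[gd gx] := gh; apply/grhomP; split=> [d v vd|v].
  by rewrite subg_gr intoE gd.
by apply: subvs_inj; rewrite subg_x !intoE gx.
Qed.

Fact into_filt : filt g'.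
Proof. by move=> u uU; rewrite sub_usub intoE gA. Qed.

Definition into_sub : smor Y sub_smono := mk_mor into_grhom into_filt.

Lemma into_subE y : vsval (topmap into_sub y) = g y. Proof. exact: intoE. Qed.
End Into.

End SubSmono.

Section SubMap.
Variables (V V' : grmod) (A B : {vspace V}) (A' B' : {vspace V'}).
Hypotheses (hA : grsub A) (hB : grsub B) (AB : {subset A <= B}).
Hypotheses (hA' : grsub A') (hB' : grsub B') (AB' : {subset A' <= B'}).
Variables (g : 'Hom(V, V')) (gh : is_grhom g).
Hypotheses (gA : forall a, a \in A -> g a \in A') (gB : forall b, b \in B -> g b \in B').

Let g' : 'Hom(sM (sub_smono hA hB AB), V') := (g \o linfun (vsval : subvs_of B -> V))%VF.
Fact sub_mapE w : g' w = g (vsval w). Proof. by rewrite comp_lfunE vsval_lf. Qed.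

Fact sub_map_grhom : is_grhom g'.
Proof.
have /grhomP[gd gx] := gh; apply/grhomP; split=> [d w|w].
  by rewrite subg_gr sub_mapE => /gd.
by rewrite !sub_mapE subg_x gx.
Qed.

Fact sub_map_B w : g' w \in B'. Proof. by rewrite sub_mapE gB // subvsP. Qed.
Fact sub_map_A w : w \in usub (sub_smono hA hB AB) -> g' w \in A'.
Proof. by rewrite sub_usub sub_mapE; apply: gA. Qed.

Definition sub_map : smor (sub_smono hA hB AB) (sub_smono hA' hB' AB') :=
  into_sub hA' hB' AB' sub_map_grhom sub_map_B sub_map_A.

Lemma vsval_sub_map w : vsval (topmap sub_map w) = g (vsval w).
Proof. by rewrite into_subE sub_mapE. Qed.
End SubMap.

Local Notation E := (smono_conflcat k p).

Lemma topmap_comp (X Y Z : E) (g : hom Y Z) (f : hom X Y) :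
  topmap (comp g f : smor X Z) = (topmap (g : smor Y Z) \o topmap (f : smor X Y))%VF.
Proof. by []. Qed.

Lemma topmap_id (X : E) : topmap (idm X : smor X X) = \1%VF.
Proof. by []. Qed.

Lemma topmap_lin (X Y : E) a (f g : hom X Y) :
  topmap (a *: f + g : smor X Y) = a *: topmap (f : smor X Y) + topmap (g : smor X Y).
Proof. by []. Qed.

Lemma topmap_sub (X Y : E) (f g : hom X Y) :
  topmap (f - g : smor X Y) = topmap (f : smor X Y) - topmap (g : smor X Y).
Proof. by []. Qed.

Lemma topmap_0 (X Y : E) : topmap (0 : hom X Y) = 0.
Proof. by []. Qed.

Lemma retraction X : exists e : 'Hom(sM X, sU X),
  degr 0 e /\ forall u, e (sf X u) = u.
Proof.
have /grhomP[sd _] := sf_hom X.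
exists (hmg 0 (sf X)^-1%VF); split; first exact: hmg_degr.
move=> u; rewrite -comp_lfunE (hmg_compr (i := 0) (l := 0)) //.
by rewrite lker0_compVf ?sf_mono // hmg_id ?id_lfunE //; apply: degr1.
Qed.

(** Exactness on the subobjects [U] follows from exactness on [M] together
    with strictness of both maps for the subspaces. *)
Lemma confl_intro (X Y Z : E) (i : hom X Y) (q : hom Y Z) :
  injective (topmap (i : smor X Y)) ->
  (forall x, topmap (q : smor Y Z) (topmap (i : smor X Y) x) = 0) ->
  (forall y, topmap (q : smor Y Z) y = 0 -> exists2 x, y = topmap (i : smor X Y) x &
      y \in usub Y -> x \in usub X) ->
  (forall z, exists2 y, topmap (q : smor Y Z) y = z & z \in usub Z -> y \in usub Y) ->
  confl i q.
Proof.
move=> ii qi ex qs; split; split.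
- apply/eqP/lker0P=> u v uv; apply: (@sf_inj X); apply: ii.
  by rewrite !topmap_sf uv.
- apply/vspaceP=> u; rewrite memv_ker; apply/memv_imgP/eqP => [[x _ ->]|qu].
    by apply: (@sf_inj Z); rewrite -!topmap_sf qi linear0.
  have [|x xE xU] := ex (sf Y u); first by rewrite topmap_sf qu linear0.
  have /usubP[x0 x0E] := xU (sf_usub u); exists x0; rewrite ?memvf //.
  by apply: (@sf_inj Y); rewrite xE x0E -topmap_sf.
- apply/vspaceP=> z; rewrite memvf; apply/memv_imgP.
  have [y yE yU] := qs (sf Z z); have /usubP[y0 y0E] := yU (sf_usub z).
  by exists y0; rewrite ?memvf //; apply: (@sf_inj Z); rewrite -yE y0E -topmap_sf.
- exact/eqP/lker0P.
- apply/vspaceP=> y; rewrite memv_ker; apply/memv_imgP/eqP => [[x _ ->]|qy].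
    exact: qi.
  by have [x xE _] := ex y qy; exists x; rewrite ?memvf.
apply/vspaceP=> z; rewrite memvf; apply/memv_imgP.
by have [y yE _] := qs z; exists y; rewrite ?memvf.
Qed.

Section ConflFacts.
Variables (X Y Z : E) (i : hom X Y) (q : hom Y Z).
Hypothesis c : confl i q.
Let iM := topmap (i : smor X Y).
Let qM := topmap (q : smor Y Z).

Lemma confl_i_inj : injective iM.
Proof. by apply/lker0P; case: c => _ [-> _ _]. Qed.

Lemma confl_ex y : qM y = 0 -> exists x, y = iM x.
Proof.
case: c => _ [_ e _]; move=> qy.
have : y \in lker (smorval q).2 by rewrite memv_ker; apply/eqP.
by rewrite -e => /memv_imgP[x _ ->]; exists x.
Qed.

Lemma confl_qi x : qM (iM x) = 0.
Proof.
case: c => _ [_ e _]; apply/eqP; rewrite -memv_ker.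
by rewrite [lker _](esym e) memv_img ?memvf.
Qed.

Lemma confl_exU x : iM x \in usub Y -> x \in usub X.
Proof.
case: c => [[_ e _] _] /usubP[y yE].
have : y \in lker (smorval q).1.
  rewrite memv_ker; apply/eqP/(@sf_inj Z); rewrite -topmap_sf -yE linear0.
  exact: confl_qi.
rewrite -e => /memv_imgP[x0 _ yx]; suff -> : x = sf X x0 by exact: sf_usub.
by apply: confl_i_inj; rewrite yE yx -topmap_sf.
Qed.

(** Conflations split linearly, compatibly with gradings and subspaces: use a
    section of the map on [U] where a retraction of [M] onto [U] allows it, and
    a section of the map on [M] for the rest. *)
Lemma confl_section : exists s : 'Hom(sM Z, sM Y),
  [/\ degr 0 s, filt s & forall z, qM (s z) = z].
Proof.
have [e [ed eE]] := retraction Z.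
have /grhomP[Yd _] := sf_hom Y; have /grhomP[Zd _] := sf_hom Z.
have /grhomP[qd _] := topmap_grhom q.
have /grhomP[q1d _] : is_grhom (smorval q).1 by case: (smorE q).
have q1 u : (smorval q).1 (hmg 0 ((smorval q).1)^-1%VF u) = u.
  rewrite -comp_lfunE (hmg_compl (l := 0) (j := 0)) //.
  have -> : ((smorval q).1 \o (smorval q).1^-1)%VF = \1%VF.
    by apply/lfunP=> w; rewrite comp_lfunE limg_lfunVK ?id_lfunE //;
      case: c => [[_ _ ->] _]; rewrite memvf.
  by rewrite hmg_id ?id_lfunE //; apply: degr1.
have q2 u : qM (hmg 0 qM^-1%VF u) = u.
  rewrite -comp_lfunE (hmg_compl (l := 0) (j := 0)) //.
  have -> : (qM \o qM^-1)%VF = \1%VF.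
    by apply/lfunP=> w; rewrite comp_lfunE limg_lfunVK ?id_lfunE //;
      case: c => [_ [_ _ h]]; rewrite [limg _]h memvf.
  by rewrite hmg_id ?id_lfunE //; apply: degr1.
set s1 := hmg 0 _ in q1; set s2 := hmg 0 _ in q2.
exists ((sf Y \o s1 \o e) + (s2 \o (\1 - (sf Z \o e))))%VF; split.
- have d0 : degr 0 (sf Z \o e)%VF by apply: degr_comp Zd ed; rewrite addr0.
  rewrite -[X in (X + _)%VF]scale1r; apply: degr_lin.
    apply: (degr_comp (i := 0) (j := 0)) => //.
    by apply: degr_comp Yd _; [rewrite addr0 | apply: hmg_degr].
  apply: (degr_comp (i := 0) (j := 0)) => //; first exact: hmg_degr.
  by rewrite -scaleN1r addrC; apply: degr_lin d0 _; apply: degr1.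
- move=> _ /usubP[u ->]; rewrite add_lfunE !comp_lfunE add_lfunE opp_lfunE id_lfunE.
  by rewrite comp_lfunE eE subrr linear0 addr0 sf_usub.
move=> z; rewrite add_lfunE !comp_lfunE linearD /= q2 [qM _]topmap_sf q1.
by rewrite add_lfunE opp_lfunE id_lfunE comp_lfunE addrC subrK.
Qed.

Lemma confl_retraction : exists r : 'Hom(sM Y, sM X),
  [/\ degr 0 r, filt r & forall x, r (iM x) = x].
Proof.
have [s [sd sF sE]] := confl_section.
have /grhomP[qd _] := topmap_grhom q; have /grhomP[id _] := topmap_grhom i.
have iV x : hmg 0 iM^-1%VF (iM x) = x.
  rewrite -comp_lfunE (hmg_compr (i := 0) (l := 0)) // lker0_compVf.
    by rewrite hmg_id ?id_lfunE //; apply: degr1.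
  exact/lker0P/confl_i_inj.
exists (hmg 0 iM^-1 \o (\1 - (s \o qM)))%VF.
have E y : exists2 x, y - s (qM y) = iM x &
    (hmg 0 iM^-1 \o (\1 - (s \o qM)))%VF y = x.
  have [|x xE] := @confl_ex (y - s (qM y)); first by rewrite linearB /= sE subrr.
  exists x => //; rewrite comp_lfunE add_lfunE opp_lfunE id_lfunE comp_lfunE xE.
  exact: iV.
split.
- apply: (degr_comp (i := 0) (j := 0)) => //; first exact: hmg_degr.
  rewrite -scaleN1r addrC; apply: degr_lin; last exact: degr1.
  by apply: degr_comp sd qd; rewrite addr0.
- move=> u uU; have [x xE ->] := E u; apply: confl_exU; rewrite -xE memvB //.
  exact/sF/topmap_filt.
move=> x; have [x' x'E ->] := E (iM x); apply: confl_i_inj.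
by rewrite -x'E confl_qi linear0 subr0.
Qed.

End ConflFacts.

Lemma smono_confl_epi (X Y Z W : E) (i : hom X Y) (q : hom Y Z) (a : hom Y W) :
  confl i q -> comp a i = 0 -> exists c : hom Z W, comp c q = a.
Proof.
move=> c ai; have [s [sd sF sE]] := confl_section c.
have /grhomP[ad ax] := topmap_grhom a; have /grhomP[qd qx] := topmap_grhom q.
have aK y : topmap (q : smor Y Z) y = 0 -> topmap (a : smor Y W) y = 0.
  move=> /(confl_ex c)[x ->].
  by have /(congr1 (@topmap X W)) := ai; rewrite topmap_comp => /lfunP/(_ x);
    rewrite comp_lfunE topmap_0 zero_lfunE.
have gh : is_grhom (topmap (a : smor Y W) \o s)%VF.
  apply/grhomP; split; first by apply: degr_comp ad sd; rewrite addr0.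
  move=> z; rewrite !comp_lfunE -ax; apply/eqP; rewrite -subr_eq0 -linearB.
  by apply/eqP/aK; rewrite linearB /= qx !sE subrr.
have gF : filt (topmap (a : smor Y W) \o s)%VF.
  by apply: filt_comp sF; apply: topmap_filt.
exists (mk_mor gh gF : hom Z W); apply: topmap_inj; rewrite topmap_comp topmap_mk.
apply/lfunP=> y; rewrite !comp_lfunE; apply/eqP; rewrite -subr_eq0 -linearB.
by apply/eqP/aK; rewrite linearB /= sE subrr.
Qed.

Lemma smono_confl_cancel (X Y Z W : E) (i : hom X Y) (q : hom Y Z) (a b : hom Z W) :
  confl i q -> comp a q = comp b q -> a = b.
Proof.
move=> c ab; have [s [_ _ sE]] := confl_section c; apply: topmap_inj.
apply/lfunP=> z; rewrite -(sE z).
by have /(congr1 (@topmap Y W)) := ab; rewrite !topmap_comp => /lfunP/(_ (s z)); rewrite !comp_lfunE.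
Qed.

Lemma smono_confl0 (X Y Z : E) (i : hom X Y) (q : hom Y Z) :
  confl i q -> comp q i = 0.
Proof.
move=> c; apply: topmap_inj; apply/lfunP=> x; rewrite topmap_comp comp_lfunE topmap_0 zero_lfunE.
exact: confl_qi c x.
Qed.

End Smono.

(** * Shift, free objects and suspension *)

Section Syzygy.
Variables (k : fieldType) (n : nat).
Local Notation smono := (smono k n.+1).
Local Notation E := (smono_conflcat k n.+1).
Implicit Types (s t : int) (X Y Z : smono).

Fact shift_grhom s X : is_grhom (sf X : 'Hom(shiftg s (sU X), shiftg s (sM X))).
Proof.
have /grhomP[fd fx] := sf_hom X; apply/grhomP; split=> // d v vd.
by rewrite addr0; have := fd _ _ vd; rewrite addr0.
Qed.

Definition shiftsm s X : smono := Smono (shift_grhom s X) (sf_mono X).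

Section ShiftMor.
Variables (s t : int) (X Y : smono) (f : smor X Y).
Hypothesis st : s = t.

Fact shift_mor_grhom : is_grhom (topmap f : 'Hom(sM (shiftsm s X), sM (shiftsm t Y))).
Proof.
have /grhomP[fd fx] := topmap_grhom f; apply/grhomP; split=> // d v vd.
by rewrite addr0 -st; have := fd _ _ vd; rewrite addr0.
Qed.

Definition shift_mor : smor (shiftsm s X) (shiftsm t Y) :=
  mk_mor shift_mor_grhom (topmap_filt f).
End ShiftMor.

Program Definition shiftF s : functor E E :=
  @Functor k E E (shiftsm s) (fun X Y f => shift_mor f (erefl s)) _ _ _.
Next Obligation. by move=> s X Y a f g; apply: topmap_inj. Qed.
Next Obligation. by move=> s X; apply: topmap_inj. Qed.
Next Obligation. by move=> s X Y Z g f; apply: topmap_inj. Qed.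

Fact freesm_grhom s X : is_grhom (freemap s (sf X)).
Proof. by apply: freemap_grhom; have /grhomP[] := sf_hom X. Qed.

Fact freesm_mono s X : lker (freemap s (sf X)) = 0%VS.
Proof.
apply/eqP/lker0P => u v uv; apply/ffunP=> i; apply: (@sf_inj _ _ X).
by rewrite -!(freemapE (sf X)) uv.
Qed.

Definition freesm s X : smono := Smono (freesm_grhom s X) (freesm_mono s X).

Lemma free_usub s X (phi : sM (freesm s X)) :
  reflect (forall i, (phi : {ffun 'I_n.+1 -> sM X}) i \in usub X) (phi \in usub (freesm s X)).
Proof.
apply: (iffP (usubP _)) => [[u ->] i|h]; first by rewrite freemapE sf_usub.
have hh i := usubP _ (h i); have [u uE] := all_sig (fun i => cid (hh i)).
exists ([ffun i => u i] : freeg s (sU X)); apply/ffunP=> i.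
by rewrite freemapE ffunE -uE.
Qed.

Lemma ext_filt s X Y (g : 'Hom(sM X, sM Y)) : filt g ->
  @filt _ _ (freesm s X) Y (ext s g).
Proof.
move=> gF u /free_usub uU; rewrite extE; apply: memv_suml => i _.
exact/filt_xp/gF/uU.
Qed.

Lemma coext_filt s X Y (g : 'Hom(sM Y, sM X)) : filt g ->
  @filt _ _ Y (freesm s X) (coext s g).
Proof.
move=> gF u uU; apply/free_usub => i; rewrite coextE.
by apply/gF/filt_xp.
Qed.

Lemma inc0_filt s X : @filt _ _ X (freesm s X) (inc0 s (sM X)).
Proof.
move=> u uU; apply/free_usub => i; rewrite inc0E; case: ifP => // _.
exact: mem0v.
Qed.

Lemma Nm_filt X Y (phi : 'Hom(sM X, sM Y)) : filt phi -> filt (Nm phi).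
Proof.
move=> pF; rewrite -(NmK phi 0).
apply: (@filt_comp _ _ X (freesm 0 X) Y); first exact: ext_filt.
by apply: coext_filt; apply: filt1.
Qed.

Definition lastc s (V W : grmod k n.+1) (g : 'Hom(W, freeg s V)) : 'Hom(W, V) :=
  (linfun (@pev k n V ord_max) \o g)%VF.

Lemma lastcE s (V W : grmod k n.+1) (g : 'Hom(W, freeg s V)) w :
  lastc g w = (g w : {ffun _ -> _}) ord_max.
Proof. by rewrite comp_lfunE (linfunE (@pev_lin k n V ord_max)). Qed.

Lemma coext_lastc s (V W : grmod k n.+1) (g : 'Hom(W, freeg s V)) :
  is_grhom g -> coext s (lastc g) = g.
Proof.
move=> /grhomP[_ gx]; apply/lfunP=> w; apply/ffunP=> i.
by rewrite coextE lastcE [RHS]coext_uniq.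
Qed.

Lemma lastc_degr s (V W : grmod k n.+1) (g : 'Hom(W, freeg s V)) :
  is_grhom g -> degr (s - n%:Z) (lastc g).
Proof.
move=> /grhomP[gd _] d w /gd; rewrite addr0 => /pgrP/(_ ord_max).
by rewrite lastcE; congr (_ \in gr V _); rewrite /=; lia.
Qed.

Lemma coext_comp s (U V W : grmod k n.+1) (g : 'Hom(W, V)) (f : 'Hom(U, W)) :
  is_grhom f -> (coext s g \o f)%VF = coext s (g \o f)%VF.
Proof.
move=> fh; apply/lfunP=> u; apply/ffunP=> i.
by rewrite comp_lfunE !coextE comp_lfunE (grhom_xp _ _ fh).
Qed.

Lemma ext_comp s (U V W : grmod k n.+1) (g : 'Hom(V, W)) (f : 'Hom(U, V)) :
  is_grhom g -> (g \o ext s f)%VF = ext s (g \o f)%VF.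
Proof.
move=> gh; apply/lfunP=> u; rewrite comp_lfunE !extE linear_sum.
by apply: eq_bigr => i _; rewrite comp_lfunE /= (grhom_xp _ _ gh).
Qed.

(** Maps out of a free object amount to linear maps on generators, maps into
    it to linear maps to the last component; both lift because conflations
    split linearly. *)
Lemma free_projinj s X : projinj (freesm s X : E).
Proof.
split=> [A B C i q c f|A B C i q c f].
  have [t [td tF tE]] := confl_section c.
  have /grhomP[fd fx] := topmap_grhom (f : smor _ _).
  pose g0 : 'Hom(sM X, sM B) := (t \o topmap (f : smor _ C) \o inc0 s (sM X))%VF.
  have gh : is_grhom (ext s g0).
    apply: ext_grhom; apply: (degr_comp (i := - s) (j := 0)); rewrite ?addr0 //.
      by apply: degr_comp td fd; rewrite addr0.
    exact: inc0_degr.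
  have gF : @filt _ _ (freesm s X) B (ext s g0).
    apply: ext_filt; apply: (@filt_comp _ _ X (freesm s X) B); last exact: inc0_filt.
    by apply: filt_comp tF _; apply: topmap_filt.
  exists (@mk_mor _ _ (freesm s X) B _ gh gF : hom (freesm s X : E) B); apply: topmap_inj.
  rewrite topmap_comp topmap_mk ext_comp; last exact: topmap_grhom.
  rewrite [RHS](ext_uniq fx); congr (ext s _); apply/lfunP=> x.
  by rewrite !comp_lfunE tE.
have [r [rd rF rE]] := confl_retraction c.
have fh := topmap_grhom (f : smor _ _).
pose g0 : 'Hom(sM B, sM X) := (lastc (topmap (f : smor A (freesm s X))) \o r)%VF.
have lF : filt (lastc (topmap (f : smor A (freesm s X)))).
  by move=> u uU; rewrite lastcE; apply/free_usub; apply: topmap_filt.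
have gh : is_grhom (coext s g0).
  apply: coext_grhom; apply: (degr_comp (i := 0) (j := s - n%:Z)); rewrite ?add0r //.
  exact: lastc_degr.
have gF : @filt _ _ B (freesm s X) (coext s g0).
  by apply: coext_filt; apply: filt_comp lF rF.
exists (@mk_mor _ _ B (freesm s X) _ gh gF : hom B (freesm s X : E)); apply: topmap_inj.
rewrite topmap_comp topmap_mk coext_comp; last exact: topmap_grhom.
rewrite -[RHS](coext_lastc fh); congr (coext s _); apply/lfunP=> x.
by rewrite !comp_lfunE rE.
Qed.

Fact freemap_mor_grhom s X Y (f : smor X Y) : is_grhom (freemap s (topmap f)).
Proof. by apply: freemap_grhom; have /grhomP[] := topmap_grhom f. Qed.

Fact freemap_filt s X Y (f : smor X Y) :
  @filt _ _ (freesm s X) (freesm s Y) (freemap s (topmap f)).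
Proof.
move=> u /free_usub uU; apply/free_usub => i; rewrite freemapE.
exact/topmap_filt/uU.
Qed.

Definition free_mor s X Y (f : smor X Y) : smor (freesm s X) (freesm s Y) :=
  @mk_mor _ _ (freesm s X) (freesm s Y) _ (freemap_mor_grhom s f) (@freemap_filt s X Y f).

Section Unit.
Variable X : smono.

Fact unit_grhom : is_grhom (coext n (\1%VF : 'End(sM X))).
Proof. by apply: coext_grhom; rewrite subrr; apply: degr1. Qed.
Fact unit_filt : @filt _ _ X (freesm n X) (coext n (\1%VF : 'End(sM X))).
Proof. by apply: coext_filt; apply: filt1. Qed.
Definition unit_mor : smor X (freesm n X) := @mk_mor _ _ X (freesm n X) _ unit_grhom unit_filt.

Let piM := ext n.+1 (\1%VF : 'End(sM X)).

Fact pi_degr s : degr s (ext s (\1%VF : 'End(sM X))).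
Proof. by apply: ext_degr (@degr1 _ _ _); rewrite addr0. Qed.

Fact ker_gr s : grsub (lker (ext s (\1%VF : 'End(sM X)))).
Proof.
apply: grsub_ker (@pi_degr s) _ => v v0.
by rewrite ext_x v0 linear0.
Qed.

Fact kerU_gr s : grsub (lker (ext s (\1%VF : 'End(sM X))) :&: usub (freesm s X))%VS.
Proof. exact: (grsub_cap (ker_gr s) (usub_gr (freesm s X))). Qed.

Fact kerU_sub s : {subset (lker (ext s (\1%VF : 'End(sM X))) :&: usub (freesm s X))%VS
                   <= lker (ext s (\1%VF : 'End(sM X)))}.
Proof. by apply/subvP; apply: capvSl. Qed.

(** The cokernel of the unit of [X], realised inside a free module as the
    kernel of the multiplication, which avoids forming quotients. *)
Definition suspsm : smono := sub_smono (kerU_gr n.+1) (ker_gr n.+1) (@kerU_sub n.+1).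

Fact counit_in (phi : sM (freesm n X)) :
  freed n n.+1 (sM X) phi \in lker piM.
Proof. by rewrite memv_ker ext_freed. Qed.

Fact counit_grhom : is_grhom (freed n n.+1 (sM X)).
Proof. by apply: freed_grhom; rewrite -addn1 PoszD. Qed.

Fact counit_inU (phi : sM (freesm n X)) : phi \in usub (freesm n X) ->
  freed n n.+1 (sM X) phi \in (lker piM :&: usub (freesm n.+1 X))%VS.
Proof.
move=> /free_usub pU; rewrite memv_cap counit_in; apply/free_usub => i.
have [_ Ux] := usub_gr X.
rewrite freedE memvB ?Ux //.
by case: (nat_of_ord i) => [|j]; rewrite ?mem0v.
Qed.

Definition counit_mor : smor (freesm n X) suspsm :=
  @into_sub _ _ _ _ _ (kerU_gr n.+1) (ker_gr n.+1) (@kerU_sub n.+1)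
    (freesm n X) _ counit_grhom counit_in counit_inU.

Lemma unit_inj : injective (topmap unit_mor).
Proof.
move=> u v /ffunP/(_ ord_max); rewrite !coextE !id_lfunE /= subnn.
by rewrite !xp0.
Qed.

Lemma susp_confl : confl (unit_mor : hom (X : E) (freesm n X)) (counit_mor : hom _ (suspsm : E)).
Proof.
apply: confl_intro; first exact: unit_inj.
- by move=> x; apply: subvs_inj; rewrite into_subE freed_coext.
- move=> phi /(congr1 (fun w => vsval w)); rewrite into_subE linear0 => d0.
  exists ((phi : {ffun _ -> _}) ord_max); first exact: (freed_ker d0).
  by move/free_usub.
move=> z; have := subvsP z; rewrite memv_ker => /eqP z0.
exists (freeh_fun n (vsval z)).
  by apply: subvs_inj; rewrite into_subE freed_freeh.
rewrite sub_usub memv_cap => /andP[_ /free_usub zU]; apply/free_usub => i.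
by rewrite ffunE; apply: memv_suml => j _; apply: filt_xp; apply: zU.
Qed.

End Unit.

Lemma unit_nat X Y (f : smor X Y) :
  comp (free_mor n f : hom (freesm n X : E) (freesm n Y))
       (unit_mor X : hom (X : E) (freesm n X : E))
  = comp (unit_mor Y : hom (Y : E) (freesm n Y : E)) (f : hom (X : E) Y).
Proof.
apply: topmap_inj; apply/lfunP=> x; rewrite !topmap_comp !comp_lfunE !topmap_mk.
exact/coext_freemap/topmap_grhom.
Qed.

(** A projective-injective object is a retract of the free object on it, so its
    identity is a norm, and norms absorb composition on both sides.  The
    converse is [NmK]. *)
Lemma stably_zeroP (X Y : E) (f : hom X Y) : stably_zero f <->
  exists phi : 'Hom(sM X, sM Y),
    [/\ degr (- n%:Z) phi, filt phi & topmap (f : smor X Y) = Nm phi].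
Proof.
split=> [[P [h [g [[_ iP] ->]]]]|[phi [pd pF fE]]].
  have [r rE] := iP _ _ _ _ _ (susp_confl P) (idm P).
  have /grhomP[rd rx] := topmap_grhom (r : smor (freesm n P) P).
  pose r0 := (topmap (r : smor (freesm n P) P) \o inc0 n (sM P))%VF.
  have r0F : @filt _ _ P P r0.
    by apply: (@filt_comp _ _ P (freesm n P) P); [exact: topmap_filt | exact: inc0_filt].
  have N1 : Nm r0 = \1%VF.
    by rewrite -topmap_id -rE topmap_comp (ext_uniq rx) NmK.
  have hh := topmap_grhom (h : smor P Y); have gh := topmap_grhom (g : smor X P).
  exists (topmap (h : smor P Y) \o r0 \o topmap (g : smor X P))%VF; split.
  - have /grhomP[hd _] := hh; have /grhomP[gd _] := gh.
    apply: (degr_comp (i := 0) (j := - n%:Z)); rewrite ?add0r //.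
    apply: (degr_comp (i := - n%:Z) (j := 0)); rewrite ?addr0 //.
    apply: (degr_comp (i := - n%:Z) (j := 0)); rewrite ?addr0 //.
    exact: inc0_degr.
  - by apply: filt_comp (topmap_filt g); apply: filt_comp r0F; apply: topmap_filt.
  by rewrite topmap_comp -Nm_compr // -Nm_compl // N1 comp_lfun1r.
have gh : is_grhom (ext n phi) by exact: ext_grhom.
exists (freesm n X : E), (@mk_mor _ _ (freesm n X) Y _ gh (ext_filt pF) : hom (freesm n X : E) Y),
  (unit_mor X : hom X (freesm n X : E)); split; first exact: free_projinj.
by apply: topmap_inj; rewrite topmap_comp !topmap_mk NmK.
Qed.

Section SuspMor.
Variables (X Y : smono) (f : smor X Y).

Fact susp_mor_ker phi : phi \in lker (ext n.+1 (\1%VF : 'End(sM X))) ->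
  freemap n.+1 (topmap f) phi \in lker (ext n.+1 (\1%VF : 'End(sM Y))).
Proof.
rewrite !memv_ker => /eqP p0; rewrite ext_freemap ?p0 ?linear0 //.
exact: topmap_grhom.
Qed.

Fact susp_mor_kerU phi :
  phi \in (lker (ext n.+1 (\1%VF : 'End(sM X))) :&: usub (freesm n.+1 X))%VS ->
  freemap n.+1 (topmap f) phi \in
    (lker (ext n.+1 (\1%VF : 'End(sM Y))) :&: usub (freesm n.+1 Y))%VS.
Proof.
rewrite !memv_cap => /andP[/susp_mor_ker-> pU] /=.
exact: freemap_filt.
Qed.

Definition susp_mor : smor (suspsm X) (suspsm Y) :=
  sub_map (kerU_gr X n.+1) (ker_gr X n.+1) (@kerU_sub X n.+1)
    (kerU_gr Y n.+1) (ker_gr Y n.+1) (@kerU_sub Y n.+1)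
    (freemap_mor_grhom n.+1 f) susp_mor_kerU susp_mor_ker.

Lemma susp_morE w : vsval (topmap susp_mor w) = freemap n.+1 (topmap f) (vsval w).
Proof. exact: vsval_sub_map. Qed.
End SuspMor.

Program Definition suspF : functor E E :=
  @Functor k E E suspsm (fun X Y f => susp_mor f) _ _ _.
Next Obligation.
move=> X Y a f g; apply: topmap_inj; apply/lfunP=> u; apply: subvs_inj.
rewrite topmap_lin add_lfunE scale_lfunE linearP /= !susp_morE; apply/ffunP=> i.
by rewrite !ffunE !freemapE topmap_lin add_lfunE scale_lfunE.
Qed.
Next Obligation.
move=> X; apply: topmap_inj; apply/lfunP=> u; apply: subvs_inj; rewrite susp_morE.
by apply/ffunP=> i; rewrite freemapE !id_lfunE.
Qed.
Next Obligation.
move=> X Y Z g f; apply: topmap_inj; apply/lfunP=> u; apply: subvs_inj.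
rewrite topmap_comp comp_lfunE !susp_morE; apply/ffunP=> i.
by rewrite !freemapE comp_lfunE.
Qed.

Lemma counit_nat X Y (f : smor X Y) :
  comp (susp_mor f : hom (suspsm X : E) (suspsm Y))
       (counit_mor X : hom (freesm n X : E) (suspsm X : E))
  = comp (counit_mor Y : hom (freesm n Y : E) (suspsm Y : E))
         (free_mor n f : hom (freesm n X : E) (freesm n Y)).
Proof.
apply: topmap_inj; apply/lfunP=> x; apply: subvs_inj.
rewrite topmap_comp comp_lfunE susp_morE topmap_comp comp_lfunE !into_subE topmap_mk freed_freemap //.
exact: topmap_grhom.
Qed.

(** The multiplication [X (x) A -> X] ends a conflation that starts at the
    suspension of [X]; so [X(p)] suspends that suspension. *)
Section Cover.
Variable X : smono.

Let inc : 'Hom(sM (suspsm X), freeg n.+1 (sM X)) := linfun (vsval : subvs_of _ -> freeg n.+1 (sM X)).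
Let incE w : inc w = vsval w. Proof. exact: vsval_lf. Qed.

Fact ker_inc_grhom : is_grhom inc.
Proof.
apply/grhomP; split=> [d w|w]; first by rewrite subg_gr incE addr0.
by rewrite !incE subg_x.
Qed.
Fact ker_inc_filt : @filt _ _ (suspsm X) (freesm n.+1 X) inc.
Proof. by move=> w; rewrite sub_usub memv_cap incE => /andP[]. Qed.
Definition ker_inc : smor (suspsm X) (freesm n.+1 X) :=
  @mk_mor _ _ (suspsm X) (freesm n.+1 X) _ ker_inc_grhom ker_inc_filt.

Fact cover_grhom :
  is_grhom (ext n.+1 \1%VF : 'Hom(sM (freesm n.+1 X), sM (shiftsm n.+1 X))).
Proof.
apply/grhomP; split=> [d v vd|v]; last exact: (ext_x (\1%VF : 'End(sM X)) v).
by rewrite addr0; apply: (@pi_degr X n.+1 _ _ vd).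
Qed.
Fact cover_filt : @filt _ _ (freesm n.+1 X) (shiftsm n.+1 X) (ext n.+1 \1%VF).
Proof. exact: (ext_filt (X := X) (Y := X) (@filt1 _ _ X)). Qed.
Definition cover_mor : smor (freesm n.+1 X) (shiftsm n.+1 X) :=
  @mk_mor _ _ (freesm n.+1 X) (shiftsm n.+1 X) _ cover_grhom cover_filt.

Lemma cover_morE (phi : freeg n.+1 (sM X)) : topmap cover_mor phi = ext n.+1 \1%VF phi.
Proof. by []. Qed.

Lemma cover_confl : confl (ker_inc : hom (suspsm X : E) (freesm n.+1 X))
  (cover_mor : hom (freesm n.+1 X : E) (shiftsm n.+1 X)).
Proof.
apply: confl_intro.
- by move=> u v; rewrite !topmap_mk !incE; apply: subvs_inj.
- by move=> w; rewrite !topmap_mk incE; apply/eqP; rewrite -memv_ker; apply: sub_mem.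
- move=> phi p0; have pk : phi \in lker (ext n.+1 (\1%VF : 'End(sM X))).
    by rewrite memv_ker; apply/eqP.
  exists (vsproj _ phi : sM (suspsm X)); first by rewrite topmap_mk incE vsprojK.
  by move=> pU; rewrite sub_usub vsprojK // memv_cap pk.
move=> z; exists (inc0 n.+1 (sM X) z); last by move=> zU; apply: (@inc0_filt n.+1 X).
rewrite cover_morE extE (bigD1 ord0) //= big1 => [|i i0].
  by rewrite addr0 !id_lfunE inc0E eqxx.
by rewrite inc0E (negPf i0) !linear0.
Qed.
End Cover.

Local Notation S := (stable_smono k n.+1).

Lemma shift_zero s (X Y : E) (f : hom X Y) : stably_zero f -> stably_zero (fmap (shiftF s) f).
Proof.
move=> /stably_zeroP[phi [pd pF pE]]; apply/stably_zeroP; exists phi; split=> //.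
by move=> d v /pd; rewrite addrAC.
Qed.

Definition Tsh s : functor S S := stabF (@shift_zero s).

Lemma susp_zero (X Y : E) (f : hom X Y) : stably_zero f -> stably_zero (fmap suspF f).
Proof.
move=> f0; apply: (confl_lift_zero (@smono_confl_epi k n.+1)
  (@smono_confl_cancel k n.+1) (@smono_confl0 k n.+1) (susp_confl X) (susp_confl Y)
  (free_projinj n Y) f0).
- exact: unit_nat.
- exact: counit_nat.
Qed.

Definition Sig : functor S S := stabF susp_zero.

Lemma Tsh_scl s (X Y : E) (f : hom X Y) :
  fmap (Tsh s) (scl f) = scl (shift_mor f (erefl s) : hom (shiftsm s X : E) (shiftsm s Y)).
Proof. exact: stabF_scl. Qed.

Lemma Sig_scl (X Y : E) (f : hom X Y) :
  fmap Sig (scl f) = scl (susp_mor f : hom (suspsm X : E) (suspsm Y)).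
Proof. exact: stabF_scl. Qed.

Lemma Sig_suspends : suspends (idF S) Sig.
Proof.
apply: (@suspends_strict k E (@smono_confl_epi k n.+1) (@smono_confl_cancel k n.+1)
  (@smono_confl0 k n.+1) (idF S) Sig (fun X Y f => f) (fun X Y f => susp_mor f)
  (freesm n) (fun X Y f => free_mor n f) unit_mor counit_mor).
- by [].
- exact: Sig_scl.
- by move=> Z; split; [exact: free_projinj | exact: susp_confl].
- exact: unit_nat.
- exact: counit_nat.
Qed.

Lemma Tsh_suspends : suspends Sig (Tsh n.+1).
Proof.
apply: (@suspends_strict k E (@smono_confl_epi k n.+1) (@smono_confl_cancel k n.+1)
  (@smono_confl0 k n.+1) Sig (Tsh n.+1) (fun X Y f => susp_mor f)
  (fun X Y f => shift_mor f (erefl n.+1%:Z))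
  (freesm n.+1) (fun X Y f => free_mor n.+1 f) ker_inc cover_mor).
- exact: Sig_scl.
- exact: Tsh_scl.
- by move=> Z; split; [exact: free_projinj | exact: cover_confl].
- move=> X Y f; apply: topmap_inj; apply/lfunP=> w.
  by rewrite topmap_comp comp_lfunE [RHS]comp_lfunE !topmap_mk !vsval_lf susp_morE.
move=> X Y f; apply: topmap_inj; apply/lfunP=> w.
rewrite topmap_comp comp_lfunE [RHS]comp_lfunE.
exact/esym/(ext_freemap _ (topmap_grhom f)).
Qed.

Lemma Sig2 : nat_iso (compF Sig Sig) (Tsh n.+1).
Proof.
exact: (suspends_uniq (@smono_confl_epi k n.+1) (@smono_confl_cancel k n.+1)
  (@smono_confl0 k n.+1) (suspends_comp Sig Sig_suspends) Tsh_suspends).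
Qed.

Fact shift2_grhom s t X :
  is_grhom (\1%VF : 'Hom(shiftg s (shiftg t (sM X)), shiftg (s + t) (sM X))).
Proof.
apply/grhomP; split=> [d v|v]; last by rewrite !id_lfunE.
by rewrite id_lfunE /= addr0 addrA.
Qed.
Fact shift2V_grhom s t X :
  is_grhom (\1%VF : 'Hom(shiftg (s + t) (sM X), shiftg s (shiftg t (sM X)))).
Proof.
apply/grhomP; split=> [d v|v]; last by rewrite !id_lfunE.
by rewrite id_lfunE /= addr0 addrA.
Qed.

Lemma TshD s t : nat_iso (compF (Tsh s) (Tsh t)) (Tsh (s + t)).
Proof.
apply: (@nat_iso_strict k E (compF (Tsh s) (Tsh t)) (Tsh (s + t))
  (fun X Y f => shift_mor (shift_mor f (erefl t)) (erefl s))
  (fun X Y f => shift_mor f (erefl (s + t)))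
  (fun X => @mk_mor _ _ (shiftsm s (shiftsm t X)) (shiftsm (s + t) X) _
    (shift2_grhom s t X) (@filt1 _ _ X))
  (fun X => @mk_mor _ _ (shiftsm (s + t) X) (shiftsm s (shiftsm t X)) _
    (shift2V_grhom s t X) (@filt1 _ _ X))).
- move=> X Y f.
  transitivity (fmap (Tsh s) (scl (shift_mor f (erefl t) : hom (shiftsm t X : E) (shiftsm t Y)))).
    exact: (congr1 (fun g => fmap (Tsh s) g) (Tsh_scl t f)).
  exact: Tsh_scl.
- exact: Tsh_scl.
- by move=> X; apply: topmap_inj; exact: comp_lfun1l.
- by move=> X; apply: topmap_inj; exact: comp_lfun1l.
move=> X Y f; apply: topmap_inj; apply/lfunP=> v.
by rewrite topmap_comp comp_lfunE [RHS]comp_lfunE !id_lfunE.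
Qed.

Fact shift0_grhom X : is_grhom (\1%VF : 'Hom(shiftg 0 (sM X), sM X)).
Proof.
apply/grhomP; split=> [d v|v]; last by rewrite !id_lfunE.
by rewrite id_lfunE /= !addr0.
Qed.
Fact shift0V_grhom X : is_grhom (\1%VF : 'Hom(sM X, shiftg 0 (sM X))).
Proof.
apply/grhomP; split=> [d v|v]; last by rewrite !id_lfunE.
by rewrite id_lfunE /= !addr0.
Qed.

Lemma Tsh0 : nat_iso (Tsh 0) (idF S).
Proof.
apply: (@nat_iso_strict k E (Tsh 0) (idF S)
  (fun X Y f => shift_mor f (erefl 0)) (fun X Y f => f)
  (fun X => @mk_mor _ _ (shiftsm 0 X) X _ (shift0_grhom X) (@filt1 _ _ X))
  (fun X => @mk_mor _ _ X (shiftsm 0 X) _ (shift0V_grhom X) (@filt1 _ _ X))).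
- exact: Tsh_scl.
- by [].
- by move=> X; apply: topmap_inj; exact: comp_lfun1l.
- by move=> X; apply: topmap_inj; exact: comp_lfun1l.
move=> X Y f; apply: topmap_inj; apply/lfunP=> v.
by rewrite topmap_comp comp_lfunE [RHS]comp_lfunE !id_lfunE.
Qed.

Lemma TshV s t : s + t = 0 -> nat_iso (compF (Tsh s) (Tsh t)) (idF S).
Proof. by move=> st; apply: nat_iso_trans (TshD s t) _; rewrite st; apply: Tsh0. Qed.

Lemma Tsh_pow s m : nat_iso (fpow (Tsh s) m) (Tsh (s * m%:Z)).
Proof.
elim: m => [|m IHm]; first by rewrite mulr0; apply: nat_iso_sym Tsh0.
apply: nat_iso_trans (nat_iso_compr _ IHm) _.
by have := TshD s (s * m%:Z); congr (nat_iso _ (Tsh _)); rewrite -addn1 PoszD; ring.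
Qed.

End Syzygy.

(** * Orthogonality of filtered maps *)

Section LinearClosed.
Variable k : fieldType.

(** A subspace of largest dimension inside the predicate exhausts it. *)
Lemma vspace_of_pred (V : vectType k) (P : V -> Prop) :
  P 0 -> (forall a u v, P u -> P v -> P (a *: u + v)) ->
  exists A : {vspace V}, forall v, v \in A <-> P v.
Proof.
move=> P0 Pl; pose Q m := `[< exists A : {vspace V}, \dim A = m /\ forall v, v \in A -> P v >].
have exQ : exists m, Q m.
  exists 0%N; apply/asboolP; exists 0%VS; split; first exact: dimv0.
  by move=> v; rewrite memv0 => /eqP->.
have ubQ m : Q m -> (m <= \dim {:V})%N.
  by move=> /asboolP[A [<- _]]; rewrite dimvS // subvf.
case: (ex_maxnP exQ ubQ) => m /asboolP[A [dA AP]] mmax.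
exists A => v; split; first exact: AP.
move=> Pv; apply: contrapT => /negP vA.
have : Q (\dim (A + <[v]>)%VS).
  apply/asboolP; exists (A + <[v]>)%VS; split=> // w /memv_addP[a aA [_ /vlineP[c ->] ->]].
  by rewrite addrC; apply: Pl => //; apply: AP.
move/mmax; rewrite -dA => le; case/negP: vA.
have : (A + <[v]> <= A)%VS by rewrite -(dimv_leqif_sup (addvSl A <[v]>)).2;
  rewrite eqn_leq dimvS ?addvSl.
by move/subvP; apply; apply: subvP (addvSr _ _) _ (memv_line v).
Qed.

Lemma sep_pred (V : vectType k) (P : V -> Prop) (v : V) :
  P 0 -> (forall a u w, P u -> P w -> P (a *: u + w)) -> ~ P v ->
  exists xi : V -> k, [/\ scalar xi, forall a, P a -> xi a = 0 & xi v != 0].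
Proof.
move=> P0 Pl Pv; have [A AP] := vspace_of_pred P0 Pl.
have [|xi [xl x0 xv]] := @sep_functional _ _ A v; first by apply/negP => /AP.
by exists xi; split=> // a /AP; apply: x0.
Qed.

End LinearClosed.

Section Perp.
Variables (k : fieldType) (p : nat).
Implicit Types X Y : smono k p.

(** The annihilator of the filtered maps [X -> Y] for the trace form, by
    [ltr_perp] and [perp_of_ltr]. *)
Definition perp Y X (h : 'Hom(sM Y, sM X)) : Prop :=
  (forall y, h y \in usub X) /\ (forall u, u \in usub Y -> h u = 0).

Lemma perp_lin Y X a (f g : 'Hom(sM Y, sM X)) : perp f -> perp g -> perp (a *: f + g).
Proof.
move=> [f1 f2] [g1 g2]; split=> [y|u uU]; rewrite add_lfunE scale_lfunE.
  by rewrite memvD ?memvZ.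
by rewrite f2 // g2 // scaler0 addr0.
Qed.

Lemma perp0 Y X : perp (0 : 'Hom(sM Y, sM X)).
Proof. by split=> *; rewrite zero_lfunE ?mem0v. Qed.

Lemma perp_hmg Y X j (h : 'Hom(sM Y, sM X)) : perp h -> perp (hmg j h).
Proof.
have [Xd _] := usub_gr X; have [Yd _] := usub_gr Y.
move=> [h1 h2]; split=> [y|u uU]; rewrite sum_lfunE.
  by apply: memv_suml => d _; rewrite !comp_lfunE; apply: Xd.
by rewrite big1 // => d _; rewrite !comp_lfunE h2 ?linear0 //; apply: Yd.
Qed.

(** The composite maps into [U'] and kills [U'], hence is nilpotent. *)
Lemma ltr_perp X Y (phi : 'Hom(sM X, sM Y)) (h : 'Hom(sM Y, sM X)) :
  filt phi -> perp h -> ltr (phi \o h)%VF = 0.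
Proof.
move=> pF [h1 h2]; pose e := projv (usub Y).
have -> : (phi \o h)%VF = (e \o (phi \o h))%VF.
  by apply/lfunP=> y; rewrite [RHS]comp_lfunE projv_id // comp_lfunE; apply: pF.
rewrite ltrC; have -> : (phi \o h \o e)%VF = 0; last by rewrite linear0.
by apply/lfunP=> y; rewrite !comp_lfunE h2 ?linear0 ?zero_lfunE // memv_proj.
Qed.

Lemma perp_of_ltr X Y (h : 'Hom(sM Y, sM X)) :
  (forall phi : 'Hom(sM X, sM Y), filt phi -> ltr (phi \o h)%VF = 0) -> perp h.
Proof.
move=> h0; split=> [y|u uU]; apply: contrapT.
  move=> /negP/sep_functional[xi [xl x0 xv]]; case/negP: xv.
  rewrite -(ltr_rk1 xl) h0 // => v vU.
  by rewrite rk1E // x0 // scale0r mem0v.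
move=> /eqP hu; have := @sep_functional _ _ 0%VS (h u).
rewrite memv0 => /(_ hu)[xi [xl _ xv]]; case/negP: xv.
by rewrite -(ltr_rk1 xl) h0 // => v vU; rewrite rk1E // memvZ.
Qed.

Lemma filt_of_ltr X Y (f : 'Hom(sM X, sM Y)) :
  (forall h : 'Hom(sM Y, sM X), perp h -> ltr (f \o h)%VF = 0) -> filt f.
Proof.
move=> h0 u uU; apply: contrapT => /negP/sep_functional[xi [xl x0 xv]].
case/negP: xv; rewrite -(ltr_rk1 xl) ltrC h0 //; split=> [y|v vU].
  by rewrite rk1E // memvZ.
by rewrite rk1E // x0 // scale0r.
Qed.

Lemma ltr_nondeg (V W : vectType k) (f : 'Hom(V, W)) :
  (forall h : 'Hom(W, V), ltr (f \o h)%VF = 0) -> f = 0.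
Proof.
move=> h0; apply/lfunP=> u; rewrite zero_lfunE; apply: contrapT => /eqP fu.
have := @sep_functional _ _ 0%VS (f u); rewrite memv0 => /(_ fu)[xi [xl _ xv]].
by case/negP: xv; rewrite -(ltr_rk1 xl) ltrC h0.
Qed.

Lemma ltr_hmg2 (V W : grmod k p) j (phi : 'Hom(V, W)) (f : 'Hom(W, V)) :
  ltr (hmg j phi \o f)%VF = ltr (phi \o hmg (- j) f)%VF.
Proof.
rewrite ltrC -(ltr_hmg (j := - j)); last by rewrite opprK; apply: hmg_degr.
by rewrite ltrC ltr_hmg //; apply: hmg_degr.
Qed.

End Perp.

(** * The Serre functor and its pairing *)

Section Serre.
Variables (k : fieldType) (m : nat).
Local Notation n := m.+1.
Local Notation smono := (smono k n.+1).
Local Notation E := (smono_conflcat k n.+1).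
Implicit Types (s t : int) (X Y Z : smono).

Section SerreObj.
Variable X : smono.
Local Notation piM := (ext n (\1%VF : 'End(sM X))).

Fact serre_preim_gr : grsub (piM @^-1: usub X)%VS.
Proof.
have [Ud Ux] := usub_gr X; split=> [d v|v]; rewrite -!memv_preim => vU.
  by rewrite (degr_pr _ _ (@pi_degr _ _ X n)) Ud.
by rewrite ext_x Ux.
Qed.

Fact serre_sub : {subset lker piM <= (piM @^-1: usub X)%VS}.
Proof. by move=> v; rewrite memv_ker -memv_preim => /eqP->; apply: mem0v. Qed.

(** On graded modules the Serre functor is the syzygy [ker pi], shifted by
    [p - 1].  The pair [ker pi -> pi^-1 U] is what the annihilator of filtered
    maps asks for, see [hat_perp]. *)
Definition serresm : smono := sub_smono (ker_gr X n) serre_preim_gr serre_sub.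
End SerreObj.

Section SerreMor.
Variables (X Y : smono) (f : smor X Y).

Fact serre_mor_ker phi : phi \in lker (ext n (\1%VF : 'End(sM X))) ->
  freemap n (topmap f) phi \in lker (ext n (\1%VF : 'End(sM Y))).
Proof.
rewrite !memv_ker => /eqP p0; rewrite ext_freemap ?p0 ?linear0 //.
exact: topmap_grhom.
Qed.

Fact serre_mor_pre phi :
  phi \in (ext n (\1%VF : 'End(sM X)) @^-1: usub X)%VS ->
  freemap n (topmap f) phi \in (ext n (\1%VF : 'End(sM Y)) @^-1: usub Y)%VS.
Proof.
rewrite -!memv_preim ext_freemap; last exact: topmap_grhom.
exact: topmap_filt.
Qed.

Definition serre_mor : smor (serresm X) (serresm Y) :=
  sub_map (ker_gr X n) (serre_preim_gr X) (@serre_sub X)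
    (ker_gr Y n) (serre_preim_gr Y) (@serre_sub Y)
    (freemap_mor_grhom n f) serre_mor_ker serre_mor_pre.

Lemma serre_morE w : vsval (topmap serre_mor w) = freemap n (topmap f) (vsval w).
Proof. exact: vsval_sub_map. Qed.
End SerreMor.

Program Definition serreF : functor E E :=
  @Functor k E E serresm (fun X Y f => serre_mor f) _ _ _.
Next Obligation.
move=> X Y a f g; apply: topmap_inj; apply/lfunP=> u; apply: subvs_inj.
rewrite topmap_lin add_lfunE scale_lfunE linearP /= !serre_morE; apply/ffunP=> i.
by rewrite !ffunE !freemapE topmap_lin add_lfunE scale_lfunE.
Qed.
Next Obligation.
move=> X; apply: topmap_inj; apply/lfunP=> u; apply: subvs_inj; rewrite serre_morE.
by apply/ffunP=> i; rewrite freemapE !id_lfunE.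
Qed.
Next Obligation.
move=> X Y Z g f; apply: topmap_inj; apply/lfunP=> u; apply: subvs_inj.
rewrite topmap_comp comp_lfunE !serre_morE; apply/ffunP=> i.
by rewrite !freemapE comp_lfunE.
Qed.

Definition vinc X : 'Hom(sM (serresm X), freeg n (sM X)) :=
  linfun (vsval : subvs_of _ -> freeg n (sM X)).

Lemma vincE X w : vinc X w = vsval w. Proof. exact: vsval_lf. Qed.

Lemma vinc_grhom X : is_grhom (vinc X).
Proof.
apply/grhomP; split=> [d w|w]; first by rewrite subg_gr vincE addr0.
by rewrite !vincE subg_x.
Qed.

(** The last component of a map into [S X].  As [vsval \o g = coext (hat g)],
    the conditions for landing in [ker pi -> pi^-1 U] concern [Nm (hat g)]. *)
Definition hat X Y (g : smor Y (serresm X)) : 'Hom(sM Y, sM X) :=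
  lastc (vinc X \o topmap g)%VF.

Lemma hatE X Y (g : smor Y (serresm X)) y :
  hat g y = (vsval (topmap g y) : {ffun 'I_n.+1 -> sM X}) ord_max.
Proof. by rewrite /hat lastcE comp_lfunE vincE. Qed.

Lemma hat_coext X Y (g : smor Y (serresm X)) y : vsval (topmap g y) = coext n (hat g) y.
Proof.
rewrite /hat coext_lastc; first by rewrite comp_lfunE vincE.
by apply: is_grhom_comp; [apply: vinc_grhom | apply: topmap_grhom].
Qed.

Lemma hat_inj X Y (g g' : smor Y (serresm X)) : hat g = hat g' -> g = g'.
Proof.
move=> gg; apply: topmap_inj; apply/lfunP=> y; apply: subvs_inj.
by rewrite !hat_coext gg.
Qed.

Lemma hat_lin X Y a (g g' : smor Y (serresm X)) : hat (a *: g + g') = a *: hat g + hat g'.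
Proof.
apply/lfunP=> y; rewrite add_lfunE scale_lfunE !hatE topmap_lin add_lfunE scale_lfunE.
by rewrite linearP /= !ffunE.
Qed.

Lemma hat_degr X Y (g : smor Y (serresm X)) : degr 0 (hat g).
Proof.
rewrite -[X in degr X _](subrr n%:Z); apply: lastc_degr.
by apply: is_grhom_comp; [apply: vinc_grhom | apply: topmap_grhom].
Qed.

Lemma ext_coext1 (V W : grmod k n.+1) s (z : 'Hom(V, W)) v :
  ext s \1%VF (coext s z v) = Nm z v.
Proof. by rewrite extE NmE; apply: eq_bigr => i _; rewrite id_lfunE coextE. Qed.

Lemma hat_perp X Y (g : smor Y (serresm X)) : perp (Nm (hat g)).
Proof.
split=> [y|u uU]; rewrite -(ext_coext1 n) -hat_coext.
  by rewrite memv_preim; apply: sub_mem.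
by have := topmap_filt g uU; rewrite sub_usub memv_ker => /eqP.
Qed.

Section Unhat.
Variables (X Y : smono) (z : 'Hom(sM Y, sM X)) (zd : degr 0 z) (zp : perp (Nm z)).

Fact unhat_grhom : is_grhom (coext n z).
Proof. by apply: coext_grhom; rewrite subrr. Qed.
Fact unhat_pre y : coext n z y \in (ext n (\1%VF : 'End(sM X)) @^-1: usub X)%VS.
Proof. by rewrite -memv_preim ext_coext1; apply: (proj1 zp). Qed.
Fact unhat_ker u : u \in usub Y -> coext n z u \in lker (ext n (\1%VF : 'End(sM X))).
Proof. by move=> uU; rewrite memv_ker ext_coext1 (proj2 zp). Qed.

Definition unhat : smor Y (serresm X) :=
  into_sub (ker_gr X n) (serre_preim_gr X) (@serre_sub X) unhat_grhom unhat_pre unhat_ker.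

Lemma unhatK : hat unhat = z.
Proof. by apply/lfunP=> y; rewrite hatE into_subE coextE subnn xp0. Qed.
End Unhat.

Lemma hat_compr X Y Y' (g : hom (Y : E) (serresm X : E)) (h : hom (Y' : E) Y) :
  hat (comp g h : smor Y' (serresm X)) = (hat (g : smor _ _) \o topmap (h : smor Y' Y))%VF.
Proof.
by apply/lfunP=> y; rewrite [RHS]comp_lfunE !hatE topmap_comp comp_lfunE.
Qed.

Lemma hat_compl X X' Y (e : smor X' X) (g : smor Y (serresm X')) :
  hat (comp (serre_mor e : hom (serresm X' : E) (serresm X)) (g : hom (Y : E) _) : smor _ _)
  = (topmap e \o hat g)%VF.
Proof.
apply/lfunP=> y; rewrite [RHS]comp_lfunE !hatE topmap_comp comp_lfunE serre_morE.
by rewrite freemapE.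
Qed.

(** Stably zero maps into [S X] are norms of maps into a free module, so this
    describes their last components. *)
Lemma last_Nm (V W : grmod k n.+1) s (phi : 'Hom(W, freeg s V)) y :
  (Nm phi y : {ffun 'I_n.+1 -> V}) ord_max =
  \sum_(j < n.+1) (phi (xp W j y) : {ffun 'I_n.+1 -> V}) j.
Proof.
rewrite NmE sum_ffunE (reindex_inj rev_ord_inj); apply: eq_bigr => j _ /=.
have jn := ltn_ord j; rewrite free_xp subSS leq_subr subKn -1?ltnS //.
by congr ((phi _ : {ffun _ -> _}) _); apply: val_inj; rewrite /= inordK.
Qed.

Lemma hat_Nm X Y (g : smor Y (serresm X)) (phi : 'Hom(sM Y, sM (serresm X))) y :
  topmap g = Nm phi ->
  hat g y = \sum_(j < n.+1) (vsval (phi (xp (sM Y) j y)) : {ffun 'I_n.+1 -> sM X}) j.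
Proof.
move=> gE; rewrite hatE gE -vincE -comp_lfunE Nm_compl; last exact: vinc_grhom.
by rewrite last_Nm; apply: eq_bigr => j _; rewrite comp_lfunE vincE.
Qed.

Definition comm_x (V W : grmod k n.+1) (psi : 'Hom(V, W)) : 'Hom(V, W) :=
  ((grx W \o psi) - (psi \o grx V))%VF.

Lemma comm_xE (V W : grmod k n.+1) (psi : 'Hom(V, W)) v :
  comm_x psi v = grx W (psi v) - psi (grx V v).
Proof. by rewrite /comm_x add_lfunE opp_lfunE !comp_lfunE. Qed.

Lemma comm_degr (V W : grmod k n.+1) (psi : 'Hom(V, W)) :
  degr (-1) psi -> degr 0 (comm_x psi).
Proof.
move=> pd d v vd; rewrite comm_xE memvB //.
  by have := @grx_degr _ _ W _ _ (pd _ _ vd); rewrite -addrA.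
by have := pd _ _ (@grx_degr _ _ V _ _ vd); rewrite -addrA.
Qed.

(** Write [hat g = h + x psi - psi x].  Then [g] is the norm of
    [y |-> (h y + x psi y) (x) 1 - psi y (x) x], which lies over [h y], hence
    in [pi^-1 U], and in [ker pi] for [y] in [U].  The component at [x] exists
    because [p > 1]. *)
Lemma stably_zero_hat X Y (g : hom (Y : E) (serresm X : E)) h psi :
  degr 0 h -> perp h -> degr (-1) psi ->
  hat (g : smor Y (serresm X)) = h + comm_x psi -> stably_zero g.
Proof.
move=> hd [h1 h2] pd gE.
pose c y : freeg n (sM X) := [ffun i : 'I_n.+1 => if i == ord0 then h y + grx _ (psi y)
  else if i == inord 1 then - psi y else 0].
have i10 : inord 1 != ord0 :> 'I_n.+1 by rewrite -val_eqE /= inordK.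
have cl : linear c.
  move=> a u v; apply/ffunP=> i; rewrite !ffunE !linearP.
  case: ifP => _; first by rewrite scalerDr addrACA.
  by case: ifP => _; rewrite ?scaler0 ?addr0 // opprD scalerN.
have cE y : linfun c y = c y by exact: (linfunE cl).
have c0 y : ext n \1%VF (c y) = h y.
  rewrite extE (bigD1 ord0) //= (bigD1 (inord 1)) //= big1 => [|i /andP[i0 i1]].
    rewrite !id_lfunE !ffunE eqxx (negPf i10) eqxx inordK // addr0.
    by rewrite xpS xp0 linearN /= addrK.
  by rewrite id_lfunE ffunE (negPf i0) (negPf i1) linear0.
have cB y : c y \in (ext n (\1%VF : 'End(sM X)) @^-1: usub X)%VS.
  by rewrite -memv_preim c0.
pose phi : 'Hom(sM Y, sM (serresm X)) := (linfun (vsproj _) \o linfun c)%VF.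
have phiE y : vsval (phi y) = c y by rewrite comp_lfunE cE vsproj_lf vsprojK.
have pF : @filt _ _ Y (serresm X) phi.
  by move=> u uU; rewrite sub_usub phiE memv_ker c0 h2.
have phid : degr (- n%:Z) phi.
  move=> d y yd; rewrite subg_gr phiE; apply/pgrP=> i; rewrite ffunE subrK.
  case: eqP => [->|_].
    rewrite subr0 memvD //; first by have := hd _ _ yd; rewrite addr0.
    by have := @grx_degr _ _ (sM X) _ _ (pd _ _ yd); rewrite -addrA addr0.
  case: eqP => [->|_]; last exact: mem0v.
  by rewrite inordK // memvN pd.
apply/stably_zeroP; exists phi; split=> //.
have Nh : is_grhom (Nm phi).
  apply/grhomP; split; last exact: Nm_x.
  by apply: Nm_degr phid; rewrite addNr.
have -> : Nm phi = topmap (mk_mor Nh (Nm_filt pF)) by [].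
congr (topmap _); apply: hat_inj; apply/lfunP=> y.
rewrite gE (hat_Nm _ (topmap_mk _ _)) (bigD1 ord0) //= (bigD1 (inord 1)) //= big1.
  rewrite !phiE !ffunE eqxx (negPf i10) eqxx inordK // xp0 xpS xp0 addr0.
  by rewrite add_lfunE comm_xE addrA.
by move=> i /andP[i0 i1]; rewrite phiE ffunE (negPf i0) (negPf i1).
Qed.

Definition pairing X Y (f : smor X Y) (g : smor Y (serresm X)) : k :=
  ltr (topmap f \o hat g)%VF.

Lemma pairing0l (X Y : E) (f : hom X Y) (g : hom Y (serresm X : E)) :
  stably_zero f -> pairing (f : smor X Y) (g : smor Y _) = 0.
Proof.
move=> /stably_zeroP[phi [_ pF fE]]; rewrite /pairing fE ltr_Nm.
by apply: ltr_perp pF _; apply: hat_perp.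
Qed.

(** If [g = N phi], then moving each power of [x] around the trace turns
    [hat g] into [pi phi], which is orthogonal to filtered maps. *)
Lemma pairing0r (X Y : E) (f : hom X Y) (g : hom Y (serresm X : E)) :
  stably_zero g -> pairing (f : smor X Y) (g : smor Y _) = 0.
Proof.
move=> /stably_zeroP[phi [_ pF gE]]; rewrite /pairing.
pose ev j : 'Hom(sM Y, sM X) := (linfun (@pev k n (sM X) j) \o vinc X \o phi)%VF.
have evE j y : ev j y = (vsval (phi y) : {ffun _ -> _}) j.
  by rewrite !comp_lfunE (linfunE (@pev_lin k n (sM X) j)) vincE.
have -> : (topmap (f : smor X Y) \o hat (g : smor Y (serresm X)))%VF
    = \sum_(j < n.+1) (topmap (f : smor X Y) \o ev j \o xp (sM Y) j)%VF.
  apply/lfunP=> y; rewrite comp_lfunE (hat_Nm _ gE) linear_sum sum_lfunE.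
  by apply: eq_bigr => j _; rewrite !comp_lfunE -evE !comp_lfunE.
have E1 : ltr (topmap (f : smor X Y) \o (ext n \1 \o (vinc X \o phi)))%VF = 0.
  apply: ltr_perp (topmap_filt f) _; split=> [y|u uU]; rewrite !comp_lfunE vincE.
    by rewrite memv_preim; apply: sub_mem.
  by have := pF _ uU; rewrite sub_usub memv_ker => /eqP.
rewrite -[RHS]E1 linear_sum /=.
have -> : (topmap (f : smor X Y) \o (ext n \1 \o (vinc X \o phi)))%VF
    = \sum_(j < n.+1) (xp (sM Y) j \o (topmap (f : smor X Y) \o ev j))%VF.
  apply/lfunP=> y; rewrite comp_lfunE [X in topmap _ X]comp_lfunE extE linear_sum sum_lfunE.
  apply: eq_bigr => j _; rewrite !comp_lfunE /= (grhom_xp _ _ (topmap_grhom f)).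
  by rewrite id_lfunE (linfunE (@pev_lin k n (sM X) j)).
by rewrite linear_sum; apply: eq_bigr => j _; rewrite /= ltrC.
Qed.

(** Otherwise a functional separates [f] from the norms of filtered maps; it is
    the trace against some [z], and being orthogonal to norms makes the degree
    [0] part of [z] the last component of a morphism [Y -> S X]. *)
Lemma pairing_nondegl (X Y : E) (f : hom X Y) :
  (forall g : hom Y (serresm X : E), pairing (f : smor X Y) (g : smor Y _) = 0) ->
  stably_zero f.
Proof.
move=> f0; apply: contrapT => fn.
pose P (a : 'Hom(sM X, sM Y)) :=
  exists phi : 'Hom(sM X, sM Y), [/\ degr (- n%:Z) phi, filt phi & a = Nm phi].
have [] := @sep_pred _ _ P (topmap (f : smor X Y)).
- exists 0; split; last by rewrite linear0.
    by move=> d v _; rewrite zero_lfunE mem0v.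
  by move=> u _; rewrite zero_lfunE mem0v.
- move=> a _ _ [u [ud uF ->]] [v [vd vF ->]]; exists (a *: u + v).
  by split; [apply: degr_lin | apply: filt_lin | rewrite linearP].
- by move=> /stably_zeroP.
move=> xi [xl x0 /negP[]]; have [z zE] := ltr_repr xl.
have fd : degr (- 0) (topmap (f : smor X Y)) by rewrite oppr0; have /grhomP[] := topmap_grhom f.
have zp : perp (Nm (hmg 0 z)).
  apply: perp_of_ltr => phi pF; have Nd : degr (- - n%:Z) (Nm (hmg 0 z)).
    by rewrite opprK; apply: Nm_degr (hmg_degr _ _); rewrite add0r.
  rewrite -(ltr_hmg _ Nd) -ltr_Nm ltrC ltr_hmg; last first.
    by apply: Nm_degr (hmg_degr _ _); rewrite addNr oppr0.
  rewrite -zE; apply: x0; exists (hmg (- n%:Z) phi); split=> //; first exact: hmg_degr.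
  exact: filt_hmg.
rewrite zE -(ltr_hmg z fd) ltrC.
by have := f0 (unhat (hmg_degr _ _) zp); rewrite /pairing unhatK => ->.
Qed.

(** Orthogonality to [perp] makes a map filtered, orthogonality to commutators
    with [x] makes it commute with [x]. *)
Section MorOfLtr.
Variables (X Y : smono) (f : 'Hom(sM X, sM Y)).
Hypothesis f_perp : forall h : 'Hom(sM Y, sM X), degr 0 h -> perp h -> ltr (f \o h)%VF = 0.
Hypothesis f_comm : forall psi : 'Hom(sM Y, sM X), degr (-1) psi -> ltr (f \o comm_x psi)%VF = 0.

Fact mor_of_ltr_filt : filt (hmg 0 f).
Proof.
apply: filt_of_ltr => h hp; rewrite ltr_hmg2 oppr0.
by apply: f_perp; [apply: hmg_degr | apply: perp_hmg].
Qed.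

Fact mor_of_ltr_grhom : is_grhom (hmg 0 f).
Proof.
apply/grhomP; split=> [|v]; first exact: hmg_degr.
pose g := comm_x (hmg 0 f); suff g0 : g = 0.
  by apply/eqP; rewrite eq_sym -subr_eq0 -comm_xE -/g g0 zero_lfunE.
have gd : degr 1 g.
  move=> d u ud; rewrite comm_xE memvB //.
    by have := @grx_degr _ _ (sM Y) _ _ (hmg_degr 0 f ud); rewrite addr0.
  by have := hmg_degr 0 f (@grx_degr _ _ (sM X) _ _ ud); rewrite addr0.
apply: ltr_nondeg => psi; rewrite -(hmg_id gd) ltr_hmg2 /g.
set psi' := hmg _ psi; have pd : degr (-1) psi' by exact: hmg_degr.
have -> : (comm_x (hmg 0 f) \o psi')%VF =
    ((grx (sM Y) \o (hmg 0 f \o psi')) - (hmg 0 f \o (grx (sM X) \o psi')))%VF.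
  by apply/lfunP=> y; rewrite comp_lfunE comm_xE add_lfunE opp_lfunE !comp_lfunE.
rewrite linearB /= ltrC -linearB /=.
have -> : ((hmg 0 f \o psi' \o grx (sM Y)) - (hmg 0 f \o (grx (sM X) \o psi')))%VF =
   - (hmg 0 f \o comm_x psi')%VF.
  apply/lfunP=> y; rewrite add_lfunE !opp_lfunE !comp_lfunE comm_xE linearB /=.
  by rewrite opprB.
by rewrite linearN /= ltr_hmg ?f_comm ?oppr0 //; apply: comm_degr.
Qed.

Definition mor_of_ltr : smor X Y := mk_mor mor_of_ltr_grhom mor_of_ltr_filt.

Lemma mor_of_ltrE (g : smor Y (serresm X)) : pairing mor_of_ltr g = ltr (f \o hat g)%VF.
Proof. by rewrite /pairing topmap_mk ltr_hmg // oppr0; apply: hat_degr. Qed.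
End MorOfLtr.

(** A functional separating [hat g] from the last components of stably zero maps
    would be the trace against a morphism, by [mor_of_ltr]. *)
Lemma pairing_nondegr (X Y : E) (g : hom Y (serresm X : E)) :
  (forall f : hom X Y, pairing (f : smor X Y) (g : smor Y _) = 0) -> stably_zero g.
Proof.
move=> g0; pose P (a : 'Hom(sM Y, sM X)) := exists h psi,
  [/\ degr 0 h, perp h, degr (-1) psi & a = h + comm_x psi].
suff [h [psi [hd hp pd gE]]] : P (hat (g : smor Y (serresm X))).
  exact: stably_zero_hat hd hp pd gE.
have comm_lin a (u v : 'Hom(sM Y, sM X)) : comm_x (a *: u + v) = a *: comm_x u + comm_x v.
  apply/lfunP=> y; rewrite comm_xE !add_lfunE !scale_lfunE !comm_xE linearP /=.
  by rewrite scalerBr opprD addrACA opp_lfunE !comp_lfunE.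
have comm0 : comm_x (0 : 'Hom(sM Y, sM X)) = 0.
  by apply/lfunP=> y; rewrite comm_xE !zero_lfunE linear0 subr0.
have d0 j : degr j (0 : 'Hom(sM Y, sM X)) by move=> d v _; rewrite zero_lfunE mem0v.
apply: contrapT => gn; have [] := sep_pred (P := P) _ _ gn.
- by exists 0, 0; split=> //; [exact: perp0 | rewrite comm0 addr0].
- move=> a _ _ [h [psi [hd hp pd ->]]] [h' [psi' [hd' hp' pd' ->]]].
  exists (a *: h + h'), (a *: psi + psi'); split; rewrite ?comm_lin.
  + exact: degr_lin.
  + exact: perp_lin.
  + exact: degr_lin.
  by rewrite scalerDr addrACA.
move=> xi [xl x0 /negP[]]; have [f fE] := ltr_repr xl.
have fp (h : 'Hom(sM Y, sM X)) : degr 0 h -> perp h -> ltr (f \o h)%VF = 0.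
  by move=> hd hp; rewrite -fE x0 //; exists h, 0; rewrite comm0 addr0.
have fc (psi : 'Hom(sM Y, sM X)) : degr (-1) psi -> ltr (f \o comm_x psi)%VF = 0.
  move=> pd; rewrite -fE x0 //; exists 0, psi; rewrite add0r.
  by split=> //; exact: perp0.
by rewrite fE -(mor_of_ltrE fp fc) g0.
Qed.

Lemma Nm_comm (V W : grmod k n.+1) (psi : 'Hom(V, W)) : Nm (comm_x psi) = 0.
Proof.
apply/lfunP=> v; rewrite NmE zero_lfunE.
under eq_bigr do rewrite comm_xE linearB /= -xpSr -xpS.
rewrite sumrB big_ord_recr /= [X in _ - X]big_ord_recl /=.
rewrite [xp W n.+1 _]xp_nil // addr0 [xp V n.+1 v]xp_nil // !linear0 add0r.
apply/eqP; rewrite subr_eq0; apply/eqP; apply: eq_bigr => i _ /=.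
have -> : (n - i)%N = (n - bump 0 i).+1; last by [].
by rewrite /bump; have := ltn_ord i; lia.
Qed.

(** A functional on the stable maps [Y -> S X] is one on their last components.
    Extend it to all linear maps by a projection; it is then the trace against
    some [f], and vanishing on stably zero maps makes [f] a morphism in degree
    [0]. *)
Lemma pairing_surj (X Y : E) (Phi : hom Y (serresm X : E) -> k) :
  scalar Phi -> (forall g, stably_zero g -> Phi g = 0) ->
  exists f : hom X Y, forall g, Phi g = pairing (f : smor X Y) (g : smor Y _).
Proof.
move=> Pl P0.
pose P (z : 'Hom(sM Y, sM X)) := degr 0 z /\ perp (Nm z).
have [] := @vspace_of_pred _ _ P.
- split; first by move=> d v _; rewrite zero_lfunE mem0v.
  by rewrite linear0; apply: perp0.
- move=> a u v [ud up] [vd vp]; split; first exact: degr_lin.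
  by rewrite linearP; apply: perp_lin.
move=> Z ZP.
(* Inverse of [hat], by cases so that it is defined on all linear maps. *)
pose uh (z : 'Hom(sM Y, sM X)) : smor Y (serresm X) :=
  if pselect (P z) is left h then unhat (proj1 h) (proj2 h) else 0.
have uhK z : P z -> hat (uh z) = z.
  by move=> Pz; rewrite /uh; case: pselect => // h; apply: unhatK.
pose l z : k := Phi (uh (projv Z z)).
have PZ z : P (projv Z z) by apply/ZP; apply: memv_proj.
have ll : scalar l.
  move=> a u v; rewrite /l -Pl; congr Phi; apply: hat_inj.
  by rewrite hat_lin !uhK // linearP.
have [f fE] := ltr_repr ll.
have lP z (Pz : P z) : l z = Phi (unhat (proj1 Pz) (proj2 Pz)).
  rewrite /l; congr Phi; apply: hat_inj; rewrite uhK // unhatK projv_id //.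
  exact/ZP.
have d0 : degr (-1) (0 : 'Hom(sM Y, sM X)) by move=> d v _; rewrite zero_lfunE mem0v.
have fp (h : 'Hom(sM Y, sM X)) : degr 0 h -> perp h -> ltr (f \o h)%VF = 0.
  move=> hd hp; have Pz : P h.
    split=> //; case: hp => h1 h2; split=> [y|u uU]; rewrite NmE.
      by apply: memv_suml => i _; apply: filt_xp.
    by rewrite big1 // => i _; rewrite h2 ?linear0 //; apply: filt_xp.
  rewrite -fE (lP _ Pz); apply: P0.
  apply: (stably_zero_hat hd hp d0); rewrite unhatK.
  by apply/lfunP=> y; rewrite add_lfunE comm_xE !zero_lfunE linear0 subr0 addr0.
have fc (psi : 'Hom(sM Y, sM X)) : degr (-1) psi -> ltr (f \o comm_x psi)%VF = 0.
  move=> pd; have Pz : P (comm_x psi).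
    by split; [exact: comm_degr | rewrite Nm_comm; apply: perp0].
  rewrite -fE (lP _ Pz); apply: P0.
  apply: (stably_zero_hat (h := 0) (psi := psi)) => //; last by rewrite unhatK add0r.
    by move=> d v _; rewrite zero_lfunE mem0v.
  exact: perp0.
exists (mor_of_ltr fp fc) => g; rewrite mor_of_ltrE -fE.
have Pg : P (hat (g : smor Y (serresm X))) by split; [exact: hat_degr | exact: hat_perp].
by rewrite (lP _ Pg); congr Phi; apply: hat_inj; rewrite unhatK.
Qed.

End Serre.

(** * Serre duality *)

Section SerreStable.
Variables (k : fieldType) (m : nat).
Local Notation n := m.+1.
Local Notation smono := (smono k n.+1).
Local Notation E := (smono_conflcat k n.+1).
Local Notation S := (stable_smono k n.+1).
Implicit Types (s t : int) (X Y Z : smono).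

Lemma pairing_linl X Y a (f f' : smor X Y) (g : smor Y (serresm X)) :
  pairing (a *: f + f') g = a * pairing f g + pairing f' g.
Proof.
by rewrite /pairing topmap_lin comp_lfunDl -comp_lfunZl linearP.
Qed.

Lemma pairing_linr X Y a (f : smor X Y) (g g' : smor Y (serresm X)) :
  pairing f (a *: g + g') = a * pairing f g + pairing f g'.
Proof.
by rewrite /pairing hat_lin comp_lfunDr -comp_lfunZr linearP.
Qed.

(** The naturality of the pairing in the form used for fullness and for the
    preservation of stably zero maps: [S e] pairs as [e] does. *)
Lemma pairing_serre X Y (e : smor X Y) (u : smor Y (serresm X)) :
  pairing (X := Y) (Y := serresm X) u (serre_mor e) = pairing e u.
Proof.
rewrite /pairing; have -> : hat (serre_mor e) = (topmap e \o hat (smor_id (serresm X)))%VF.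
  by rewrite -hat_compl; congr hat; apply: esym (compf1 (_ : hom (serresm X : E) (serresm Y))).
rewrite ltrC -comp_lfunA; congr (ltr (_ \o _)%VF).
rewrite -(hat_compr (smor_id (serresm X) : hom (serresm X : E) _) (u : hom (Y : E) _)).
by congr hat; apply: (comp1f (u : hom (Y : E) (serresm X))).
Qed.

Lemma serre_zero (X Y : E) (f : hom X Y) : stably_zero f -> stably_zero (fmap (serreF k m) f).
Proof.
move=> f0; apply: pairing_nondegr => u; rewrite pairing_serre.
exact: pairing0l.
Qed.

Definition Ser : functor S S := stabF serre_zero.

Lemma Ser_scl (X Y : E) (f : hom X Y) :
  fmap Ser (scl f) = scl (serre_mor f : hom (serresm X : E) (serresm Y)).
Proof. exact: stabF_scl. Qed.

(** Nondegeneracy on the right makes the Serre functor full: [g] induces a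
    functional on [Hom (Y, S X)], represented by some [f : X -> Y], and then
    [S f] and [g] cannot be told apart by the pairing. *)
Lemma Ser_full (X Y : S) (g : hom (Ser X) (Ser Y)) : exists f : hom X Y, fmap Ser f = g.
Proof.
have [v ->] := scl_surj g.
pose Phi (u : hom (Y : E) (serresm X : E)) : k :=
  pairing (X := Y) (Y := serresm X) u (v : smor (serresm X) (serresm Y)).
have [|u u0|e eE] := @pairing_surj _ _ X Y Phi.
- by move=> a u u'; apply: pairing_linl.
- exact: pairing0l.
exists (scl e); rewrite Ser_scl; apply/scl_eq; apply: pairing_nondegr => u.
rewrite -[serre_mor e - v]/(serre_mor e - v : smor _ _) -scaleN1r addrC pairing_linr.
by rewrite pairing_serre -eE mulN1r addNr.
Qed.

Definition qpairing (X Y : S) (f : hom X Y) (g : hom Y (Ser X)) : k :=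
  pairing (qrepr f : smor X Y) (qrepr g : smor Y (serresm X)).

Lemma qpairing_scl (X Y : E) (f : hom X Y) (g : hom Y (serresm X : E)) :
  qpairing (scl f) (scl g : hom (Y : S) (Ser X)) = pairing (f : smor X Y) (g : smor Y _).
Proof.
have df : stably_zero (qrepr (scl f) - f) by apply/scl_eq; rewrite /scl qreprK.
have dg : stably_zero (qrepr (scl g) - g) by apply/scl_eq; rewrite /scl qreprK.
have := pairing0l (qrepr (scl g)) df; have := pairing0r f dg.
rewrite -[_ - g]addrC -[_ - f]addrC -!scaleN1r pairing_linr pairing_linl !mulN1r.
by move=> /eqP; rewrite addrC subr_eq0 => /eqP <- /eqP; rewrite addrC subr_eq0 => /eqP.
Qed.

Lemma Ser_is_serre (A : autoequiv S) : aeF A = Ser -> is_serre A.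
Proof.
case: A => F G FG GF /= FE; subst F.
have lin (X Y : S) (f : hom X Y) : scalar (@qpairing X Y f).
  move=> a g g'; have [f' ->] := scl_surj f; have [u ->] := scl_surj g.
  have [u' ->] := scl_surj g'.
  rewrite -(scl_lin a u u') !qpairing_scl.
  exact: pairing_linr.
pose eta (X Y : S) (f : hom X Y) : {scalar (hom Y (Ser X))} :=
  HB.pack (@qpairing X Y f) (GRing.isLinear.Build k _ k _ _ (lin X Y f)).
have etaE X Y f g : eta X Y f g = qpairing f g by [].
exists eta; split.
- move=> X Y a f f' g; rewrite !etaE.
  have [u ->] := scl_surj f; have [u' ->] := scl_surj f'; have [w ->] := scl_surj g.
  by rewrite -(scl_lin a u u') !qpairing_scl; apply: pairing_linl.
- move=> X Y phi; have [|u u0|f fE] := @pairing_surj _ _ X Y (fun g => phi (scl g)).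
  + by move=> a u u'; rewrite scl_lin linearP.
  + by rewrite (scl_zero u0) linear0.
  exists (scl f); split.
    by move=> g; rewrite etaE; have [u ->] := scl_surj g; rewrite qpairing_scl -fE.
  move=> f' f'E; have [h hE] := scl_surj f'; rewrite hE in f'E *; apply/scl_eq.
  apply: pairing_nondegl => u.
  have := f'E (scl u); rewrite etaE qpairing_scl fE => e.
  by rewrite -scaleN1r addrC pairing_linl e mulN1r addNr.
- move=> X Y Y' h f g; rewrite !etaE; have [h' ->] := scl_surj h; have [f' ->] := scl_surj f.
  have [g' ->] := scl_surj g.
  rewrite -(scl_comp h' f') -(scl_comp (g' : hom (Y' : E) (serresm X : E)) h').
  rewrite !qpairing_scl /pairing topmap_comp hat_compr -comp_lfunA ltrC.
  by rewrite comp_lfunA.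
move=> X X' Y e f g; rewrite !etaE; have [e' ->] := scl_surj e; have [f' ->] := scl_surj f.
have [g' ->] := scl_surj g.
rewrite -(scl_comp f' e') Ser_scl.
rewrite -(scl_comp (serre_mor e' : hom (serresm X' : E) (serresm X)) g').
by rewrite !qpairing_scl /pairing topmap_comp hat_compl comp_lfunA.
Qed.

End SerreStable.

(** * The map from the cube of the Serre functor to a shift *)

Section SerreCube.
Variables (k : fieldType) (m : nat).
Local Notation n := m.+1.
Local Notation smono := (smono k n.+1).
Local Notation E := (smono_conflcat k n.+1).
Local Notation S := (stable_smono k n.+1).
Implicit Types (s t : int) (X Y Z : smono).

(** An element [w] of [S X] is [sum_i scoord i w (x) x^i]. *)
Definition scoord X (i : 'I_n.+1) : 'Hom(sM (serresm X), sM X) :=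
  (linfun (@pev k n (sM X) i) \o vinc X)%VF.

Lemma scoordE X i w : scoord X i w = (vsval w : {ffun 'I_n.+1 -> sM X}) i.
Proof. by rewrite comp_lfunE vincE (linfunE (@pev_lin k n (sM X) i)). Qed.

Lemma scoord_inj X (u v : sM (serresm X)) : (forall i, scoord X i u = scoord X i v) -> u = v.
Proof. by move=> uv; apply: subvs_inj; apply/ffunP=> i; rewrite -!scoordE. Qed.

Lemma scoord_xp X i j w : scoord X i (xp (sM (serresm X)) j w) =
  if (j <= i)%N then scoord X (inord (i - j)) w else 0.
Proof. by rewrite !scoordE subg_xp free_xp. Qed.

(** The multiplication [m (x) x^i |-> x^i m].  It is not homogeneous of degree
    [0], but commutes with [x]. *)
Definition piS X : 'Hom(sM (serresm X), sM X) := (ext n \1 \o vinc X)%VF.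

Lemma piSE X w : piS X w = \sum_(i < n.+1) xp (sM X) i (scoord X i w).
Proof.
by rewrite comp_lfunE extE; apply: eq_bigr => i _; rewrite id_lfunE scoordE vincE.
Qed.

Lemma piS_x X w : piS X (grx _ w) = grx _ (piS X w).
Proof. by rewrite comp_lfunE [X in _ = grx _ X]comp_lfunE !vincE subg_x ext_x. Qed.

Lemma piS_xp X i w : piS X (xp _ i w) = xp _ i (piS X w).
Proof. by elim: i => [|i IHi]; rewrite ?xp0 // !xpS piS_x IHi. Qed.

Lemma piS_mem X w : piS X w \in usub X.
Proof. by rewrite comp_lfunE vincE memv_preim; apply: sub_mem. Qed.

Lemma serre_usub X w : (w \in usub (serresm X)) = (piS X w == 0).
Proof. by rewrite sub_usub memv_ker comp_lfunE vincE. Qed.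

Lemma scoord_gr Y d i w : w \in gr (sM (serresm Y)) d -> scoord Y i w \in gr (sM Y) (d + n%:Z - i%:Z).
Proof. by rewrite subg_gr scoordE => /pgrP/(_ i). Qed.

(* From here on, elements of iterated Serre functors are accessed only through
   [scoord] and [piS]. *)
#[local] Opaque serresm.

Lemma scoord_piS X i w : scoord X i (piS (serresm X) w) =
  \sum_(c < n.+1) \sum_(b < n.+1 | (b + c == i)%N) scoord X b (scoord (serresm X) c w).
Proof.
rewrite piSE linear_sum; apply: eq_bigr => c _; rewrite /= scoord_xp.
case: leqP => ci; last by rewrite big1 // => b /eqP; lia.
rewrite (big_pred1 (inord (i - c))) // => b /=.
by rewrite -val_eqE /= inordK; have := ltn_ord i; lia.
Qed.

(** Regroups a double sum along [b + c = i]; as [i] ranges below [p], the part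
    with [b + c < p] is what remains. *)
Lemma sum_antidiag (V W : zmodType) (G : nat -> {additive V -> W})
    (F : 'I_n.+1 -> 'I_n.+1 -> V) :
  \sum_(i < n.+1) G i (\sum_(c < n.+1) \sum_(b < n.+1 | (b + c == i)%N) F c b) =
  \sum_(c < n.+1) \sum_(b < n.+1 | (b + c < n.+1)%N) G (b + c)%N (F c b).
Proof.
under eq_bigr do rewrite raddf_sum.
rewrite exchange_big; apply: eq_bigr => c _ /=.
under eq_bigr do rewrite raddf_sum.
rewrite (exchange_big_dep (fun b : 'I_n.+1 => (b + c < n.+1)%N)) /=; last first.
  by move=> i b _ /eqP->.
by apply: eq_bigr => b bc; rewrite (big_pred1 (Ordinal bc)) // => i.
Qed.

Section Retraction.
Variable X : smono.
Local Notation M := (sM X).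
Local Notation X1 := (serresm X).
Local Notation X2 := (serresm X1).
Local Notation X3 := (serresm X2).

Definition coord3 (a b c : 'I_n.+1) : 'Hom(sM X3, M) :=
  (scoord X a \o (scoord X1 b \o scoord X2 c))%VF.

Lemma coord3E a b c z : coord3 a b c z = scoord X a (scoord X1 b (scoord X2 c z)).
Proof. by rewrite !comp_lfunE. Qed.

Definition xminus (e : nat) : 'End(M) := if (n.+1 <= e)%N then xp M (e - n.+1) else 0.

Lemma xminus_small e v : (e < n.+1)%N -> xminus e v = 0.
Proof. by rewrite /xminus ltnNge => /negPf->; rewrite zero_lfunE. Qed.

Lemma xminusD e v : xminus (e + n.+1) v = xp M e v.
Proof. by rewrite /xminus leq_addl addnK. Qed.

Lemma xminusS e v : xminus e.+1 v = grx M (xminus e v) + (if e == n then v else 0).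
Proof.
case: (ltngtP e n) => en.
- by rewrite !xminus_small ?linear0 ?addr0 //; lia.
- by rewrite -(subnK en) -addSn !xminusD xpS addr0.
by rewrite en [xminus n v]xminus_small // linear0 add0r; apply: etrans (xminusD 0 v) (xp0 v).
Qed.

(** The natural map [S^3 X -> X(2p-3)]: on [M (x) (k[x]/x^p)^(x 3)] it is
    [m (x) x^a (x) x^b (x) x^c |-> x^(a+b+c-p) m]. *)
Definition cube : 'Hom(sM X3, M) :=
  \sum_(a < n.+1) \sum_(b < n.+1) \sum_(c < n.+1) (xminus (a + b + c) \o coord3 a b c)%VF.

Lemma cubeE z : cube z =
  \sum_(a < n.+1) \sum_(b < n.+1) \sum_(c < n.+1) xminus (a + b + c) (coord3 a b c z).
Proof.
rewrite sum_lfunE; apply: eq_bigr => a _; rewrite sum_lfunE; apply: eq_bigr => b _.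
by rewrite sum_lfunE; apply: eq_bigr => c _; rewrite comp_lfunE.
Qed.

(** Each [scoord c z] lies in [S^2 X], so its image in [S X] lies in the
    subobject [ker pi]. *)
Lemma coord3_rel2 (c : 'I_n.+1) z :
  \sum_(a < n.+1) \sum_(b < n.+1) xp M (a + b) (coord3 a b c z) = 0.
Proof.
have := piS_mem (scoord X2 c z); rewrite serre_usub piSE => /eqP h.
under eq_bigr do under eq_bigr do rewrite coord3E.
rewrite exchange_big /= -[RHS]h; under [RHS]eq_bigr do rewrite scoord_piS.
rewrite (sum_antidiag (fun i => xp M i)); apply: eq_bigr => b _.
rewrite [LHS](bigID (fun a : 'I_n.+1 => (a + b < n.+1)%N)) /= [X in _ + X]big1 ?addr0 //.
by move=> a; rewrite -leqNgt => ab; rewrite xp_nil.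
Qed.

(** [z] lies in [S^3 X], so its image in [S^2 X] lies in the subobject of
    [S^2 X], the kernel of the map to [S X]. *)
Lemma coord3_rel3 (j : nat) z : (j < n.+1)%N ->
  \sum_(a < n.+1) \sum_(b < n.+1) \sum_(c < n.+1 | (a + b + c == j)%N) coord3 a b c z = 0.
Proof.
move=> jn; have := piS_mem z; rewrite serre_usub => /eqP /(congr1 (scoord X (Ordinal jn))).
rewrite linear0 scoord_piS /= => h.
pose G (i : nat) (w : sM X1) : M := \sum_(a < n.+1 | (a + i == j)%N) scoord X a w.
have Ga i : {morph G i : u v / u - v}.
  by move=> u v; rewrite /G -sumrB; apply: eq_bigr => a _; rewrite linearB.
pose GA i : {additive sM X1 -> M} :=
  HB.pack (G i) (GRing.isZmodMorphism.Build _ _ (G i) (@Ga i)).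
have := sum_antidiag GA (fun c b => scoord X1 b (scoord X2 c z)).
have -> : \sum_(i < n.+1) GA i (\sum_(c < n.+1) \sum_(b < n.+1 | (b + c == i)%N)
    scoord X1 b (scoord X2 c z)) = 0.
  rewrite -[RHS]h; apply: eq_bigr => i _; rewrite /GA /= /G; apply: eq_bigr => a _.
  by rewrite -scoord_piS.
move=> /esym e; rewrite -[RHS]e.
under [LHS]eq_bigr do under eq_bigr do rewrite big_mkcond /=.
under [LHS]eq_bigr do rewrite exchange_big /=.
rewrite [LHS]exchange_big; apply: eq_bigr => c _ /=.
rewrite [LHS]exchange_big [RHS]big_mkcond; apply: eq_bigr => b _ /=.
rewrite -big_mkcond /= /G; case: ltnP => bc.
  by apply: eq_big => a; rewrite ?addnA // coord3E.
by rewrite big1 // => a /eqP; lia.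
Qed.

(** Multiplying by [x] shifts [c].  The error terms are the part with
    [a + b + c = p - 1], which vanishes by [coord3_rel3], and the part that
    falls off at [c = p - 1], which vanishes by [coord3_rel2]. *)
Lemma cube_x z : cube (grx _ z) = grx M (cube z).
Proof.
have cx (a b c : 'I_n.+1) : coord3 a b c (grx _ z) =
    if nat_of_ord c is d.+1 then coord3 a b (inord d) z else 0.
  have <- : xp (sM X3) 1 z = grx _ z by rewrite xpS xp0.
  rewrite !coord3E scoord_xp; case: (nat_of_ord c) => [|d] /=.
    by rewrite !linear0.
  by rewrite subn1 coord3E.
have E1 (a b : 'I_n.+1) : \sum_(c < n.+1) xminus (a + b + c) (coord3 a b c (grx _ z)) =
   \sum_(c < n.+1) xminus (a + b + c).+1 (coord3 a b c z) - xp M (a + b) (coord3 a b ord_max z).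
  rewrite big_ord_recl [in RHS]big_ord_recr /= cx /= linear0 add0r -addnS xminusD addrK.
  apply: eq_bigr => c _; rewrite cx /= addnS; congr (xminus _ (coord3 a b _ z)).
  by apply: val_inj; rewrite /= inordK //; have := ltn_ord c; lia.
rewrite !cubeE; under eq_bigr do under eq_bigr do rewrite E1.
under eq_bigr do rewrite sumrB; rewrite sumrB coord3_rel2 subr0.
under eq_bigr do under eq_bigr do (under eq_bigr do rewrite xminusS; rewrite big_split /=).
under eq_bigr do rewrite big_split /=; rewrite big_split /=.
have -> : \sum_(a < n.+1) \sum_(b < n.+1) \sum_(c < n.+1)
    (if (a + b + c == n)%N then coord3 a b c z else 0) = 0.
  by rewrite -[RHS](@coord3_rel3 n z) //; apply: eq_bigr => a _; apply: eq_bigr => b _;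
    rewrite [RHS]big_mkcond.
rewrite addr0 linear_sum; apply: eq_bigr => a _; rewrite linear_sum.
by apply: eq_bigr => b _; rewrite linear_sum.
Qed.

Lemma xminus_degr e d v : v \in gr M d -> xminus e v \in gr M (d + e%:Z - n.+1%:Z).
Proof.
move=> vd; rewrite /xminus; case: (leqP n.+1 e) => en; last by rewrite zero_lfunE mem0v.
by have := @xp_degr _ _ M (e - n.+1) _ _ vd; congr (_ \in gr M _); lia.
Qed.

Fact cube_grhom : is_grhom (cube : 'Hom(sM X3, sM (shiftsm (n%:Z *+ 2 - 1) X))).
Proof.
apply/grhomP; split=> [d z zd|z]; last exact: cube_x.
rewrite [X in X \in _]cubeE addr0 /=; apply: memv_suml => a _; apply: memv_suml => b _.
apply: memv_suml => c _.
have := @xminus_degr (a + b + c) _ _ (scoord_gr a (scoord_gr b (scoord_gr c zd))).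
rewrite coord3E; congr (_ \in gr M _); lia.
Qed.

(** On the subobject of [S^3 X] the sums along [b + c = i] vanish for [i < p],
    and the remaining terms are multiples of elements [pi w] with [w] in [S X],
    which lie in [U]. *)
Fact cube_filt : @filt _ _ X3 (shiftsm (n%:Z *+ 2 - 1) X) cube.
Proof.
move=> z; rewrite serre_usub => /eqP z0; change (cube z \in usub X).
have low (a : 'I_n.+1) : \sum_(c < n.+1) \sum_(b < n.+1 | (b + c < n.+1)%N)
    xminus (a + b + c) (coord3 a b c z) = 0.
  transitivity (\sum_(i < n.+1) xminus (a + i) (scoord X a (scoord X1 i (piS X2 z)))).
    have := sum_antidiag (fun i => xminus (a + i)) (fun c b => coord3 a b c z).
    under [in X in _ = X]eq_bigr do under eq_bigr do rewrite addnA.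
    move=> <-; apply: eq_bigr => i _; congr (xminus _ _).
    rewrite scoord_piS linear_sum; apply: eq_bigr => c _; rewrite linear_sum.
    by apply: eq_bigr => b _; rewrite coord3E.
  by rewrite big1 // => i _; rewrite z0 !linear0.
have -> : cube z = \sum_(c < n.+1) \sum_(b < n.+1 | (n.+1 <= b + c)%N)
    xp M (b + c - n.+1) (piS X (scoord X1 b (scoord X2 c z))).
  rewrite cubeE; transitivity (\sum_(a < n.+1) \sum_(c < n.+1)
      \sum_(b < n.+1 | (n.+1 <= b + c)%N) xminus (a + b + c) (coord3 a b c z)).
    apply: eq_bigr => a _; rewrite exchange_big /=.
    under eq_bigr => c _ do rewrite (bigID (fun b : 'I_n.+1 => (b + c < n.+1)%N)) /=.
    rewrite big_split /= low add0r; apply: eq_bigr => c _; apply: eq_bigl => b.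
    by rewrite -leqNgt.
  rewrite exchange_big; apply: eq_bigr => c _; rewrite exchange_big.
  apply: eq_bigr => b bc; rewrite piSE linear_sum; apply: eq_bigr => a _ /=.
  rewrite -xpD coord3E; have -> : (a + b + c = (b + c - n.+1 + a) + n.+1)%N by lia.
  by rewrite xminusD.
apply: memv_suml => c _; apply: memv_suml => b _.
exact/filt_xp/piS_mem.
Qed.

Definition cube_mor : smor X3 (shiftsm (n%:Z *+ 2 - 1) X) := mk_mor cube_grhom cube_filt.

End Retraction.

End SerreCube.

(** * The section, and the cube of the Serre functor *)

Section CubeSection.
Variables (k : fieldType) (m : nat).
Local Notation n := m.+1.
Local Notation smono := (smono k n.+1).
Local Notation E := (smono_conflcat k n.+1).
Local Notation S := (stable_smono k n.+1).
Implicit Types (s t : int) (X Y Z : smono).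

Lemma scoord_serre_mor X Y (f : smor X Y) i w :
  scoord Y i (topmap (serre_mor f) w) = topmap f (scoord X i w).
Proof. by rewrite !scoordE serre_morE freemapE. Qed.

Lemma serre_grP X d (w : sM (serresm X)) :
  (forall i : 'I_n.+1, scoord X i w \in gr (sM X) (d + n%:Z - i%:Z)) ->
  w \in gr (sM (serresm X)) d.
Proof. by move=> h; rewrite subg_gr; apply/pgrP => i; rewrite -scoordE. Qed.

Lemma scoord_mor X Y (g : smor Y (serresm X)) i y :
  scoord X i (topmap g y) = hat g (xp (sM Y) (n - i) y).
Proof. by rewrite scoordE hat_coext coextE. Qed.

Lemma vinc_inj X : injective (vinc X).
Proof. by move=> u v; rewrite !vincE; apply: subvs_inj. Qed.

Lemma vinc_scoord X w i : (vinc X w : {ffun 'I_n.+1 -> sM X}) i = scoord X i w.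
Proof. by rewrite vincE scoordE. Qed.

(** [elt2] is the element [u (x) 1 + v (x) x]; it belongs to [S X] when
    [u + x v] lies in [U], and [vsproj] supplies a junk value otherwise. *)
Section Pair2.
Variables (W : vectType k) (X : smono) (u v : 'Hom(W, sM X)).

Definition pair2 (w : W) : {ffun 'I_n.+1 -> sM X} :=
  [ffun i => if i == ord0 then u w else if i == inord 1 then v w else 0].

Lemma pair2_lin : linear pair2.
Proof.
move=> a w w'; apply/ffunP=> i; rewrite !ffunE !linearP.
by case: ifP => // _; case: ifP => // _; rewrite scaler0 addr0.
Qed.

Definition elt2 : 'Hom(W, sM (serresm X)) := (linfun (vsproj _) \o linfun pair2)%VF.

Lemma sum2 (V : zmodType) (F : 'I_n.+1 -> sM X -> V) w : (forall i, F i 0 = 0) ->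
  \sum_(i < n.+1) F i (if i == ord0 then u w else if i == inord 1 then v w else 0)
  = F ord0 (u w) + F (inord 1) (v w).
Proof.
move=> F0; have i10 : inord 1 != ord0 :> 'I_n.+1 by rewrite -val_eqE /= inordK.
rewrite (bigD1 ord0) //= (bigD1 (inord 1)) //= (negPf i10) eqxx big1 ?addr0 //.
by move=> i /andP[i0 i1]; rewrite (negPf i0) (negPf i1).
Qed.

Lemma scoord_elt2 w (i : 'I_n.+1) : u w + grx _ (v w) \in usub X ->
  scoord X i (elt2 w) = if i == ord0 then u w else if i == inord 1 then v w else 0.
Proof.
move=> uv; rewrite scoordE comp_lfunE (linfunE pair2_lin) vsproj_lf vsprojK ?ffunE //.
rewrite -memv_preim extE; under eq_bigr do rewrite id_lfunE ffunE.
rewrite (sum2 (F := fun i => xp (sM X) i)) => [|j]; last exact: linear0.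
by rewrite inordK // xp0 xpS xp0.
Qed.

Lemma piS_elt2 w : u w + grx _ (v w) \in usub X -> piS X (elt2 w) = u w + grx _ (v w).
Proof.
move=> uv; rewrite piSE; under eq_bigr do rewrite scoord_elt2 //.
rewrite (sum2 (F := fun i => xp (sM X) i)) => [|j]; last exact: linear0.
by rewrite inordK // xp0 xpS xp0.
Qed.
End Pair2.

#[local] Opaque serresm.

Lemma elt2_degr (W : grmod k n.+1) X (u v : 'Hom(W, sM X)) j :
  (forall w, u w + grx _ (v w) \in usub X) ->
  degr (j + n%:Z) u -> degr (j + n%:Z - 1) v -> degr j (elt2 u v).
Proof.
move=> uv ud vd d w wd; apply: serre_grP => i; rewrite scoord_elt2 //.
case: eqP => [->|_]; first by have := ud _ _ wd; rewrite subr0 addrA.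
case: eqP => [->|_]; last exact: mem0v.
by have := vd _ _ wd; rewrite inordK // !addrA.
Qed.

(** The section is the morphism with last component
    [m |-> ((m - e m) (x) x - x m (x) 1) (x) 1 + (e m (x) 1) (x) x], found by
    comparing the standard projective resolution of [U -> M] with the
    resolution that defines [S^3].  On [M] it resolves
    [m |-> m (x) x - x m (x) 1], and on [U], where [e u = u], it is
    [u |-> (u (x) 1) (x) x - (x u (x) 1) (x) 1]; both are commutators with [x],
    which is why norms kill them in [theta_hat_perp1] and [theta_hat_perp2]. *)
Section Theta.
Variables (X : smono) (e : 'Hom(sM X, sU X)).
Hypotheses (ed : degr 0 e) (eK : forall u, e (sf X u) = u).
Local Notation M := (sM X).
Local Notation X1 := (serresm X).
Local Notation X2 := (serresm X1).
Local Notation X3 := (serresm X2).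

Let eU : 'End(M) := (sf X \o e)%VF.
Let eU_mem v : eU v \in usub X. Proof. by rewrite comp_lfunE sf_usub. Qed.
Let eU_id u : u \in usub X -> eU u = u.
Proof. by move=> /usubP[u0 ->]; rewrite comp_lfunE eK. Qed.

Let mu0 : 'Hom(M, sM X1) := elt2 (- grx M) (\1%VF - eU).
Let mu1 : 'Hom(M, sM X1) := elt2 eU 0.

Let mu0_mem v : (- grx M)%VF v + grx M ((\1%VF - eU)%VF v) \in usub X.
Proof.
rewrite !add_lfunE !opp_lfunE id_lfunE linearB /= addKr memvN.
by have [_ Ux] := usub_gr X; apply: Ux.
Qed.
Let mu1_mem v : eU v + grx M ((0 : 'End(M)) v) \in usub X.
Proof. by rewrite zero_lfunE linear0 addr0. Qed.

Definition theta_hat : 'Hom(M, sM X2) := elt2 mu0 mu1.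

Let kap v : mu0 v + grx _ (mu1 v) = elt2 (- grx M) \1 v.
Proof.
have mem : (- grx M)%VF v + grx M (\1%VF v) \in usub X.
  by rewrite opp_lfunE id_lfunE addNr mem0v.
apply: scoord_inj => i; rewrite linearD /= !scoord_elt2 //.
have <- : xp _ 1 (mu1 v) = grx _ (mu1 v) by rewrite xpS xp0.
rewrite scoord_xp scoord_elt2 // !zero_lfunE.
have i0E : (i == ord0) = (i == 0%N :> nat) by rewrite -val_eqE.
have i1E : (i == inord 1) = (i == 1%N :> nat) by rewrite -val_eqE /= inordK.
rewrite i0E i1E; case: (ltngtP i 1) => i1.
- by have -> : nat_of_ord i = 0%N; [lia | rewrite addr0].
- have -> : (nat_of_ord i == 0%N) = false by lia.
  rewrite add0r -val_eqE /= inordK; last by have := ltn_ord i; lia.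
  by have -> : (i - 1 == 0)%N = false; [lia | case: ifP].
rewrite i1 /= subnn add_lfunE opp_lfunE id_lfunE.
by have -> : inord 0 == ord0 :> 'I_n.+1; [rewrite -val_eqE /= inordK | rewrite subrK].
Qed.

Let kap_mem v : mu0 v + grx _ (mu1 v) \in usub X1.
Proof.
rewrite kap serre_usub piS_elt2; rewrite opp_lfunE id_lfunE addNr ?eqxx //.
exact: mem0v.
Qed.

Lemma theta_hat_perp1 v : Nm theta_hat v \in usub X2.
Proof.
rewrite serre_usub NmE linear_sum; apply/eqP; apply: (@vinc_inj X).
rewrite linear0 linear_sum.
transitivity ((0 : 'Hom(sM X, freeg n (sM X))) v); last exact: zero_lfunE.
rewrite -(Nm_comm (inc0 n (sM X))) NmE; apply: eq_bigr => i _ /=.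
rewrite piS_xp piS_elt2 // kap (grhom_xp _ _ (vinc_grhom X)). congr (xp (freeg n M) i _).
set w := xp M _ v.
have -> : comm_x (inc0 n M) w = grx (freeg n M) (inc0 n M w) - inc0 n M (grx M w).
  exact: comm_xE.
apply/ffunP=> j.
rewrite vinc_scoord scoord_elt2; last by rewrite opp_lfunE id_lfunE addNr mem0v.
rewrite ffunE free_x ffunE !ffunE !inc0E opp_lfunE id_lfunE.
have j0E : (j == ord0) = (j == 0%N :> nat) by rewrite -val_eqE.
have j1E : (j == inord 1) = (j == 1%N :> nat) by rewrite -val_eqE /= inordK.
rewrite j0E j1E; have := ltn_ord j; case: (nat_of_ord j) => [|[|l]] jn.
- by rewrite /= sub0r.
- by rewrite /= inc0E subr0; have -> : inord 0 == ord0 :> 'I_n.+1;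
  rewrite // -val_eqE /= inordK.
rewrite /= inc0E subr0; case: eqP => // /(congr1 val) /=.
by rewrite inordK //; lia.
Qed.

Lemma theta_hat_perp2 u : u \in usub X -> Nm theta_hat u = 0.
Proof.
move=> uU; pose J : 'Hom(M, freeg n (sM X1)) := (inc0 n (sM X1) \o elt2 \1 (0 : 'End(M)))%VF.
have JE y : J y = inc0 n (sM X1) (elt2 \1 (0 : 'End(M)) y) by exact: comp_lfunE.
have jmem w : w \in usub X -> (\1%VF : 'End(M)) w + grx M ((0 : 'End(M)) w) \in usub X.
  by move=> wU; rewrite id_lfunE zero_lfunE linear0 addr0.
apply: (@vinc_inj X1); rewrite linear0 NmE linear_sum.
transitivity ((0 : 'Hom(sM X, freeg n (sM X1))) u); last exact: zero_lfunE.
rewrite -(Nm_comm J) NmE; apply: eq_bigr => i _ /=.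
rewrite (grhom_xp _ _ (vinc_grhom X1)); congr (xp (freeg n (sM X1)) i _).
have wU : xp M (n - i) u \in usub X by exact: filt_xp.
move: (xp M _ u) wU => w wU.
have -> : comm_x J w = grx (freeg n (sM X1)) (J w) - J (grx M w) by exact: comm_xE.
apply/ffunP=> j.
have xwU : grx M w \in usub X by have [_ Ux] := usub_gr X; apply: Ux.
rewrite vinc_scoord scoord_elt2 // ffunE free_x ffunE !ffunE !JE !inc0E.
have E0 : mu0 w = - elt2 \1 (0 : 'End(M)) (grx M w).
  apply: scoord_inj => a; rewrite linearN /= !scoord_elt2 //; last exact: jmem.
  rewrite add_lfunE !opp_lfunE !id_lfunE zero_lfunE eU_id // subrr.
  by case: ifP => // _; case: ifP; rewrite oppr0.
have E1 : mu1 w = elt2 \1 (0 : 'End(M)) w.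
  apply: scoord_inj => a; rewrite !scoord_elt2 //; last exact: jmem.
  by rewrite eU_id // id_lfunE.
have j0E : (j == ord0) = (j == 0%N :> nat) by rewrite -val_eqE.
have j1E : (j == inord 1) = (j == 1%N :> nat) by rewrite -val_eqE /= inordK.
rewrite j0E j1E; have := ltn_ord j; case: (nat_of_ord j) => [|[|l]] jn.
- by rewrite /= sub0r E0.
- by rewrite /= inc0E subr0 E1; have -> : inord 0 == ord0 :> 'I_n.+1;
  rewrite // -val_eqE /= inordK.
rewrite /= inc0E subr0; case: eqP => // /(congr1 val) /=.
by rewrite inordK //; lia.
Qed.

Local Notation Y := (shiftsm (n%:Z *+ 2 - 1) X).

Lemma theta_hat_degr : degr 0 (theta_hat : 'Hom(sM Y, sM X2)).
Proof.
have /grhomP[fd _] := sf_hom X.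
have eUd d v : v \in gr M d -> eU v \in gr M d.
  by move=> vd; rewrite comp_lfunE -[d]addr0 -[d + 0]addr0; apply/fd/ed.
have m0 : degr (0 + n%:Z) (mu0 : 'Hom(sM Y, sM X1)).
  apply: (@elt2_degr (sM Y) X (- grx M) (\1%VF - eU)); first exact: mu0_mem.
    move=> d v vd; rewrite opp_lfunE memvN.
    by have := @grx_degr _ _ M _ _ vd; congr (_ \in gr M _); lia.
  move=> d v vd; rewrite add_lfunE opp_lfunE id_lfunE memvB ?eUd //;
  by move: vd; congr (_ \in gr M _); lia.
have m1 : degr (0 + n%:Z - 1) (mu1 : 'Hom(sM Y, sM X1)).
  apply: (@elt2_degr (sM Y) X eU 0); first exact: mu1_mem.
    by move=> d v /eUd; congr (_ \in gr M _); lia.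
  by move=> d v vd; rewrite zero_lfunE mem0v.
exact: (@elt2_degr (sM Y) X1 mu0 mu1 _ kap_mem m0 m1).
Qed.

Lemma theta_hat_perp : @perp _ _ Y X2 (Nm (theta_hat : 'Hom(sM Y, sM X2))).
Proof. by split; [exact: theta_hat_perp1 | exact: theta_hat_perp2]. Qed.

Definition theta : smor Y X3 := unhat theta_hat_degr theta_hat_perp.

(** For the [c]-th component only the indices with [a + b] at most [1] matter,
    and the powers of [x] are nonzero only for [c = p - 1] and [a + b = 1],
    where [m - e m] and [e m] add up to [m]. *)
Lemma cube_theta v : cube X (topmap theta v) = v.
Proof.
rewrite cubeE exchange_big /=.
under eq_bigr => b _ do rewrite exchange_big /=; rewrite exchange_big /=.
have E (c : 'I_n.+1) : \sum_(b < n.+1) \sum_(a < n.+1)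
    xminus X (a + b + c) (coord3 X a b c (topmap theta v)) = if c == ord_max then v else 0.
  under eq_bigr do under eq_bigr do rewrite coord3E scoord_mor unhatK.
  have -> : xp (sM Y) (n - c) v = xp M (n - c) v by [].
  set w := xp M _ v.
  under eq_bigr do under eq_bigr do rewrite scoord_elt2 //.
  rewrite (sum2 mu0 mu1 (F := fun b y => \sum_(a < n.+1) xminus X (a + b + c) (scoord X a y))); last first.
    by move=> b; rewrite big1 // => a _; rewrite !linear0.
  under eq_bigr do rewrite scoord_elt2 //.
  under [X in _ + X]eq_bigr do rewrite scoord_elt2 //.
  rewrite (sum2 _ _ (F := fun a y => xminus X (a + ord0 + c) y)); last first.
    by move=> b; rewrite linear0.
  rewrite (sum2 _ _ (F := fun a y => xminus X (a + inord 1 + c) y)); last first.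
    by move=> b; rewrite linear0.
  rewrite !inordK // zero_lfunE linear0 addr0 /= xminus_small ?ltn_ord // add0r.
  rewrite -linearD /= add_lfunE opp_lfunE id_lfunE subrK addn0 add1n xminusS.
  rewrite xminus_small ?ltn_ord // linear0 add0r -val_eqE /=.
  by case: eqP => // cn; rewrite /w cn subnn xp0.
under eq_bigr do rewrite E.
by rewrite -big_mkcond big_pred1_eq.
Qed.

End Theta.

Lemma cube_nat X Y (f : smor X Y) z :
  cube Y (topmap (serre_mor (serre_mor (serre_mor f))) z) = topmap f (cube X z).
Proof.
rewrite !cubeE linear_sum; apply: eq_bigr => a _; rewrite linear_sum.
apply: eq_bigr => b _; rewrite linear_sum; apply: eq_bigr => c _ /=.
rewrite !coord3E !scoord_serre_mor /xminus; case: ifP => _; last by rewrite !zero_lfunE linear0.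
by rewrite (grhom_xp _ _ (topmap_grhom f)).
Qed.

Lemma Ser3_scl (X Y : E) (f : hom X Y) : fmap (fpow (Ser k m) 3) (scl f) =
  scl (serre_mor (serre_mor (serre_mor f)) :
    hom (serresm (serresm (serresm X)) : E) (serresm (serresm (serresm Y)))).
Proof.
transitivity (fmap (Ser k m) (fmap (Ser k m) (scl (serre_mor f : hom (serresm X : E) (serresm Y))))).
  exact: (congr1 (fun g => fmap (Ser k m) (fmap (Ser k m) g)) (Ser_scl f)).
transitivity (fmap (Ser k m) (scl (serre_mor (serre_mor f) :
   hom (serresm (serresm X) : E) (serresm (serresm Y))))).
  exact: (congr1 (fun g => fmap (Ser k m) g) (Ser_scl _)).
exact: Ser_scl.
Qed.

(** [cube] is natural and has a section on each object; fullness of the Serre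
    functor makes it invertible. *)
Lemma Ser3 : nat_iso (fpow (Ser k m) 3) (Tsh k n (n%:Z *+ 2 - 1)).
Proof.
apply: (@nat_iso_of_retraction k S (fpow (Ser k m) 3) (Tsh k n (n%:Z *+ 2 - 1))
  (fun X => scl (cube_mor X : hom (serresm (serresm (serresm X)) : E)
                                  (shiftsm (n%:Z *+ 2 - 1) X)))).
- move=> X Y g; have [f3 <-] := Ser_full (X := Ser k m (Ser k m X)) (Y := Ser k m (Ser k m Y)) g.
  have [f2 <-] := Ser_full (X := Ser k m X) (Y := Ser k m Y) f3.
  by have [f1 <-] := Ser_full f2; exists f1.
- move=> X Y f f'; apply: (@faithful_of_linv _ _ _ (Tsh k n (- (n%:Z *+ 2 - 1)))).
  by apply: TshV; rewrite addNr.
- move=> X Y f; have [g ->] := scl_surj f; rewrite Ser3_scl Tsh_scl.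
  rewrite -(scl_comp (shift_mor g (erefl (n%:Z *+ 2 - 1)) : hom (shiftsm _ X : E) (shiftsm _ Y))
    (cube_mor X : hom (serresm (serresm (serresm X)) : E) (shiftsm _ X))).
  rewrite -(scl_comp (cube_mor Y : hom (serresm (serresm (serresm Y)) : E) (shiftsm _ Y))).
  congr scl; apply: topmap_inj; apply/lfunP=> z; rewrite !topmap_comp comp_lfunE [RHS]comp_lfunE.
  by rewrite [RHS](cube_nat g z).
move=> X; have [e [ed eK]] := retraction (X : smono).
exists (scl (theta ed eK : hom (shiftsm _ X : E) (serresm (serresm (serresm X))))).
rewrite -(scl_comp (cube_mor X : hom (serresm (serresm (serresm X)) : E) (shiftsm _ X))).
rewrite -scl_id; congr scl; apply: topmap_inj; apply/lfunP=> z; rewrite !topmap_comp comp_lfunE.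
by rewrite [LHS](cube_theta ed eK z) topmap_id id_lfunE.
Qed.

End CubeSection.

(** * The suspension for the exponent two *)

Section Period2.
Variable k : fieldType.
Local Notation smono := (smono k 2).
Local Notation grmod := (grmod k 2).
Local Notation E := (smono_conflcat k 2).
Local Notation S := (stable_smono k 2).
Implicit Types (V W : grmod) (X Y Z : smono).

(** The cosyzygy of [M] is [M(1)] with [x] replaced by [-x]; the sign
    automorphism [(-1)^deg] undoes this. *)
Definition sgnm V : 'End(V) := \sum_(d <- supp V) (-1) ^+ absz d *: pr V d.

Lemma sgnE V d v : v \in gr V d -> sgnm V v = (-1) ^+ absz d *: v.
Proof.
move=> vd; rewrite sum_lfunE (sum_seq_pick (i := d)) ?supp_uniq //.
- by rewrite scale_lfunE pr_id.
- by move=> e _ ed; rewrite scale_lfunE (pr_neq vd ed) scaler0.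
- by move=> ds; rewrite scale_lfunE pr_notin // scaler0.
Qed.

Lemma sgnK V v : sgnm V (sgnm V v) = v.
Proof.
suff E : (sgnm V \o sgnm V)%VF = \1%VF by rewrite -comp_lfunE E id_lfunE.
apply: eq_homog => d w wd; rewrite comp_lfunE (sgnE wd) linearZ /= (sgnE wd).
by rewrite scalerA -exprD addnn -mul2n exprM sqrrN !expr1n scale1r id_lfunE.
Qed.

Lemma sgn_x V v : sgnm V (grx V v) = - grx V (sgnm V v).
Proof.
suff E : (sgnm V \o grx V)%VF = - (grx V \o sgnm V)%VF.
  by rewrite -comp_lfunE E opp_lfunE comp_lfunE.
apply: eq_homog => d w wd; rewrite opp_lfunE !comp_lfunE (sgnE wd).
rewrite (sgnE (@grx_degr _ _ V _ _ wd)) linearZ -scaleNr; congr (_ *: _).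
rewrite -signr_odd -[in RHS]signr_odd.
have -> : odd (absz (d + 1)) = ~~ odd (absz d) by lia.
by case: (odd _); rewrite ?expr0 ?expr1 ?opprK.
Qed.

Lemma sgn_grhom V W (f : 'Hom(V, W)) v : is_grhom f -> sgnm W (f v) = f (sgnm V v).
Proof.
move=> /grhomP[fd _]; suff E : (sgnm W \o f)%VF = (f \o sgnm V)%VF.
  by rewrite -comp_lfunE E comp_lfunE.
apply: eq_homog => d w wd; rewrite !comp_lfunE (sgnE wd) linearZ /=.
by have := fd _ _ wd; rewrite addr0 => /sgnE->.
Qed.

Lemma sgn_filt X : filt (sgnm (sM X)).
Proof.
by move=> _ /usubP[u ->]; rewrite (sgn_grhom _ (sf_hom X)) sf_usub.
Qed.

Section Quotient2.
Variable X : smono.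
Local Notation M := (sM X).

Definition quot2 : 'Hom(freeg 1 M, M) :=
  (sgnm M \o (linfun (@pev k 1 M ord0) - (grx M \o linfun (@pev k 1 M ord_max))))%VF.

Lemma quot2E (phi : freeg 1 M) : quot2 phi =
  sgnm M ((phi : {ffun _ -> _}) ord0 - grx M ((phi : {ffun _ -> _}) ord_max)).
Proof.
rewrite comp_lfunE add_lfunE opp_lfunE comp_lfunE.
by rewrite (linfunE (@pev_lin k 1 M ord0)) (linfunE (@pev_lin k 1 M ord_max)).
Qed.

Fact quot2_grhom : is_grhom (quot2 : 'Hom(sM (freesm 1 X), sM (shiftsm 1 X))).
Proof.
apply/grhomP; split=> [d phi /pgrP h|phi].
  rewrite quot2E addr0 /=.
  have hd : (phi : {ffun _ -> _}) ord0 - grx M ((phi : {ffun _ -> _}) ord_max) \in gr M (d + 1).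
    rewrite memvB //; first by have := h ord0; rewrite subr0.
    by have := @grx_degr _ _ M _ _ (h ord_max); rewrite /= addrK.
  by rewrite (sgnE hd) memvZ.
rewrite [RHS](congr1 (grx M) (quot2E phi)) [LHS]quot2E free_x !ffunE /= sub0r linearN /=.
rewrite sgn_x opprK linearB /= sgn_x opprK linearD /=.
have -> : grx M (grx M (sgnm M ((phi : {ffun _ -> _}) ord_max))) = 0.
  exact: (grx_nil (sgnm M (phi ord_max))).
rewrite addr0; congr (grx M (sgnm M (phi _))).
by apply: val_inj; rewrite /= inordK.
Qed.

Fact quot2_filt : @filt _ _ (freesm 1 X) (shiftsm 1 X) quot2.
Proof.
move=> phi /free_usub h; have [_ Ux] := usub_gr X.
change (quot2 phi \in usub X); rewrite quot2E; apply: sgn_filt.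
by rewrite memvB // Ux.
Qed.

Definition quot2_mor : smor (freesm 1 X) (shiftsm 1 X) :=
  @mk_mor _ _ (freesm 1 X) (shiftsm 1 X) _ quot2_grhom quot2_filt.

Lemma confl2 : confl (unit_mor X : hom (X : E) (freesm 1 X))
  (quot2_mor : hom (freesm 1 X : E) (shiftsm 1 X)).
Proof.
have uE x (i : 'I_2) : (topmap (unit_mor X) x : {ffun 'I_2 -> M}) i = xp M (1 - i) x.
  by rewrite coextE id_lfunE.
apply: confl_intro; first exact: unit_inj.
- move=> x; rewrite [LHS]quot2E !uE.
  have -> : (1 - (ord0 : 'I_2) = 1)%N by [].
  have -> : (1 - (ord_max : 'I_2) = 0)%N by [].
  by rewrite xpS !xp0 subrr; apply: linear0.
- move=> phi; rewrite [LHS]quot2E => /(congr1 (sgnm M)).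
  rewrite sgnK [X in _ = X](linear0 (sgnm M)) => /eqP; rewrite subr_eq0 => /eqP e0.
  exists (phi ord_max); last by move/free_usub.
  apply/ffunP=> i; rewrite uE; case: i => [[|[|i]] // i2]; rewrite ?subn0 ?subnn ?xpS ?xp0.
    by rewrite -e0; congr (fun_of_fin phi _); apply: val_inj.
  by congr (fun_of_fin phi _); apply: val_inj.
move=> z; exists (inc0 1 M (sgnm M z)).
  by rewrite [LHS]quot2E !inc0E eqxx /= linear0 subr0 sgnK.
by move=> zU; apply: (@inc0_filt _ _ 1 X); apply: sgn_filt.
Qed.
End Quotient2.

Lemma Sig_period2 : nat_iso (Sig k 1) (Tsh k 1 1).
Proof.
apply: (suspends_uniq (@smono_confl_epi k 2) (@smono_confl_cancel k 2)
  (@smono_confl0 k 2) (Sig_suspends k 1)).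
apply: (@suspends_strict k E (@smono_confl_epi k 2) (@smono_confl_cancel k 2)
  (@smono_confl0 k 2) (idF S) (Tsh k 1 1) (fun X Y f => f)
  (fun X Y f => shift_mor f (erefl 1))
  (freesm 1) (fun X Y f => free_mor 1 f) (@unit_mor k 1) quot2_mor).
- by [].
- exact: Tsh_scl.
- by move=> Z; split; [exact: free_projinj | exact: confl2].
- exact: unit_nat.
move=> X Y f; apply: topmap_inj; apply/lfunP=> phi.
rewrite !topmap_comp comp_lfunE [RHS]comp_lfunE [RHS]quot2E.
rewrite [X in fun_of_lfun _ X](quot2E phi) !freemapE.
have fh := topmap_grhom (f : smor X Y); have /grhomP[_ fx] := fh.
by rewrite -fx -linearB (sgn_grhom _ fh).
Qed.

End Period2.

(** * Objects that tell the functors apart *)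

Section Minimality.
Variables (k : fieldType) (m : nat).
Local Notation n := m.+1.
Local Notation smono := (smono k n.+1).
Local Notation E := (smono_conflcat k n.+1).
Local Notation S := (stable_smono k n.+1).

Definition simple_gr (d : int) : {vspace k^o} := if d == 0 then fullv else 0%VS.

Program Definition simple : grmod k n.+1 :=
  @Grmod k n.+1 (k^o : vectType k) simple_gr 0 _ _ _.
Next Obligation.
apply: (gr_direct_of_proj (r := [:: 0]) (e := fun d (v : k^o) => if d == 0 then v else 0)) => //.
- by move=> d; rewrite inE /simple_gr => /negPf->.
- by move=> d a u v; case: ifP => // _; rewrite scaler0 addr0.
- by move=> d w; rewrite /simple_gr; case: ifP; rewrite ?memvf ?mem0v.
- by move=> w; rewrite big_seq1 eqxx.
- by move=> d w; rewrite /simple_gr; case: eqP => // _; rewrite memv0 => /eqP.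
- move=> d d' w; rewrite /simple_gr; case: (eqVneq d' 0) => [->|_].
    by move=> _ /negPf->.
  by rewrite memv0 => /eqP->; case: ifP.
Qed.
Next Obligation. by move=> d; rewrite lim0g sub0v. Qed.
Next Obligation. by move=> v /=; rewrite zero_lfunE. Qed.

Lemma simple_xp i v : xp simple i.+1 v = 0.
Proof. by rewrite xpS /= zero_lfunE. Qed.

Fact simple_mono : lker (0 : 'Hom(grmod0 k n.+1, simple)) = 0%VS.
Proof.
by apply/eqP; rewrite -subv0; apply/subvP=> v _; rewrite memv0 [v]thinmx0.
Qed.

Definition simple_obj : smono := Smono (is_grhom0 _ _) simple_mono.

Lemma simple_obj_usub v : v \in usub simple_obj -> v = 0.
Proof. by move=> /usubP[u ->]; rewrite zero_lfunE. Qed.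

Lemma nat_iso_obj (F G : functor S S) (X : S) : nat_iso F G ->
  exists (g : hom (F X : E) (G X : E)) (h : hom (G X : E) (F X : E)),
    stably_zero (idm (F X : E) - comp h g).
Proof.
move=> [t [ti _]]; have [u [ut _]] := ti X.
have [g gE] := scl_surj (t X); have [h hE] := scl_surj u.
by exists g, h; apply/scl_eq; rewrite scl_comp -hE -gE ut.
Qed.

Definition monomial s (i : 'I_n.+1) : freeg s simple := [ffun j => if j == i then 1 else 0].

Lemma monomial_ker s i : i != ord0 -> ext s (\1%VF : 'End(simple)) (monomial s i) = 0.
Proof.
move=> i0; rewrite extE big1 // => j _; rewrite id_lfunE ffunE.
case: eqP => [->|_]; last by rewrite linear0.
by case: i i0 => [[|i] iN] //= _; rewrite simple_xp.
Qed.

Lemma ker_ev0 s (w : freeg s simple) : ext s (\1%VF : 'End(simple)) w = 0 ->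
  (w : {ffun 'I_n.+1 -> _}) ord0 = 0.
Proof.
rewrite extE (bigD1 ord0) //= big1 => [|j j0]; first by rewrite addr0 !id_lfunE.
by case: j j0 => [[|j] jN] //= _; rewrite simple_xp.
Qed.

(** Only the summand [x^(p-1) phi v] survives.  This detects identities that are
    not stably zero. *)
Lemma Nm_socle (V W : grmod k n.+1) (phi : 'Hom(V, W)) v :
  grx V v = 0 -> xp W n (phi v) = 0 -> Nm phi v = 0.
Proof.
move=> xv pv; rewrite NmE big_ord_recr /= subnn xp0 pv addr0 big1 // => i _.
have -> : (n - i)%N = (n - i).-1.+1 by have := ltn_ord i; lia.
by rewrite xpSr xv !linear0.
Qed.

Lemma socle_top s (w : freeg s simple) : ext s (\1%VF : 'End(simple)) w = 0 ->
  xp (freeg s simple) n w = 0.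
Proof.
move=> /ker_ev0 w0; apply/ffunP=> i; rewrite free_xp ffunE; case: leqP => // ni.
have -> : (i - n)%N = 0%N by have := ltn_ord i; lia.
by rewrite -[RHS]w0; congr (fun_of_fin w _); apply: val_inj; rewrite /= inordK.
Qed.

Lemma monomial_max s : grx (freeg s simple) (monomial s ord_max) = 0.
Proof.
apply/ffunP=> i; rewrite free_x !ffunE; case E: (nat_of_ord i) => [//|j].
rewrite ffunE; case: eqP => // /(congr1 val) /=.
by move=> jn; exfalso; move: jn; have il := ltn_ord i; rewrite inordK; lia.
Qed.

Lemma monomial_neq0 s i : monomial s i != 0.
Proof.
apply/eqP => /ffunP/(_ i); rewrite !ffunE eqxx => /eqP.
by rewrite oner_eq0.
Qed.

Lemma Tsh_id_eq0 z : nat_iso (Tsh k n z) (idF S) -> z = 0.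
Proof.
move=> /nat_iso_sym/(nat_iso_obj simple_obj)[g [h /stably_zeroP[phi [_ _ pE]]]].
case: (eqVneq z 0) => // z0; have g0 : topmap (g : smor simple_obj (shiftsm z simple_obj)) (1 : k^o) = 0.
  have /grhomP[gd _] := topmap_grhom (g : smor simple_obj (shiftsm z simple_obj)).
  have /gd : (1 : k^o) \in gr simple 0 by rewrite /= /simple_gr eqxx memvf.
  by rewrite /= /simple_gr !add0r (negPf z0) memv0 => /eqP.
have : topmap (idm (simple_obj : E) - comp h g : smor simple_obj simple_obj) (1 : k^o) = 0.
  rewrite pE; apply: Nm_socle; first by rewrite /= zero_lfunE.
  exact: simple_xp.
rewrite topmap_sub add_lfunE opp_lfunE topmap_comp comp_lfunE g0 linear0 subr0 topmap_id id_lfunE.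
by move/eqP; rewrite oner_eq0.
Qed.

(** The subobject [U] of a shift of [0 -> k] vanishes, so a stable isomorphism
    would make the identity on the [U] of [S (0 -> k)] a norm; but the socle
    element [1 (x) x^(p-1)] there is not a multiple of [x^(p-1)]. *)
Lemma Ser_neq_Tsh z : ~ nat_iso (Ser k m) (Tsh k n z).
Proof.
move=> /(nat_iso_obj simple_obj)[g [h /stably_zeroP[phi [_ pF pE]]]].
pose N := serresm simple_obj; pose v : sM N := vsproj _ (monomial n ord_max).
have vE : vsval v = monomial n ord_max.
  by rewrite vsprojK // -memv_preim [X in X \in _]monomial_ker ?mem0v.
have vU : v \in usub N by rewrite sub_usub vE memv_ker [X in X == _]monomial_ker.
have : topmap (idm (N : E) - comp h g : smor N N) v = 0.
  rewrite pE; apply: Nm_socle; apply: subvs_inj.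
    by rewrite subg_x vE [LHS]monomial_max.
  rewrite subg_xp; apply: socle_top; have := pF _ vU.
  by rewrite sub_usub memv_ker => /eqP.
rewrite topmap_sub add_lfunE opp_lfunE topmap_comp comp_lfunE topmap_id id_lfunE.
have -> : topmap (g : smor N (shiftsm z simple_obj)) v = 0.
  exact/simple_obj_usub/(topmap_filt (g : smor N (shiftsm z simple_obj))).
rewrite linear0 subr0 => /(congr1 (fun w : sM N => vsval w)); rewrite vE.
by move/eqP; rewrite (negPf (monomial_neq0 _ _)).
Qed.

(** For [p > 2] the suspension of [k] has length [p - 1 > 1], and its socle
    [1 (x) x^(p-1)] is a multiple of [x], hence dies in any map to a shift of
    [k]. *)
Lemma Sig_neq_Tsh z : (1 < n)%N -> ~ nat_iso (Sig k n) (Tsh k n z).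
Proof.
move=> n1 /(nat_iso_obj simple_obj)[g [h /stably_zeroP[phi [_ pF pE]]]].
pose N := suspsm simple_obj; pose e (i : 'I_n.+1) : sM N := vsproj _ (monomial n.+1 i).
have eE (i : 'I_n.+1) : i != ord0 -> vsval (e i) = monomial n.+1 i.
  by move=> i0; rewrite vsprojK // memv_ker [X in X == _]monomial_ker.
have xe : grx _ (e (inord m)) = e ord_max.
  have m0 : inord m != ord0 :> 'I_n.+1 by rewrite -val_eqE /= inordK; lia.
  apply: subvs_inj; rewrite subg_x !eE //; apply/ffunP=> j.
  rewrite [X in (X : {ffun _ -> _}) _]free_x !ffunE; case E: (nat_of_ord j) => [|l].
    by case: eqP => // /(congr1 val) /=; rewrite E.
  have jn := ltn_ord j.
  rewrite ffunE -!val_eqE /= !inordK ?E; try lia.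
  by rewrite eqSS.
have : topmap (idm (N : E) - comp h g : smor N N) (e ord_max) = 0.
  rewrite pE; apply: Nm_socle; apply: subvs_inj.
    by rewrite subg_x eE // [LHS]monomial_max.
  rewrite subg_xp; apply: socle_top.
  have := subvsP (phi (e ord_max)).
  by rewrite memv_ker => /eqP.
rewrite topmap_sub add_lfunE opp_lfunE topmap_comp comp_lfunE topmap_id id_lfunE.
have -> : topmap (g : smor N (shiftsm z simple_obj)) (e ord_max) = 0.
  rewrite -xe; have /grhomP[_ ->] := topmap_grhom (g : smor N (shiftsm z simple_obj)).
  by rewrite /= zero_lfunE.
rewrite linear0 subr0 => /(congr1 (fun w : sM N => vsval w)); rewrite eE //.
by move/eqP; rewrite (negPf (monomial_neq0 _ _)).
Qed.

End Minimality.

(** * Powers of the Serre functor and of the suspension *)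

Section Powers.
Variables (k : fieldType) (m : nat).
Local Notation n := m.+1.
Local Notation S := (stable_smono k n.+1).
Local Notation T := (Tsh k n).
Local Notation Ser := (Ser k m).
Local Notation Sig := (Sig k n).

Lemma Sig_pow2 : nat_iso (fpow Sig 2) (T n.+1).
Proof. exact: nat_iso_trans (nat_iso_compr _ (fpow1 _)) (Sig2 k n). Qed.

Lemma Tsh_cancel z F G : nat_iso (compF (T z) F) G -> nat_iso F (compF (T (- z)) G).
Proof.
move=> h; apply: nat_iso_sym; apply: nat_iso_trans (nat_iso_compr _ (nat_iso_sym h)) _.
apply: nat_iso_trans (nat_iso_sym (compFA _ _ _)) _.
apply: nat_iso_trans (comp1F F); apply: nat_iso_compl.
by apply: TshV; rewrite addNr.
Qed.

Lemma Sig_autoequiv : exists A : autoequiv S, aeF A = Sig.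
Proof.
by apply: (autoequiv_of_pow (T' := T (- n.+1%:Z)) Sig_pow2); apply: TshV;
  rewrite ?addNr ?addrN.
Qed.

Lemma Ser_autoequiv : exists A : autoequiv S, aeF A = Ser.
Proof.
by apply: (autoequiv_of_pow (T' := T (- (n%:Z *+ 2 - 1))) (Ser3 k m)); apply: TshV;
  rewrite ?addNr ?addrN.
Qed.

Lemma Ser_pow3 a : nat_iso (fpow Ser (3 * a)) (T ((n%:Z *+ 2 - 1) * a%:Z)).
Proof.
apply: nat_iso_trans (nat_iso_sym (fpowM _ _ _)) _.
exact: nat_iso_trans (fpow_congr _ (Ser3 k m)) (Tsh_pow _ _ _ _).
Qed.

Lemma suspension_Sig (Sg : autoequiv S) : is_suspension Sg -> nat_iso Sg Sig.
Proof.
move=> /suspension_suspends h.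
exact: (suspends_uniq (@smono_confl_epi k n.+1) (@smono_confl_cancel k n.+1)
  (@smono_confl0 k n.+1) h (Sig_suspends k n)).
Qed.

Section Suspension.
Variables (Sg : autoequiv S).
Hypothesis SgE : nat_iso Sg Sig.

Lemma Sg_pow2 : nat_iso (fpow Sg 2) (T n.+1).
Proof. exact: nat_iso_trans (fpow_congr _ SgE) Sig_pow2. Qed.

Lemma Sg_pow_even c : nat_iso (fpow Sg (2 * c)) (T (n.+1%:Z * c%:Z)).
Proof.
apply: nat_iso_trans (nat_iso_sym (fpowM _ _ _)) _.
exact: nat_iso_trans (fpow_congr _ Sg_pow2) (Tsh_pow _ _ _ _).
Qed.

Lemma SgV_pow2 : nat_iso (fpow (aeG Sg) 2) (T (- n.+1%:Z)).
Proof.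
apply: (inverse_uniq (F := fpow Sg 2)); last first.
  apply: nat_iso_trans (nat_iso_compl _ Sg_pow2) _.
  by apply: TshV; rewrite addrN.
apply: nat_iso_trans (nat_iso_comp (nat_iso_compr _ (fpow1 _)) (nat_iso_compr _ (fpow1 _))) _.
apply: nat_iso_trans (compFA _ _ _) _; apply: nat_iso_trans (aeGF Sg); apply: nat_iso_compr.
apply: nat_iso_trans (nat_iso_sym (compFA _ _ _)) _.
exact: nat_iso_trans (nat_iso_compl _ (aeGF Sg)) (comp1F _).
Qed.

Lemma SgV_pow_even c : nat_iso (fpow (aeG Sg) (2 * c)) (T (- n.+1%:Z * c%:Z)).
Proof.
apply: nat_iso_trans (nat_iso_sym (fpowM _ _ _)) _.
exact: nat_iso_trans (fpow_congr _ SgV_pow2) (Tsh_pow _ _ _ _).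
Qed.

Lemma aepow_sq z : nat_iso (fpow (aepow Sg z) 2) (T (n.+1%:Z * z)).
Proof.
case: z => c; apply: nat_iso_trans (fpowM _ _ _) _; rewrite mulnC.
  exact: Sg_pow_even.
rewrite (_ : _ * Negz c = - n.+1%:Z * c.+1%:Z); first exact: SgV_pow_even.
by rewrite NegzE mulrN mulNr.
Qed.

(** The inverse [G] of the suspension is [G^2] times the suspension, and [G^2]
    is a shift; this handles the odd negative powers. *)
Lemma aepow_parity z : (exists c : int, z = c *+ 2 /\ nat_iso (aepow Sg z) (T (n.+1%:Z * c)))
  \/ exists w : int, nat_iso (aepow Sg z) (compF (T w) Sig).
Proof.
have half (c : nat) : c = (2 * c./2 + odd c)%N by have := odd_double_half c; lia.
case: z => c.
  case E: (odd c); have cE := half c; rewrite E in cE.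
    right; exists (n.+1%:Z * c./2%:Z); rewrite /= {1}cE.
    apply: nat_iso_trans (nat_iso_sym (fpowD _ _ _)) _.
    exact: nat_iso_comp (nat_iso_trans (fpow1 _) SgE) (Sg_pow_even _).
  left; exists c./2%:Z; split; first by lia.
  by rewrite /= {1}cE addn0; apply: Sg_pow_even.
case E: (odd c.+1); have cE := half c.+1; rewrite E in cE.
  right; exists (- n.+1%:Z * (c.+1)./2%:Z + - n.+1%:Z).
  rewrite /aepow {1}cE; apply: nat_iso_trans (nat_iso_sym (fpowD _ _ _)) _.
  have GE : nat_iso (fpow (aeG Sg) 1) (compF (T (- n.+1%:Z)) Sig).
    apply: nat_iso_trans (fpow1 _) _; apply: nat_iso_sym.
    apply: nat_iso_trans (nat_iso_comp (nat_iso_sym SgE) (nat_iso_sym SgV_pow2)) _.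
    apply: nat_iso_trans (nat_iso_compl _ (nat_iso_compr _ (fpow1 _))) _.
    apply: nat_iso_trans (compFA _ _ _) _.
    exact: nat_iso_trans (nat_iso_compr _ (aeGF Sg)) (compF1 _).
  apply: nat_iso_trans (nat_iso_comp GE (SgV_pow_even _)) _.
  apply: nat_iso_trans (nat_iso_sym (compFA _ _ _)) _.
  by apply: nat_iso_compl; apply: TshD.
left; exists (- (c.+1)./2%:Z); split; first by rewrite NegzE; lia.
rewrite /aepow {1}cE addn0 (_ : _ * - _ = - n.+1%:Z * (c.+1)./2%:Z); last first.
  by rewrite mulrN mulNr.
exact: SgV_pow_even.
Qed.

Lemma Tsh_inj a b : nat_iso (T a) (T b) -> a = b.
Proof.
move=> h; apply/eqP; rewrite -subr_eq0; apply/eqP; apply: (@Tsh_id_eq0 k m).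
rewrite addrC; apply: nat_iso_trans (nat_iso_sym (TshD _ _ _ _)) _.
by apply: nat_iso_trans (nat_iso_compr _ h) _; apply: TshV; rewrite addNr.
Qed.

(** Otherwise a second or fourth power of the isomorphism has exponent
    [1 mod 3] on the left and an even power of the suspension on the right, so
    that the Serre functor itself would be a shift. *)
Lemma CY_dvd3 n' z : nat_iso (fpow Ser n') (aepow Sg z) -> (3 %| n')%N.
Proof.
move=> h; have no q w : ~ nat_iso (fpow Ser (3 * q + 1)) (T w).
  move=> /(nat_iso_trans (fpowD _ _ _)).
  move=> /(nat_iso_trans (nat_iso_comp (nat_iso_sym (fpow1 _)) (nat_iso_sym (Ser_pow3 q)))).
  move=> /Tsh_cancel /nat_iso_trans/(_ (TshD _ _ _ _)).
  exact: Ser_neq_Tsh.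
have h2 : nat_iso (fpow Ser (n' * 2)) (T (n.+1%:Z * z)).
  apply: nat_iso_trans (nat_iso_sym (fpowM _ _ _)) _.
  exact: nat_iso_trans (fpow_congr _ h) (aepow_sq z).
have h4 : nat_iso (fpow Ser (n' * 2 * 2)) (T (n.+1%:Z * z * 2)).
  apply: nat_iso_trans (nat_iso_sym (fpowM _ _ _)) _.
  exact: nat_iso_trans (fpow_congr _ h2) (Tsh_pow _ _ _ _).
have := divn_eq n' 3; have := ltn_pmod n' (isT : (0 < 3)%N).
rewrite /dvdn; case: (n' %% 3)%N => [//|[|[|//]]] _ n'E.
  case: (no (n' %/ 3 * 4 + 1)%N (n.+1%:Z * z * 2)).
  by move: h4; congr (nat_iso (fpow _ _) _); lia.
case: (no (n' %/ 3 * 2 + 1)%N (n.+1%:Z * z)).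
by move: h2; congr (nat_iso (fpow _ _) _); lia.
Qed.

(** With [n' = 3 a], the Serre functor contributes the shift by [(2p-3) a].
    This is not an odd power of the suspension, and if it is an even one, then
    [p] divides [(2p-3) a], hence [3 a]. *)
Lemma CY_dvdp n' z : (0 < m)%N -> nat_iso (fpow Ser n') (aepow Sg z) -> (n.+1 %| n')%N.
Proof.
move=> m0 h; have /dvdnP[a aE] := CY_dvd3 h; rewrite aE mulnC in h.
have h' := nat_iso_trans (nat_iso_sym (Ser_pow3 a)) h.
case: (aepow_parity z) => [[c [_ zc]]|[w zw]].
  have /Tsh_inj e := nat_iso_trans h' zc.
  have : ((n.+1%:Z) %| n'%:Z)%Z.
    apply/dvdzP; exists (2 * a%:Z - c); rewrite aE; move: e; rewrite PoszM; nia.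
  by rewrite dvdzE.
exfalso; have := nat_iso_trans (nat_iso_sym zw) (nat_iso_sym h').
by move=> /Tsh_cancel/nat_iso_trans/(_ (TshD _ _ _ _)); apply: Sig_neq_Tsh.
Qed.

End Suspension.
End Powers.

(** * The fractional Calabi-Yau dimension *)

Theorem proposition5p11 (k : fieldType) (p : nat) (hp : (2 <= p)%N) :
  let chi : rat := euler_char [:: 2%N; 3%N; p] in
  [/\ chi = p%:R^-1 - 6^-1 /\ chi = (6 - p%:R) / (6 * p%:R),
      1 - 2 * chi = (4 * p%:R - 6) / (3 * p%:R),
      exists Sg : autoequiv (stable_smono k p), is_suspension Sg
    & forall Sg : autoequiv (stable_smono k p), is_suspension Sg ->
      [/\ p = 2%N -> fractional_CY Sg 1 3 /\ 1 / 3 = 1 - 2 * chi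
        & (3 <= p)%N -> exists m : int,
            m%:~R = (lcmn 3 p)%:R * (1 - 2 * chi) /\
            fractional_CY Sg m (lcmn 3 p)]].
Proof.
move=> chi; have p0 : p%:R != 0 :> rat by rewrite pnatr_eq0; lia.
have chiE : chi = p%:R^-1 - 6^-1.
  by rewrite /chi /euler_char !big_cons big_nil; field.
have chi2 : 1 - 2 * chi = (4 * p%:R - 6) / (3 * p%:R) by rewrite chiE; field.
split=> //; first by split=> //; rewrite chiE; field.
  case: p hp {chi p0 chiE chi2} => [|[|m]] // _.
  have [A AE] := Sig_autoequiv k m; exists A; apply/suspension_suspends.
  by rewrite AE; apply: Sig_suspends.
case: p hp chi p0 chiE chi2 => [|[|m]] // _ chi p0 chiE chi2 Sg /suspension_Sig SgE.
have [A AE] := Ser_autoequiv k m; have AS := Ser_is_serre AE.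
split=> [[m0]|m1].
  subst m; split; last by rewrite chi2.
  exists A; split=> //.
    rewrite AE; apply: nat_iso_trans (Ser3 k 0) _.
    apply: nat_iso_trans (nat_iso_sym (fpow1 _)).
    exact: nat_iso_trans (nat_iso_sym (Sig_period2 k)) (nat_iso_sym SgE).
  move=> n' m' n0; rewrite AE => /(CY_dvd3 SgE) d3.
  exact: dvdn_leq.
have [/dvdnP[a aE] /dvdnP[b bE]] : (3 %| lcmn 3 m.+2)%N /\ (m.+2 %| lcmn 3 m.+2)%N.
  by rewrite dvdn_lcml dvdn_lcmr.
(* [lcm (3, p) = 3 a = p b], and [(2p-3) a = p (2a - b)]. *)
have ba : (b <= 2 * a)%N by move: aE bE; move: (lcmn _ _) => L; nia.
exists (2 * (2 * a - b))%N%:Z; split.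
  have e : 3 * a%:R = b%:R * m.+2%:R :> rat.
    by rewrite -!natrM -bE aE mulnC.
  rewrite chi2 -pmulrn aE !natrM natrB // natrM.
  apply: (mulIf (_ : 3 * m.+2%:R != 0 :> rat)); first by rewrite mulf_neq0.
  rewrite -!mulrA mulVf ?mulf_neq0 // mulr1.
  transitivity (2 * (2 * (3 * a%:R) * m.+2%:R - 3 * (b%:R * m.+2%:R)) : rat); first by ring.
  by rewrite -e; ring.
exists A; split=> //.
- by rewrite lcmn_gt0.
- rewrite AE aE mulnC; apply: nat_iso_trans (Ser_pow3 k m a) _; apply: nat_iso_sym.
  apply: nat_iso_trans (Sg_pow_even SgE _) _.
  rewrite (_ : _ * _ = (m.+1%:Z *+ 2 - 1) * a%:Z); first exact: nat_iso_refl.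
  by move: aE bE; move: (lcmn _ _) => L; nia.
move=> n' m' n0; rewrite AE => h.
apply: dvdn_leq => //; rewrite dvdn_lcm (CY_dvd3 SgE h).
by rewrite (CY_dvdp SgE _ h) //; lia.
Qed.
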